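(* Let $p$ be a prime and $A \subseteq \mathbb{F}_p$ with $|A| = n$ and $|A + A| \leq Cn$, for some $C > 0$. Then the following hold. (i) If $2n < \log_2\log_8\log_{32} p - 1$ and $0 \notin A$, then $|A^{-1} + A^{-1}| > \exp\!\left(-C'\frac{\log n}{\log \log n}\right)n^2$, for some $C'$ depending only on $C$. (ii) Let $k$ be a positive integer and $f \in \mathbb{Z}[x]$ a $k$-bounded polynomial of degree at least $2$. If $n < \log_2\log_{8k}\log_{32k^2} p - 1$, then $|f(A) + f(A)| > \exp\!\left(-C'\frac{\log n}{\log \log n}\right)n^2$, for some $C' = C'(C, k)$ depending only on $C$ and $k$.
   Context: $A+A=\{a+b: a,b\in A\}$, $A^{-1}=\{a^{-1}:a\in A\}$, $f(A)=\{f(a):a\in A\}$. A polynomial $f\in\mathbb{Z}[x]$ is $k$-bounded if the sum of the absolute values of its coefficients is at most $k$ and its degree is at most $k$.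
   Formalization: The formal theorem assumes n ≥ 3: for n ≤ 1 the quantity log n / log log n is undefined, and for n = 2 log log n is negative, so the stated bound exceeds n² for every C' > 0 and fails. *)

(* Defs.v *)
From mathcomp Require Import all_boot all_order all_algebra.
From mathcomp Require Import reals sequences exp.

Set Implicit Arguments.
Unset Strict Implicit.
Unset Printing Implicit Defensive.

Import Order.TTheory GRing.Theory Num.Theory.
Local Open Scope ring_scope.

Definition sumset (V : finZmodType) (A B : {set V}) : {set V} :=
  [set a + b | a in A, b in B].

Definition invset (F : finFieldType) (A : {set F}) : {set F} :=
  [set a^-1 | a in A].

Definition polyset (F : finFieldType) (f : {poly int}) (A : {set F}) : {set F} :=
  [set (map_poly intr f).[a] | a in A].

Definition kbounded (k : nat) (f : {poly int}) : bool :=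
  (\sum_(i < size f) absz (f`_i)%R <= k)%N && (size f <= k.+1)%N.

(* As [ln x = 0] for [x <= 0], an iterated logarithm whose inner value is not
   positive is 0. *)
Definition logb (R : realType) (b x : R) : R := ln x / ln b.

(* Main.v *)
(* Plunnecke's inequality and Ruzsa's covering lemma give a set X of at most C^4 elements of F_p
   such that every a + d - e with a, d, e in A is of the form x + d' - e' with x in X and d', e' in
   A; hence a small multiple of each element of A is a small integer combination of X. As X has
   bounded size and p is large compared with n = |A|, the elements of X can be lifted one at a time
   to algebraic numbers of bounded degree and height n^O(1), in such a way that an expression of
   bounded complexity vanishes in F_p if and only if its lift does. The lifts of the elements of A
   then have a common denominator n^O(1).
   In a number field of bounded degree, an algebraic integer of height n^O(1) has at most
   exp(O(log n / log log n)) divisors of height n^O(1): up to boundedly many choices a divisor is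
   determined by its valuations, which are encoded by divisors of a power of a norm, and by the
   sizes of its conjugates. So a nonzero m in F_p has at most that many factorizations m = x y
   where x and y are expressions of bounded complexity in A.
   (i) If 1/a + 1/b = s/t with s = a0 + b0 and t = a0 b0 for some a0, b0 in A, then
   (s a - t)(s b - t) = t^2, so every nonzero c has few representations in A^-1 + A^-1.
   (ii) As a - b divides f(a) - f(b), a nonzero m is the difference of few pairs of values of f on
   A, and the Cauchy-Schwarz inequality turns this into a lower bound for |f(A) + f(A)|. *)
From HB Require Import structures.
Require Import Defs.
From mathcomp Require Import all_boot all_order all_algebra all_field.
From mathcomp Require Import boolp reals sequences exp.
From mathcomp Require classical_sets polyorder.
From mathcomp Require Import zify ring lra.

Set Implicit Arguments.
Unset Strict Implicit.
Unset Printing Implicit Defensive.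

Import Order.TTheory GRing.Theory Num.Theory.
Local Open Scope ring_scope.

Local Notation aut := {rmorphism algC -> algC}.

(** * Conjugates of algebraic numbers *)

Lemma splitting_num_field (p : {poly rat}) : p \is monic ->
  exists (Qn : splittingFieldType rat) (QnC : {rmorphism Qn -> algC}) (s : seq Qn),
    map_poly (in_alg Qn) p = \prod_(z <- s) ('X - z%:P).
Proof.
move=> mon_p.
have [rs Drs] := closed_field_poly_normal (map_poly ratr p : {poly algC}).
have [Qs [QsC [s Ds gen_s]]] := num_field_exists rs.
have Dp : map_poly (in_alg Qs) p = \prod_(z <- s) ('X - z%:P).
  apply: (map_poly_inj QsC); rewrite rmorph_prod -map_poly_comp.
  rewrite (eq_map_poly (_ : _ =1 ratr)) => [|a]; last first.
    by rewrite /= rmorphZ_num rmorph1 mulr1.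
  rewrite Drs (monicP _) ?map_monic // scale1r -Ds big_map.
  by apply: eq_bigr => z _; rewrite /= map_polyXsubC.
have splitQs : SplittingField.axiom Qs.
  exists (map_poly (in_alg Qs) p); last by exists s; rewrite ?Dp ?eqpxx.
  by apply/polyOverP=> i; rewrite coef_map /= memvZ ?mem1v.
pose splitM := FieldExt_isSplittingField.Build rat Qs splitQs.
by exists (HB.pack_for (splittingFieldType rat) Qs splitM), QsC, s.
Qed.

Lemma minCpoly_root_aut (x y : algC) :
  root (minCpoly x) y -> exists nu : aut, nu x = y.
Proof.
have [p [Dp mon_p] dv_p] := minCpolyP x.
have [Qn [QnC [s Ds]]] := splitting_num_field mon_p.
have mapQ q : map_poly QnC (map_poly (in_alg Qn) q) = map_poly ratr q.
  rewrite -map_poly_comp; apply: eq_map_poly => a.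
  by rewrite /= rmorphZ_num rmorph1 mulr1.
have in_Qn z : root (minCpoly x) z -> exists2 z1 : Qn, QnC z1 = z & z1 \in s.
  rewrite Dp -mapQ Ds rmorph_prod (eq_bigr (fun z1 => 'X - (QnC z1)%:P)).
    by rewrite -(big_map _ xpredT (fun z1 => 'X - z1%:P)) root_prod_XsubC => /mapP[z1]; exists z1.
  by move=> z1 _; rewrite /= map_polyXsubC.
move=> /in_Qn[y1 Dy s_y1]; have [x1 Dx _] := in_Qn x (root_minCpoly x).
have y1_conj : root (minPoly (1%AS : {subfield Qn}) x1) y1.
  have /polyOver1P[q Dq] := minPolyOver (1%AS : {subfield Qn}) x1.
  have: root (map_poly ratr q) x by rewrite -Dx -mapQ -Dq fmorph_root root_minPoly.
  rewrite dv_p => /dvdpP[r Dr]; rewrite Dq Dr rmorphM rootM /= Ds.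
  by rewrite root_prod_XsubC s_y1 orbT.
have [s1 _ s1x] : exists2 s1 : gal_of {:Qn}%AS, s1 \in 'Gal({:Qn} / 1)%g & s1 x1 = y1.
  by apply: (@normalField_root_minPoly _ _ 1%AS {:Qn}%AS) => //;
     rewrite ?sub1v ?memvf ?normalFieldf.
have [nu Dnu] := extend_algC_subfield_aut QnC (s1 : {rmorphism Qn -> Qn}).
by exists nu; rewrite -Dx -Dnu -Dy -s1x.
Qed.

Lemma separable_minCpoly (x : algC) : separable_poly (minCpoly x).
Proof.
have [p [Dp mon_p] dv_p] := minCpolyP x; rewrite Dp separable_map.
have p1 : (1 < size p)%N by rewrite -(size_map_poly (ratr : rat -> algC)) -Dp size_minCpoly.
have p0 := monic_neq0 mon_p.
have p'0 : p^`() != 0 by rewrite -size_poly_gt0 polyorder.size_deriv -ltnS prednK // ltnW.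
have no_multiple q : p %| q -> q != 0 -> (size p <= size q)%N by move=> pq q0; apply: dvdp_leq.
rewrite unlock /coprimep; have /dvdpP[h Dh] := dvdp_gcdl p p^`().
have h0 : h != 0 by apply: contraNneq p0 => h0; rewrite Dh h0 mul0r.
have g0 : gcdp p p^`() != 0 by rewrite gcdp_eq0 negb_and p0.
have: root (map_poly ratr (h * gcdp p p^`())) x by rewrite -Dh dv_p.
rewrite rmorphM rootM !dv_p => /orP[/no_multiple/(_ h0)|/dvdp_trans/(_ (dvdp_gcdr _ _))].
  rewrite {1}Dh size_mul //; move: h0 g0; rewrite -!size_poly_gt0.
  by move: (size h) (size (gcdp _ _)) => sh sg; lia.
by move=> /no_multiple/(_ p'0); rewrite leqNgt lt_size_deriv.
Qed.

Definition conjugates (x : algC) : seq algC := sval (closed_field_poly_normal (minCpoly x)).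

Lemma minCpolyE x : minCpoly x = \prod_(r <- conjugates x) ('X - r%:P).
Proof.
rewrite /conjugates; case: closed_field_poly_normal => rs /= {1}->.
by rewrite (monicP (minCpoly_monic x)) scale1r.
Qed.

Lemma size_conjugates x : (size (conjugates x)).+1 = size (minCpoly x).
Proof. by rewrite minCpolyE size_prod_XsubC. Qed.

Lemma uniq_conjugates x : uniq (conjugates x).
Proof. by rewrite -separable_prod_XsubC -minCpolyE separable_minCpoly. Qed.

Lemma conjugatesP x r : reflect (exists nu : aut, nu x = r) (r \in conjugates x).
Proof.
rewrite -root_prod_XsubC -minCpolyE; apply: (iffP idP) => [/minCpoly_root_aut // | [nu <-]].
by rewrite -(minCpoly_aut nu) root_minCpoly.
Qed.

Lemma conjugates_id x : x \in conjugates x.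
Proof. by rewrite -root_prod_XsubC -minCpolyE root_minCpoly. Qed.

(** * Norms of algebraic integers *)

Definition absnorm (x : algC) : nat := Num.truncn `|\prod_(r <- conjugates x) r|.

Lemma Aint_conjugates x r : x \in Aint -> r \in conjugates x -> r \in Aint.
Proof. by move=> Ax /conjugatesP[nu <-]; rewrite Aint_aut. Qed.

Lemma prod_conjugates_int x : x \in Aint -> \prod_(r <- conjugates x) r \in Num.int.
Proof.
rewrite unfold_in => /polyOverP/(_ 0%N).
rewrite minCpolyE -horner_coef0 horner_prod (eq_bigr (fun r => - 1 * r)).
  by rewrite big_split /= big_const_seq count_predT iter_mulr_1 rpredMsign.
by move=> r _; rewrite hornerXsubC sub0r mulN1r.
Qed.

Lemma absnormE x : x \in Aint -> exists s : bool,
  (absnorm x)%:R = (-1) ^+ s * \prod_(r <- conjugates x) r.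
Proof.
move=> /prod_conjugates_int Zx; exists (\prod_(r <- conjugates x) r < 0).
by rewrite /absnorm truncnK ?natr_norm_int // real_normrEsign // Rreal_int.
Qed.

Lemma absnorm_gt0 x : x \in Aint -> x != 0 -> (0 < absnorm x)%N.
Proof.
move=> Ax x0; have [s Ds] := absnormE Ax.
rewrite lt0n -(pnatr_eq0 algC) Ds mulf_eq0 signr_eq0 prodf_seq_neq0.
by apply/allP => r /conjugatesP[nu <-]; rewrite fmorph_eq0.
Qed.

Lemma absnorm_divE x : x \in Aint -> x != 0 -> exists s : bool,
  (absnorm x)%:R / x = (-1) ^+ s * \prod_(r <- rem x (conjugates x)) r.
Proof.
move=> Ax x0; have [s Ds] := absnormE Ax; exists s.
by rewrite Ds (big_rem _ (conjugates_id x)) /= [x * _]mulrC mulrA mulfK.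
Qed.

Lemma Aint_absnorm_div x : x \in Aint -> x != 0 -> (absnorm x)%:R / x \in Aint.
Proof.
move=> Ax /(absnorm_divE Ax)[s ->]; rewrite rpredMsign big_seq rpred_prod // => r.
by move/mem_rem/Aint_conjugates; apply.
Qed.

Section AbsnormBounds.
Variables (D b : nat) (x : algC).
Hypotheses (b_gt0 : (0 < b)%N) (deg_x : (size (conjugates x) <= D)%N).
Hypotheses (Ax : x \in Aint) (x0 : x != 0) (le_xb : forall nu : aut, `|nu x| <= b%:R).

Lemma norm_prod_conjugates_le (nu : aut) (s : seq algC) :
  {subset s <= conjugates x} -> (size s <= D)%N -> `|nu (\prod_(r <- s) r)| <= (b ^ D)%:R.
Proof.
move=> sub_s le_sD; rewrite rmorph_prod normr_prod.
apply: le_trans (_ : \prod_(r <- s) b%:R <= _); last first.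
  by rewrite big_const_seq count_predT iter_mulr_1 -natrX ler_nat leq_pexp2l.
rewrite big_seq [leRHS]big_seq; apply: ler_prod => r /sub_s/conjugatesP[nu' <-].
by rewrite normr_ge0 (le_xb [the aut of nu \o nu']).
Qed.

Lemma absnorm_le : (absnorm x <= b ^ D)%N.
Proof.
have [s Ds] := absnormE Ax; rewrite -(ler_nat algC) -[leLHS]normr_nat Ds normrMsign.
exact: (norm_prod_conjugates_le idfun).
Qed.

Lemma absnorm_div_le (nu : aut) : `|nu ((absnorm x)%:R / x)| <= (b ^ D)%:R.
Proof.
have [s ->] := absnorm_divE Ax x0; rewrite rmorphM rmorph_sign normrMsign.
apply: norm_prod_conjugates_le; first exact: mem_rem.
by rewrite size_rem ?conjugates_id // (leq_trans (leq_pred _)).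
Qed.

Lemma norm_ge_absnorm (nu : aut) : 1 <= (b ^ D)%:R * `|nu x|.
Proof.
apply: le_trans (_ : `|nu (absnorm x)%:R| <= _).
  by rewrite rmorph_nat normr_nat (ler_nat _ 1) absnorm_gt0.
by rewrite -{1}[(absnorm x)%:R](divfK x0) rmorphM normrM ler_wpM2r ?absnorm_div_le.
Qed.
End AbsnormBounds.

(** * Northcott's theorem for algebraic integers *)

Lemma coef_prod_XsubC_le (R : numDomainType) (b : R) (rs : seq R) i : 0 <= b ->
  (forall r, r \in rs -> `|r| <= b) ->
  `|(\prod_(r <- rs) ('X - r%:P))`_i| <= (1 + b) ^+ size rs.
Proof.
move=> b0; elim: rs i => [|r rs IHrs] i le_b.
  by rewrite big_nil expr0 coef1; case: (i == 0%N); rewrite ?normr1 ?normr0.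
have {}IHrs j : `|(\prod_(r <- rs) ('X - r%:P))`_j| <= (1 + b) ^+ size rs.
  by apply: IHrs => x x_rs; apply: le_b; rewrite inE x_rs orbT.
rewrite big_cons mulrBl coefB coefXM mul_polyC coefZ /= exprS mulrDl mul1r.
apply: le_trans (ler_normB _ _) (lerD _ _).
  by case: (i == 0%N); rewrite ?IHrs // normr0 exprn_ge0 // addr_ge0.
by rewrite normrM ler_pM // le_b ?mem_head.
Qed.

Lemma coef_minCpoly_int (D b : nat) x i : x \in Aint -> (size (conjugates x) <= D)%N ->
  (forall nu : aut, `|nu x| <= b%:R) ->
  exists k : 'I_(2 * b.+1 ^ D).+1, (minCpoly x)`_i = k%:R - (b.+1 ^ D)%:R.
Proof.
move=> Ax deg_x le_xb; set M := (b.+1 ^ D)%N.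
have Zi : (minCpoly x)`_i \in Num.int by move: Ax; rewrite unfold_in => /polyOverP.
have: `|(minCpoly x)`_i| <= M%:R.
  rewrite minCpolyE; apply: le_trans (coef_prod_XsubC_le _ (ler0n _ b) _) _.
    by move=> r /conjugatesP[nu <-].
  by rewrite nat1r -natrX ler_nat leq_pexp2l.
rewrite real_ler_norml ?Rreal_int // => /andP[ge_M le_M].
have /natrP[k Dk] : (minCpoly x)`_i + M%:R \in Num.nat
  by rewrite natrEint rpredD ?rpred_nat //= -lerBlDr sub0r.
suff lt_k : (k < (2 * M).+1)%N by exists (Ordinal lt_k); rewrite -Dk addrK.
by rewrite ltnS -(ler_nat algC) -Dk mul2n -addnn natrD lerD2r.
Qed.

Theorem Northcott_Aint (D b : nat) : exists K : nat, forall s : seq algC, uniq s ->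
  (forall x, x \in s -> [/\ x \in Aint, (size (conjugates x) <= D)%N
     & forall nu : aut, `|nu x| <= b%:R]) ->
  (size s <= K)%N.
Proof.
pose M := (b.+1 ^ D)%N; pose coefs := {ffun 'I_D.+1 -> 'I_(2 * M).+1}.
pose poly_of (t : coefs) : {poly algC} := \poly_(i < D.+1) ((t (inord i))%:R - M%:R).
pose roots_of (p : {poly algC}) := sval (closed_field_poly_normal p).
exists (size (flatten [seq roots_of (poly_of t) | t <- enum {: coefs}])).
move=> s uniq_s bounded_s; apply: uniq_leq_size => // x /bounded_s[Ax deg_x le_xb].
have [t Dt] := fin_all_exists (fun i : 'I_D.+1 => coef_minCpoly_int i Ax deg_x le_xb).
apply/flattenP; exists (conjugates x); last exact: conjugates_id.
apply/mapP; exists (finfun t); rewrite ?mem_enum //; congr roots_of.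
apply/polyP => i; rewrite coef_poly; case: ltnP => [lt_iD|le_Di].
  by rewrite ffunE -Dt inordK.
by rewrite nth_default // -size_conjugates (leq_ltn_trans deg_x).
Qed.

(** * The divisor bound for natural numbers *)

Section DivisorBound.
Local Open Scope nat_scope.

Lemma leq_wexp2r m n e : m <= n -> m ^ e <= n ^ e.
Proof. by case: e => // e; rewrite leq_exp2r. Qed.

Lemma leq_self_exp m e : 0 < e -> m <= m ^ e.
Proof. by case: m => // m e_gt0; rewrite -[leqLHS]expn1 leq_pexp2l. Qed.

Lemma size_divisors n : size (divisors n) = \prod_(p <- primes n) (logn p n).+1.
Proof.
transitivity (\prod_(f <- prime_decomp n) f.2.+1); last by rewrite prime_decompE big_map.
rewrite /divisors; elim: (prime_decomp n) => [|[p e] f IHf]; first by rewrite big_nil.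
rewrite big_cons /= -IHf mulSn addnC; elim: e => //= e IHe.
by rewrite size_merge size_cat size_map IHe mulSnr.
Qed.

Lemma logn_le_trunc_log p n : logn p n <= trunc_log 2 n.
Proof.
have [->|n_gt0] := posnP n; first by rewrite logn0.
have [p_pr|/negPf p_npr] := boolP (prime p); last by rewrite lognE p_npr.
apply: trunc_log_max => //; apply: leq_trans (dvdn_leq n_gt0 (pfactor_dvdnn p n)).
by rewrite leq_wexp2r // prime_gt1.
Qed.

Lemma succ_exponent_le t L p e : e <= L ->
  0 < p -> e.+1 ^ t <= (if p < 2 ^ t then L.+1 ^ t else 1) * p ^ e.
Proof.
move=> le_eL p_gt0; have [_|le_tp] := ltnP p (2 ^ t).
  by apply: leq_trans (leq_pmulr _ _); rewrite ?expn_gt0 ?p_gt0 // leq_wexp2r.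
rewrite mul1n; apply: leq_trans (_ : (2 ^ e) ^ t <= _).
  by rewrite leq_wexp2r // ltn_expl.
by rewrite expnAC leq_wexp2r.
Qed.

Theorem divisor_bound t n : 0 < n ->
  size (divisors n) ^ t <= (trunc_log 2 n).+1 ^ (t * 2 ^ t) * n.
Proof.
move=> n_gt0; set L := trunc_log 2 n; rewrite size_divisors.
pose small p := if p < 2 ^ t then L.+1 ^ t else 1.
rewrite (big_morph (expn^~ t) (fun x y => expnMn x y t) (exp1n t)).
apply: leq_trans (_ : \prod_(p <- primes n) (small p * p ^ logn p n) <= _).
  rewrite big_seq [leqRHS]big_seq; apply: leq_prod => p.
  rewrite mem_primes => /and3P[/prime_gt0 p_gt0 _ _].
  by apply: succ_exponent_le; rewrite ?logn_le_trunc_log.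
rewrite big_split /= [X in _ <= _ * X](prod_prime_decomp n_gt0) prime_decompE big_map leq_mul //.
rewrite -big_mkcond -big_filter big_const_seq count_predT iter_muln_1 -expnM.
rewrite leq_pexp2l // leq_mul2l -{2}(size_iota 0 (2 ^ t)); apply/orP; right.
apply: uniq_leq_size; first by rewrite filter_uniq ?primes_uniq.
by move=> p; rewrite mem_filter mem_iota => /andP[].
Qed.
End DivisorBound.

(** * Valuation rings *)

Lemma subringClosed_of_pred (R : pzRingType) (S : pred R) : subring_closed S ->
  exists B : subringClosed R, B =i S.
Proof.
move=> S_subring.
by exists (HB.pack_for (subringClosed R) S (GRing.isSubringClosed.Build R S S_subring)).
Qed.

Lemma subring_closed_chain (R : pzRingType) (F : pred R -> Prop) (S0 : pred R) : F S0 ->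
  (forall S, F S -> subring_closed S) ->
  (forall S T, F S -> F T -> {subset S <= T} \/ {subset T <= S}) ->
  subring_closed (fun x => `[< exists2 S, F S & x \in S >]).
Proof.
move=> FS0 ringF totF.
have common x y : `[< exists2 S, F S & x \in S >] -> `[< exists2 S, F S & y \in S >] ->
    exists S, [/\ F S, x \in S & y \in S].
  move=> /asboolP[S FS xS] /asboolP[T FT yT].
  by have [sub|sub] := totF S T FS FT; [exists T|exists S]; split=> //; apply: sub.
split=> [|x y xF yF|x y xF yF].
- by apply/asboolP; exists S0; have [] := ringF S0 FS0.
- have [S [FS xS yS]] := common x y xF yF; apply/asboolP; exists S => //.
  by have [_ SB _] := ringF S FS; apply: SB.
- have [S [FS xS yS]] := common x y xF yF; apply/asboolP; exists S => //.
  by have [_ _ SM] := ringF S FS; apply: SM.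
Qed.

Lemma maximal_subring_avoiding (R : pzRingType) (A : subringClosed R) (y : R) :
  y \notin A -> exists B : subringClosed R, [/\ {subset A <= B}, y \notin B &
    forall C : subringClosed R, {subset B <= C} -> y \notin C -> {subset C <= B}].
Proof.
move=> Ay; pose avoiding (S : pred R) := [/\ subring_closed S, {subset A <= S} & y \notin S].
have ring_mem (C : subringClosed R) : subring_closed (fun x => x \in C).
  by split=> [|x z|x z]; [apply: rpred1|apply: rpredB|apply: rpredM].
have avoidingA : avoiding (fun x => x \in A) by split; first exact: ring_mem.
pose le (S T : {S | avoiding S}) := `[< {subset sval S <= sval T} >].
have [|||[S [ringS sAS Sy]] maxS] := @classical_sets.ZL_preorder _ (exist _ _ avoidingA) le.
- by move=> S; apply/asboolP.
- by move=> S T U /asboolP sST /asboolP sTU; apply/asboolP => x /sST/sTU.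
- move=> F totF; have [[S0 FS0]|F0] := pselect (exists S, F S); last first.
    by exists (exist _ _ avoidingA) => S FS; case: F0; exists S.
  pose U := fun x => `[< exists2 S, (exists2 T, F T & sval T = S) & x \in S >].
  have avoidingU : avoiding U.
    split.
    + apply: (@subring_closed_chain _ _ (sval S0)); first by exists S0.
        by move=> _ [S _ <-]; have [] := svalP S.
      move=> _ _ [S FS <-] [T FT <-].
      by have [/asboolP|/asboolP] := totF S T FS FT; [left|right].
    + move=> x xA; apply/asboolP; exists (sval S0); first by exists S0.
      by have [_ sAS _] := svalP S0; apply: sAS.
    + by apply/negP => /asboolP[_ [S _ <-]]; apply/negP; have [] := svalP S.
  exists (exist _ U avoidingU) => S FS; apply/asboolP => x xS.
  by apply/asboolP; exists (sval S); first exists S.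
have [B memB] := subringClosed_of_pred ringS; exists B; split=> [x /sAS||C sBC Cy x Cx].
- by rewrite memB.
- by rewrite memB.
have avoidingC : avoiding (fun x => x \in C) by split=> [|z|] // /sAS Sz; apply: sBC; rewrite memB.
have le_SC : le (exist _ S (And3 ringS sAS Sy)) (exist _ _ avoidingC).
  by apply/asboolP => z Sz; apply: sBC; rewrite memB.
by have /asboolP/(_ x Cx) := maxS _ le_SC; rewrite memB.
Qed.

Section SubringType.
Variables (L : fieldType) (B : subringClosed L).

Definition subring_type : Type := {x : L | x \in B}.
HB.instance Definition _ := [isSub of subring_type for @sval L (fun x => x \in B)].
HB.instance Definition _ := [Choice of subring_type by <:].
HB.instance Definition _ := [SubChoice_isSubComNzRing of subring_type by <:].

Definition subring_val : {rmorphism subring_type -> L} := \val.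

Definition integral_over : L -> Prop := integralOver subring_val.

Lemma integral_over_mem x : x \in B -> integral_over x.
Proof. by move=> Bx; apply: (integral_id subring_val (Sub x Bx)). Qed.

Lemma integral_overP x : integral_over x <->
  exists p : {poly L}, [/\ p \is monic, p \is a polyOver B & root p x].
Proof.
split=> [[p mon_p px]|[p [mon_p Bp px]]].
  exists (map_poly subring_val p); split=> //; first exact: monic_map.
  by apply/polyOverP => i; rewrite coef_map; apply: valP.
apply: integral_root_monic mon_p px _; apply/integral_poly => i.
exact/integral_over_mem/(polyOverP Bp).
Qed.

Lemma integral_over_horner (p : {poly L}) x :
  p \is a polyOver B -> integral_over x -> integral_over p.[x].
Proof.
move=> Bp; apply: integral_horner; apply/integral_poly => i.
exact/integral_over_mem/(polyOverP Bp).
Qed.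

Lemma lead_coef_mul_root_mem (p : {poly L}) x :
  x^-1 \in B -> p \is a polyOver B -> root p x -> lead_coef p * x \in B.
Proof.
move=> BVx Bp px; have [->|x0] := eqVneq x 0; first by rewrite mulr0 rpred0.
have [->|p0] := eqVneq p 0; first by rewrite lead_coef0 mul0r rpred0.
have := root_size_gt1 p0 px; have /eqP := px; rewrite horner_coef lead_coefE.
case: (size p) => [|[|d]] //=; rewrite big_ord_recr /= addrC => /eqP.
rewrite addr_eq0 => /eqP {}px _.
have -> : p`_d.+1 * x = - \sum_(i < d.+1) p`_i * x^-1 ^+ (d - i).
  transitivity (p`_d.+1 * x ^+ d.+1 * x^-1 ^+ d).
    by rewrite exprS exprVn mulrA mulfK ?expf_neq0.
  rewrite px mulNr mulr_suml; congr (- _); apply: eq_bigr => i _.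
  by rewrite -mulrA !exprVn expfB_cond ?(negPf x0) ?add0n -1?ltnS // invf_div.
by rewrite rpredN rpred_sum // => i _; rewrite rpredM ?rpredX ?(polyOverP Bp).
Qed.

Lemma integral_inv_mem x : x^-1 \in B -> integral_over x -> x \in B.
Proof.
move=> BVx /integral_overP[p [mon_p Bp px]].
by rewrite -[x]mul1r -(monicP mon_p) lead_coef_mul_root_mem.
Qed.
End SubringType.

(** * Chevalley's extension theorem *)

Definition valuation_ring (L : fieldType) (B : subringClosed L) :=
  forall x, x \in B \/ x^-1 \in B.

Section MaximalAvoiding.
Variables (L : fieldType) (B : subringClosed L) (pi : L).
Hypotheses (Bpi : pi \in B) (BVpi : pi^-1 \notin B).
Hypothesis maxB : forall C : subringClosed L,
  {subset B <= C} -> pi^-1 \notin C -> {subset C <= B}.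

Lemma adjoin_avoided x : x \notin B ->
  exists2 p : {poly L}, p \is a polyOver B & p.[x] = pi^-1.
Proof.
move=> Bx; apply: contrapT => avoids.
pose S : pred L := fun y => `[< exists2 p, p \is a polyOver B & p.[x] = y >].
have [|C memC] := @subringClosed_of_pred _ S.
  split=> [|_ _ /asboolP[p Bp <-] /asboolP[q Bq <-]|_ _ /asboolP[p Bp <-] /asboolP[q Bq <-]].
  - by apply/asboolP; exists 1; rewrite ?rpred1 ?hornerE.
  - by apply/asboolP; exists (p - q); rewrite ?rpredB ?hornerE.
  - by apply/asboolP; exists (p * q); rewrite ?rpredM ?hornerE.
move/negP: Bx; apply; apply: (maxB (C := C)).
- by move=> y By; rewrite memC; apply/asboolP; exists y%:P; rewrite ?polyOverC ?hornerE.
- by rewrite memC; apply/negP => /asboolP.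
- by rewrite memC; apply/asboolP; exists 'X; rewrite ?polyOverX ?hornerE.
Qed.

Lemma maximal_integrally_closed x : integral_over B x -> x \in B.
Proof.
move=> int_x; apply: contrapT => /negP/adjoin_avoided[p Bp Dp].
move/negP: BVpi; apply; apply: integral_inv_mem; rewrite ?invrK // -Dp.
exact: integral_over_horner.
Qed.

Lemma maximal_inv_1B r : r \in B -> (1 - pi * r)^-1 \in B.
Proof.
move=> Br; apply: contrapT => /negP/adjoin_avoided[p Bp].
set c := 1 - pi * r => Dp; have Bc : c \in B by rewrite rpredB ?rpred1 ?rpredM.
have pi0 : pi != 0 by apply: contraNneq BVpi => ->; rewrite invr0 rpred0.
have c_exp n : exists2 e, e \in B & c ^+ n = 1 - pi * e.
  elim: n => [|n [e Be De]]; first by exists 0; rewrite ?rpred0 // expr0 mulr0 subr0.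
  exists (e + r - pi * r * e); first by rewrite !(rpredB, rpredD, rpredM).
  by rewrite exprS De /c; ring.
have [e Be De] := c_exp (size p).
have c0 : c != 0.
  by apply: contraNneq BVpi => c0; rewrite -Dp c0 invr0 horner_coef0 (polyOverP Bp).
move/negP: BVpi; apply.
have -> : pi^-1 = c ^+ size p * p.[c^-1] + e.
  by rewrite Dp De mulrBl mul1r [pi * e]mulrC mulfK // subrK.
rewrite rpredD // horner_coef mulr_sumr rpred_sum // => i _.
rewrite mulrCA exprVn -expfB_cond ?(negPf c0) ?add0n 1?ltnW //.
by rewrite rpredM ?rpredX ?(polyOverP Bp).
Qed.

(* If 1 / x is not in B, then 1 / pi is a polynomial r in 1 / x over B; since 1 - pi r(0)
   is invertible in B, multiplying 1 = pi r(1 / x) by a power of x yields a monic equation for x. *)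
Lemma maximal_valuation_ring : valuation_ring B.
Proof.
move=> x; have [Bx|BVx] := boolP (x^-1 \in B); [by right | left].
apply: maximal_integrally_closed; have [r Br Dr] := adjoin_avoided BVx.
have pi0 : pi != 0 by apply: contraNneq BVpi => ->; rewrite invr0 rpred0.
have x0 : x != 0 by apply: contraNneq BVx => ->; rewrite invr0 rpred0.
have /maximal_inv_1B := polyOverP Br 0%N; set c := 1 - _ => BVc.
have c0 : c != 0.
  rewrite subr_eq0; apply: contraNneq BVpi => E.
  by rewrite -[pi^-1]mulr1 E mulKf // (polyOverP Br).
pose m := (size r).-1.
pose q := 'X^m - \poly_(i < m) (c^-1 * (pi * r`_(m - i))).
have Bq : q \is a polyOver B.
  rewrite rpredB ?polyOverXn // polyOver_poly // => i _.
  by rewrite !rpredM ?(polyOverP Br).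
apply/integral_overP; exists q; split=> //.
  by rewrite monicE lead_coefDl ?lead_coefXn // size_polyN size_polyXn ltnS size_poly.
have sz_r : size r = m.+1.
  rewrite prednK // size_poly_gt0; apply: contraNneq BVpi => r0.
  by rewrite -Dr r0 horner0 rpred0.
have xm : x ^+ m = \sum_(j < m.+1) pi * r`_j * x ^+ (m - j).
  rewrite -[LHS]mulr1 -(divff pi0) -Dr horner_coef sz_r !mulr_sumr.
  apply: eq_bigr => j _; rewrite expfB_cond ?(negPf x0) ?add0n -1?ltnS // exprVn.
  by ring.
rewrite rootE !hornerE horner_poly subr_eq0 -(inj_eq (mulfI c0)) mulrBl mul1r.
rewrite {1}xm big_ord_recl subn0 addrC addKr (reindex_inj rev_ord_inj) mulr_sumr /=.
apply/eqP/eq_bigr => i _; rewrite mulrA mulVKf //.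
by rewrite /bump add1n subnSK // subKn // ltnW.
Qed.
End MaximalAvoiding.

Theorem Chevalley_extension (L : fieldType) (A : subringClosed L) (x : L) :
  x \in A -> x^-1 \notin A -> exists B : subringClosed L,
    [/\ {subset A <= B}, x^-1 \notin B & valuation_ring B].
Proof.
move=> Ax /maximal_subring_avoiding[B [sAB BVx maxB]]; exists B; split=> //.
exact: maximal_valuation_ring (sAB x Ax) BVx maxB.
Qed.

(** * Units and valuations *)

Section ValuationRingUnits.
Variables (L : fieldType) (B : subringClosed L).
Hypothesis valB : valuation_ring B.
Implicit Types x y : L.

Definition unit_of : {pred L} := fun x => [&& x != 0, x \in B & x^-1 \in B].

Lemma unit_ofP x : reflect [/\ x != 0, x \in B & x^-1 \in B] (x \in unit_of).
Proof. exact: and3P. Qed.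

Fact unit_of_sdivr_closed : GRing.sdivr_closed unit_of.
Proof.
split=> [|x y /unit_ofP[x0 Bx BVx] /unit_ofP[y0 By BVy]]; apply/unit_ofP.
  by rewrite invrN invr1 oppr_eq0 oner_neq0 !rpredN rpred1.
by rewrite invf_div !rpredM // mulf_neq0 ?invr_eq0.
Qed.
HB.instance Definition _ := GRing.isSdivClosed.Build L unit_of unit_of_sdivr_closed.

Lemma unit_of_mem x : x \in unit_of -> x \in B. Proof. by case/unit_ofP. Qed.

Lemma integral_mem_valuation_ring x : integral_over B x -> x \in B.
Proof. by have [//|BVx] := valB x; apply: integral_inv_mem. Qed.

Lemma lead_coef_mul_root_valuation_ring (p : {poly L}) x :
  p \is a polyOver B -> root p x -> lead_coef p * x \in B.
Proof.
move=> Bp px; have [Bx|BVx] := valB x; last exact: lead_coef_mul_root_mem.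
by rewrite rpredM // lead_coefE (polyOverP Bp).
Qed.

Lemma unit_exp_mem x n : (0 < n)%N -> x ^+ n \in unit_of -> x \in B.
Proof.
move=> n_gt0 /unit_ofP[_ Bxn _]; apply/integral_mem_valuation_ring/integral_overP.
exists ('X^n - (x ^+ n)%:P); split; first exact: monicXnsubC.
  by rewrite rpredB ?polyOverXn ?polyOverC.
by rewrite rootE !hornerE subrr.
Qed.

Lemma nonunitM x y : x \in B -> y \in B -> x \notin unit_of -> x * y \notin unit_of.
Proof.
move=> Bx By; apply: contra => /unit_ofP[]; rewrite mulf_eq0 negb_or => /andP[x0 y0] _ BVxy.
apply/unit_ofP; split=> //; rewrite (_ : x^-1 = (x * y)^-1 * y) ?rpredM //.
by rewrite invfM mulfVK.
Qed.

Lemma nonunitD x y : x \in B -> y \in B -> x \notin unit_of -> y \notin unit_of ->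
  x + y \notin unit_of.
Proof.
have div_mem u v : u \in B -> v \in B -> v \notin unit_of -> v != 0 -> u / v \in B ->
    u + v \notin unit_of.
  move=> Bu Bv nUv v0 Buv; apply: contra nUv => /unit_ofP[s0 _ BVs].
  apply/unit_ofP; split=> //; have -> : v^-1 = (u / v + 1) * (u + v)^-1.
    by rewrite -(divff v0) -mulrDl mulrAC divff ?mul1r.
  by rewrite rpredM ?rpredD ?rpred1.
move=> Bx By nUx nUy.
have [->|x0] := eqVneq x 0; first by rewrite add0r.
have [->|y0] := eqVneq y 0; first by rewrite addr0.
have [Bxy|] := valB (x / y); first exact: div_mem.
by rewrite invf_div => Byx; rewrite addrC div_mem.
Qed.

Lemma nonunit_sum (I : Type) (r : seq I) (P : pred I) (F : I -> L) :
  (forall i, P i -> F i \in B /\ F i \notin unit_of) ->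
  \sum_(i <- r | P i) F i \notin unit_of.
Proof.
move=> nonunitF.
have [] // : \sum_(i <- r | P i) F i \in B /\ \sum_(i <- r | P i) F i \notin unit_of.
apply: (big_ind (fun x => x \in B /\ x \notin unit_of)) => //.
  by rewrite rpred0; split=> //; apply/unit_ofP; case; rewrite eqxx.
by move=> x y [Bx nUx] [By nUy]; rewrite rpredD // nonunitD.
Qed.

Lemma least_valuation (s : seq L) : s != [::] -> 0 \notin s ->
  exists2 x, x \in s & forall y, y \in s -> y / x \in B.
Proof.
elim: s => // x [|x' s] IHs _ /norP[x0 s0].
  by exists x; rewrite ?mem_head // => y /[!inE]/eqP->; rewrite divff ?rpred1 // eq_sym.
have [z zs min_z] := IHs isT s0; rewrite eq_sym in x0.
have z0 : z != 0 by apply: contraNneq s0 => <-.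
have [Bxz|] := valB (x / z).
  exists z; first by rewrite inE zs orbT.
  by move=> y; rewrite inE => /predU1P[->|/min_z].
rewrite invf_div => Bzx; exists x; first exact: mem_head.
move=> y; rewrite inE => /predU1P[->|/min_z Byz]; first by rewrite divff ?rpred1.
by rewrite -[y](divfK z0) -(mulrA (y / z)) rpredM.
Qed.

(* In a vanishing sum the least valuation is attained at least twice. *)
Lemma sum_eq0_ratio_unit (I : eqType) (s : seq I) (t : I -> L) : uniq s -> s != [::] ->
  (forall i, i \in s -> t i != 0) -> \sum_(i <- s) t i = 0 ->
  exists i j, [/\ i \in s, j \in s, i != j & t i / t j \in unit_of].
Proof.
move=> uniq_s s_neq0 t0 sum_t.
have [||_ /mapP[j js ->] min_j] := least_valuation (s := map t s).
- by case: (s) s_neq0.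
- by apply/mapP => -[i /t0 ti0 E]; rewrite -E eqxx in ti0.
have tj0 := t0 j js; apply: contrapT => no_tie.
have: \sum_(i <- s | (i \in s) && (i != j)) t i / t j \notin unit_of.
  apply: nonunit_sum => i /andP[i_s i_neq_j]; split; first exact/min_j/map_f.
  by apply/negP => U; apply: no_tie; exists i, j.
rewrite -big_seq_cond -mulr_suml; move: sum_t; rewrite (bigD1_seq j) //= => /eqP.
by rewrite addrC addr_eq0 => /eqP ->; rewrite mulNr divff // rpredN /= rpred1.
Qed.
End ValuationRingUnits.

Section PrimeInValuationRing.
Variables (L : fieldType) (B : subringClosed L) (q : nat).
Hypotheses (valB : valuation_ring B) (q_pr : prime q) (BVq : (q%:R : L)^-1 \notin B).

Implicit Types x y : L.

Let q0 : q%:R != 0 :> L.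
Proof. by apply: contraNneq BVq => ->; rewrite invr0 rpred0. Qed.

Lemma coprime_nat_unit c : coprime c q -> c%:R \in unit_of B.
Proof.
move=> co_cq; apply: contrapT => /negP nUc.
have nUq : q%:R \notin unit_of B by apply/unit_ofP => -[_ _]; apply/negP.
have c_gt0 : (0 < c)%N.
  by case: c co_cq {nUc} => //; rewrite /coprime gcd0n => /eqP q1; move: q_pr; rewrite q1.
have [u v Duv _] := egcdnP q c_gt0; move: Duv; rewrite (eqP co_cq) => Duv.
have : c%:R * u%:R + - (q%:R * v%:R) \notin unit_of B.
  by rewrite nonunitD ?rpredN ?nonunitM ?rpredM ?rpred_nat.
by rewrite -!natrM mulnC Duv natrD mulnC addrC addKr rpred1.
Qed.

Lemma nat_unit_logn n : (0 < n)%N -> n%:R / q%:R ^+ logn q n \in unit_of B.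
Proof.
move=> n_gt0; have [m co_qm Dn] := pfactor_coprime q_pr n_gt0.
by rewrite {1}Dn natrM natrX mulfK ?expf_neq0 // coprime_nat_unit // coprime_sym.
Qed.

Lemma nat_neq0 n : (0 < n)%N -> n%:R != 0 :> L.
Proof. by move=> /nat_unit_logn/unit_ofP[]; rewrite mulf_eq0 negb_or => /andP[]. Qed.

Lemma int_unit_logn (z : int) : z != 0 -> z%:~R / q%:R ^+ logn q `|z| \in unit_of B.
Proof.
move=> z0; have -> : z%:~R = (-1) ^+ (z < 0)%R * `|z|%N%:R :> L.
  by rewrite {1}(intEsign z) rmorphM rmorph_sign.
by rewrite -mulrA rpredMsign nat_unit_logn ?absz_gt0.
Qed.

Lemma prime_exp_div_mem a c : q%:R ^+ a / q%:R ^+ c \in B -> (c <= a)%N.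
Proof.
move=> Bac; rewrite leqNgt; apply/negP => lt_ac; move/negP: BVq; apply.
have -> : (q%:R : L)^-1 = q%:R ^+ a / q%:R ^+ c * q%:R ^+ (c - a.+1).
  have -> : (q%:R : L) ^+ c = q%:R ^+ a * (q%:R * q%:R ^+ (c - a.+1)).
    by rewrite -exprS -exprD -addSnnS subnKC.
  by field; rewrite ?expf_neq0 ?q0.
by rewrite rpredM // -natrX rpred_nat.
Qed.

Lemma root_int_poly_exponent (p : {poly int}) x : p != 0 -> x != 0 ->
  root (map_poly intr p) x ->
  exists e a c, (0 < e < size p)%N /\ x ^+ e * q%:R ^+ a / q%:R ^+ c \in unit_of B.
Proof.
move=> p0 x0 px; pose s := [seq i <- iota 0 (size p) | p`_i != 0].
pose t i : L := (p`_i)%:~R * x ^+ i.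
have s_lt i : i \in s -> p`_i != 0 /\ (i < size p)%N.
  by rewrite mem_filter mem_iota add0n => /andP[pi0 /andP[]].
have int0 (z : int) : z != 0 -> z%:~R != 0 :> L.
  by move=> /int_unit_logn/unit_ofP[]; rewrite mulf_eq0 negb_or => /andP[].
have t0 i : i \in s -> t i != 0.
  by move=> /s_lt[pi0 _]; rewrite mulf_neq0 ?expf_neq0 ?int0.
have sum_t : \sum_(i <- s) t i = 0.
  rewrite big_filter -[RHS](eqP px) (@horner_coef_wide _ (size p)) ?size_poly //.
  rewrite -(big_mkord xpredT (fun i => (map_poly intr p)`_i * x ^+ i)) /index_iota subn0.
  rewrite big_mkcond; apply: eq_bigr => i _; rewrite coef_map_id0 // /t.
  by case: eqP => [->|] //; rewrite mul0r.
have s_neq0 : s != [::].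
  apply/negP => /eqP s0; have := mem_filter (fun i => p`_i != 0) (size p).-1 (iota 0 (size p)).
  by rewrite -/s s0 mem_iota -lead_coefE lead_coef_eq0 p0 add0n ltn_predL size_poly_gt0 p0.
have [i [j [i_s j_s]]] := sum_eq0_ratio_unit valB (filter_uniq _ (iota_uniq _ _)) s_neq0 t0 sum_t.
wlog lt_ji : i j i_s j_s / (j < i)%N => [oriented|_ Uij].
  rewrite neq_ltn => /orP[lt_ij|lt_ji]; last by apply: oriented; rewrite // gtn_eqF.
  by rewrite -invf_div rpredV; apply: oriented; rewrite // gtn_eqF.
have [[pi0 lt_i] [pj0 _]] := (s_lt i i_s, s_lt j j_s).
exists (i - j)%N, (logn q `|p`_i|), (logn q `|p`_j|); split.
  by rewrite subn_gt0 lt_ji (leq_ltn_trans (leq_subr _ _)).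
have -> : x ^+ (i - j) * q%:R ^+ logn q `|p`_i| / q%:R ^+ logn q `|p`_j| =
    (t i / t j) * ((p`_j)%:~R / q%:R ^+ logn q `|p`_j|)
                / ((p`_i)%:~R / q%:R ^+ logn q `|p`_i|).
  rewrite /t expfB //; field.
  by rewrite !expf_neq0 ?q0 ?x0 ?int0.
by apply: rpredM; [apply: rpredM|rewrite rpredV]; rewrite ?int_unit_logn.
Qed.

Lemma unit_exp_fact_exponent D x : x \in B -> x != 0 ->
  (exists p : {poly int}, [/\ p != 0, (size p <= D.+1)%N & root (map_poly intr p) x]) ->
  exists s, x ^+ D`! / q%:R ^+ s \in unit_of B.
Proof.
move=> Bx x0 [p [p0 sz_p px]].
have [e [a [c [/andP[e_gt0 lt_ep] Ue]]]] := root_int_poly_exponent p0 x0 px.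
have le_ac : (a <= c)%N.
  apply: prime_exp_div_mem; have -> : (q%:R : L) ^+ c / q%:R ^+ a =
      x ^+ e * (x ^+ e * q%:R ^+ a / q%:R ^+ c)^-1.
    by field; rewrite ?expf_neq0 ?q0 ?x0.
  by rewrite rpredM ?rpredX // unit_of_mem ?rpredV.
have e_dvd : (e %| D`!)%N by rewrite dvdn_fact // e_gt0 -ltnS (leq_trans lt_ep).
exists ((c - a) * (D`! %/ e))%N.
have -> : x ^+ D`! / q%:R ^+ ((c - a) * (D`! %/ e)) =
    (x ^+ e * q%:R ^+ a / q%:R ^+ c) ^+ (D`! %/ e).
  rewrite -{1}(divnK e_dvd) mulnC !exprM -expr_div_n; congr (_ ^+ _).
  by rewrite -{2}(subnKC le_ac) exprD; field; rewrite ?expf_neq0 ?q0.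
exact: rpredX.
Qed.

Lemma exponent_le_logn w s x n : (0 < n)%N -> x != 0 -> x ^+ w / q%:R ^+ s \in unit_of B ->
  n%:R / x \in B -> (s <= w * logn q n)%N.
Proof.
move=> n_gt0 x0 Ux Bnx; apply: prime_exp_div_mem.
have -> : (q%:R : L) ^+ (w * logn q n) / q%:R ^+ s =
    (n%:R / q%:R ^+ logn q n) ^- w * (x ^+ w / q%:R ^+ s) * (n%:R / x) ^+ w.
  rewrite !expr_div_n invf_div mulnC exprM.
  by field; rewrite ?expf_neq0 ?q0 ?x0 ?nat_neq0.
rewrite rpredM ?rpredX // unit_of_mem // rpredM // rpredV rpredX //.
exact: nat_unit_logn.
Qed.

Lemma ratr_mem_den (a : rat) : ratr a \in B -> ~~ (q %| `|denq a|)%N.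
Proof.
move=> Ba; apply/negP => q_dvd.
have co_num : coprime `|numq a| q.
  by rewrite coprime_sym; apply: coprime_dvdl q_dvd _; rewrite coprime_sym coprime_num_den.
have Unum : (numq a)%:~R \in unit_of B.
  by rewrite (intEsign (numq a)) rmorphM rmorph_sign rpredMsign coprime_nat_unit.
have [num0 _ BVnum] := unit_ofP _ _ Unum.
move/negP: BVq; apply; have -> : (q%:R : L)^-1 = ratr a * (numq a)%:~R^-1 * (`|denq a| %/ q)%:R.
  have den_gt0 : (0 < `|denq a| %/ q)%N.
    by rewrite divn_gt0 ?prime_gt0 // dvdn_leq // absz_gt0 denq_neq0.
  have Dden : (denq a)%:~R = (`|denq a| %/ q)%:R * q%:R :> L.
    by rewrite -natrM divnK // -[in LHS](gez0_abs (ltW (denq_gt0 a))).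
  rewrite /ratr Dden; field.
  by rewrite num0 q0 nat_neq0.
exact: rpredM (rpredM Ba BVnum) (rpred_nat _ _).
Qed.
End PrimeInValuationRing.

Definition valuation_ring_above (q : nat) (B : subringClosed algC) :=
  [/\ {subset Aint <= B}, q%:R^-1 \notin B & valuation_ring B].

Lemma valuation_ring_above_exists q : prime q -> exists B, valuation_ring_above q B.
Proof.
move=> q_pr; have AqV : q%:R^-1 \notin Aint.
  apply/negP => AqV; have /intrP[z Dz] : (q%:R^-1 : algC) \in Num.int.
    by rewrite Cint_rat_Aint ?rpredV ?rpred_nat.
  have : (z * q)%:~R == 1%:~R :> algC.
    by rewrite rmorphM /= -Dz mulVf // pnatr_eq0 -lt0n prime_gt0.
  rewrite eqr_int => /eqP/(congr1 absz)/eqP; rewrite abszM absz_nat muln_eq1 => /andP[_ /eqP q1].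
  by move: q_pr; rewrite q1.
by have [B] := Chevalley_extension (Aint_Cnat (natr_nat _ q)) AqV; exists B.
Qed.

Lemma Aint_valuation_rings x :
  (forall q, prime q -> exists2 B, valuation_ring_above q B & forall nu : aut, nu x \in B) ->
  x \in Aint.
Proof.
move=> in_rings; rewrite unfold_in; apply/polyOverP => k.
have [p [Dp _] _] := minCpolyP x; rewrite Dp coef_map /=; apply/intrP.
suff den1 : `|denq p`_k|%N = 1%N.
  by exists (numq p`_k); rewrite /ratr -[denq _]gez0_abs ?denq_ge0 // den1 divr1.
apply/eqP/negPn/negP => den_neq1.
have q_pr : prime (pdiv `|denq p`_k|).
  by rewrite pdiv_prime // ltn_neqAle eq_sym den_neq1 absz_gt0 denq_neq0.
have [B [_ BVq valB] Bx] := in_rings _ q_pr.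
have : ratr p`_k \in B.
  rewrite -coef_map -Dp minCpolyE; apply/polyOverP; rewrite big_seq rpred_prod // => r.
  by case/conjugatesP=> nu <-; rewrite polyOverXsubC.
by move/(ratr_mem_den valB q_pr BVq); rewrite pdiv_dvd.
Qed.

Lemma Aint_lead_coef_mul_root (p : {poly algC}) x :
  p \is a polyOver Aint -> root p x -> lead_coef p * x \in Aint.
Proof.
move=> Ap px; apply: Aint_valuation_rings => q /valuation_ring_above_exists[B aboveB].
have [sAB _ valB] := aboveB; exists B => // nu; rewrite rmorphM -lead_coef_map.
apply: lead_coef_mul_root_valuation_ring; rewrite ?fmorph_root //.
by apply/polyOverP => i; rewrite coef_map sAB // Aint_aut (polyOverP Ap).
Qed.

(** * Counting divisors in a number field *)

Lemma size_le_fibers (X Y : eqType) (f : X -> Y) (k : nat) (s : seq X) (t : seq Y) :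
  {in s, forall x, f x \in t} -> (forall y, y \in t -> size [seq x <- s | f x == y] <= k)%N ->
  (size s <= size t * k)%N.
Proof.
elim: t s => [|y t IHt] s; first by case: s => // x s /(_ x (mem_head _ _)).
move=> fs le_k; rewrite -(count_predC (fun x => f x == y)) mulSn leq_add //.
  by rewrite -size_filter le_k ?mem_head.
rewrite -size_filter; apply: IHt => [x|z zt].
  by rewrite mem_filter => /andP[/= /negPf ne_y /fs]; rewrite inE ne_y.
apply: leq_trans (le_k z _); last by rewrite inE zt orbT.
by rewrite !size_filter count_filter; apply: sub_count => x /andP[].
Qed.

Lemma size_le_joint_fibers (X Y : eqType) (f : nat -> X -> Y) (D k : nat) (s : seq X) (t : seq Y) :
  (forall i x, (i < D)%N -> x \in s -> f i x \in t) ->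
  (forall u, subseq u s -> (forall i, (i < D)%N -> {in u &, forall x y, f i x = f i y}) ->
     size u <= k)%N ->
  (size s <= size t ^ D * k)%N.
Proof.
elim: D s => [|D IHD] s ft le_k; first by rewrite mul1n le_k.
rewrite expnS -mulnA; apply: (@size_le_fibers _ _ (f D)) => [x xs|z _]; first exact: ft.
apply: IHD => [i x lt_iD|u sub_u const_u].
  by rewrite mem_filter => /andP[_]; apply/ft/ltnW.
apply: le_k => [|i]; first exact: subseq_trans sub_u (filter_subseq _ _).
rewrite ltnS leq_eqVlt => /predU1P[->|]; last exact: const_u.
move=> x y /(mem_subseq sub_u) + /(mem_subseq sub_u).
by rewrite !mem_filter => /andP[/eqP-> _] /andP[/eqP-> _].
Qed.

Lemma logn_prod_primes (s : seq nat) (e : nat -> nat) q :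
  uniq s -> all prime s -> logn q (\prod_(p <- s) p ^ e p)%N = if q \in s then e q else 0%N.
Proof.
elim: s => [|p s IHs] /=; first by rewrite big_nil logn1.
move=> /andP[ps us] /andP[p_pr s_pr].
have prod_gt0 : (0 < \prod_(x <- s) x ^ e x)%N.
  by rewrite big_seq prodn_cond_gt0 // => x /(allP s_pr) x_pr; rewrite expn_gt0 prime_gt0.
have pe_gt0 : (0 < p ^ e p)%N by rewrite expn_gt0 prime_gt0.
rewrite big_cons (lognM _ pe_gt0 prod_gt0) lognX logn_prime // IHs // inE.
have [->|_] := eqVneq q p.
  by rewrite muln1 (negPf ps) addn0.
by rewrite muln0.
Qed.

Lemma prod_primes_dvd (n w : nat) (e : nat -> nat) : (0 < n)%N ->
  (forall q, q \in primes n -> e q <= w * logn q n)%N ->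
  (\prod_(q <- primes n) q ^ e q %| n ^ w)%N.
Proof.
move=> n_gt0 le_e; rewrite {2}(prod_prime_decomp n_gt0) prime_decompE big_map /=.
rewrite (big_morph (expn^~ w) (fun x y => expnMn x y w) (exp1n w)).
rewrite big_seq [X in (_ %| X)%N]big_seq; apply: (big_ind2 (fun x y => x %| y)%N) => //.
  by move=> *; apply: dvdn_mul.
by move=> q q_n; rewrite -expnM mulnC dvdn_exp2l ?le_e.
Qed.

Lemma root_int_poly_Aint x : x \in Aint -> exists p : {poly int},
  [/\ p != 0, size p = (size (conjugates x)).+1 & root (map_poly intr p) x].
Proof.
rewrite unfold_in => /floorpP[p Dp]; exists p; split.
- by apply: contraFneq (minCpoly_eq0 x) => p0; rewrite Dp p0 rmorph0.
- by rewrite size_conjugates Dp size_map_inj_poly //; apply: intr_inj.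
- by rewrite -Dp root_minCpoly.
Qed.

Definition integral_divisor (D N : nat) (x : algC) :=
  [/\ x \in Aint, x != 0, N%:R / x \in Aint & (size (conjugates x) <= D)%N].

Lemma integral_divisor_aut D N x (nu : aut) :
  integral_divisor D N x -> integral_divisor D N (nu x).
Proof.
case=> Ax x0 ANx deg_x; split; rewrite ?Aint_aut ?fmorph_eq0 //.
  by rewrite -(rmorph_nat nu) -fmorph_div Aint_aut.
by rewrite -ltnS size_conjugates minCpoly_aut -size_conjugates.
Qed.

Lemma divisor_exponents_exist (D N : nat) (q : nat) : (0 < N)%N -> prime q ->
  exists (B : subringClosed algC) (v : algC -> nat), valuation_ring_above q B /\
  forall x, integral_divisor D N x ->
    (x ^+ D`! / q%:R ^+ v x \in unit_of B) /\ (v x <= D`! * logn q N)%N.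
Proof.
move=> N_gt0 q_pr; have [B aboveB] := valuation_ring_above_exists q_pr.
have [sAB BVq valB] := aboveB.
have [|v vP] := @boolp.choice algC nat
    (fun x s => integral_divisor D N x -> x ^+ D`! / q%:R ^+ s \in unit_of B).
  move=> x; have [[Ax x0 _ deg_x]|] := pselect (integral_divisor D N x); last by exists 0%N.
  have [p [p0 sz_p px]] := root_int_poly_Aint Ax.
  have [|s Us] := unit_exp_fact_exponent valB q_pr BVq (sAB x Ax) x0 (D := D).
    by exists p; rewrite sz_p.
  by exists s.
exists B, v; split=> // x div_x; have [Ax x0 ANx _] := div_x; split; first exact: vP.
apply: (exponent_le_logn valB q_pr BVq N_gt0 x0 (vP x div_x)); exact: sAB.
Qed.

Lemma divisor_code_exists (D N : nat) : (0 < N)%N -> exists code : algC -> nat,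
  (forall x, integral_divisor D N x -> code x %| N ^ D`!)%N /\
  (forall x y, integral_divisor D N x -> integral_divisor D N y ->
     (forall nu : aut, code (nu x) = code (nu y)) -> x / y \in Aint).
Proof.
move=> N_gt0; have := @boolp.choice nat (subringClosed algC * (algC -> nat))%type
  (fun q Bv => prime q -> valuation_ring_above q Bv.1 /\ forall x, integral_divisor D N x ->
    (x ^+ D`! / q%:R ^+ Bv.2 x \in unit_of Bv.1) /\ (Bv.2 x <= D`! * logn q N)%N).
case=> [q|Bv BvP].
  have [q_pr|nq_pr] := boolP (prime q).
    by have [B [v vP]] := divisor_exponents_exist D N_gt0 q_pr; exists (B, v).
  by have [B _] := valuation_ring_above_exists (isT : prime 2); exists (B, fun=> 0%N).
pose v q := (Bv q).2; pose code x := (\prod_(q <- primes N) q ^ v q x)%N; exists code.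
split=> [x div_x|x y div_x div_y code_xy].
  apply: prod_primes_dvd => // q; rewrite mem_primes => /and3P[q_pr _ _].
  by have [_ /(_ x div_x)[]] := BvP q q_pr.
have code_logn q z : prime q -> integral_divisor D N z -> logn q (code z) = v q z.
  move=> q_pr div_z; rewrite logn_prod_primes ?primes_uniq //; last first.
    by apply/allP => p; rewrite mem_primes => /andP[].
  case: ifPn => // qN; have [_ /(_ z div_z)[_]] := BvP q q_pr.
  by move: qN; rewrite -logn_gt0 lt0n negbK => /eqP ->; rewrite muln0 leqn0 => /eqP.
apply: Aint_valuation_rings => q q_pr; have [above vP] := BvP q q_pr.
have [_ _ valB] := above; exists (Bv q).1 => // nu.
have [div_nx div_ny] := (integral_divisor_aut nu div_x, integral_divisor_aut nu div_y).
have [Ux _] := vP _ div_nx; have [Uy _] := vP _ div_ny.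
have same_v : v q (nu x) = v q (nu y) by rewrite -!code_logn // code_xy.
apply: (unit_exp_mem valB (fact_gt0 D)).
have [_ ny0 _ _] := div_ny; have q0 : (q%:R : algC) != 0 by rewrite pnatr_eq0 -lt0n prime_gt0.
suff -> : nu (x / y) ^+ D`! =
    (nu x ^+ D`! / q%:R ^+ v q (nu x)) / (nu y ^+ D`! / q%:R ^+ v q (nu y)).
  by apply: rpred_div.
by rewrite same_v fmorph_div expr_div_n; field; rewrite !expf_neq0.
Qed.

Definition dyadic_size (R : archiNumDomainType) (x : R) : nat := trunc_log 2 (Num.truncn x).

Lemma dyadic_size_le (R : archiNumDomainType) (x : R) n :
  x <= n%:R -> (dyadic_size x <= trunc_log 2 n)%N.
Proof. by move=> le_xn; rewrite leq_trunc_log // -[n](@natrK R) le_truncn. Qed.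

Lemma eq_dyadic_size_le2 (R : archiNumDomainType) (x y : R) :
  1 <= x -> 1 <= y -> dyadic_size x = dyadic_size y -> x <= 2 * y.
Proof.
move=> x1 y1 eq_xy; have [x0 y0] := (le_trans ler01 x1, le_trans ler01 y1).
have /andP[_ /ltW/le_trans] := truncn_itv x0; apply.
have /andP[le_y _] := truncn_itv y0.
apply: le_trans (_ : 2 * (Num.truncn y)%:R <= _); last by rewrite ler_pM2l.
rewrite -natrM ler_nat; apply: leq_trans (trunc_log_ltn _ (isT : (1 < 2)%N)) _.
rewrite -/(dyadic_size x) eq_xy expnS leq_mul2l trunc_logP //.
by rewrite truncn_gt0.
Qed.

Lemma norm_div_le2 (R : archiNumFieldType) (c x y : R) : 0 < c -> 1 <= c * `|x| -> 1 <= c * `|y| ->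
  dyadic_size (c * `|x|) = dyadic_size (c * `|y|) -> `|x / y| <= 2.
Proof.
move=> c0 x1 y1 /(eq_dyadic_size_le2 x1 y1) le_xy.
have y0 : 0 < `|y| by rewrite -(pmulr_rgt0 _ c0) (lt_le_trans ltr01).
by rewrite normf_div ler_pdivrMr // -(ler_pM2l c0) mulrCA.
Qed.

Definition conjugate_system (D : nat) (mu : nat -> aut) (P : algC -> Prop) :=
  forall nu : aut, exists2 i, (i < D)%N & forall x, P x -> nu x = mu i x.

Lemma size_conjugates_le D mu (P : algC -> Prop) x :
  conjugate_system D mu P -> P x -> (size (conjugates x) <= D)%N.
Proof.
move=> conjP Px; rewrite -[leqRHS](size_iota 0) -(size_map (fun i => mu i x)).
apply: uniq_leq_size (uniq_conjugates x) _ => r /conjugatesP[nu <-].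
by have [i lt_iD ->] := conjP nu; rewrite //; apply/mapP; exists i; rewrite ?mem_iota.
Qed.

Definition bounded_divisor (b : nat) (m x : algC) :=
  [/\ x != 0, x \in Aint, m / x \in Aint & forall nu : aut, `|nu x| <= b%:R].

Lemma bounded_divisor_absnorm D b m x : m \in Aint -> m != 0 ->
  (size (conjugates x) <= D)%N -> bounded_divisor b m x -> integral_divisor D (absnorm m) x.
Proof.
move=> Am m0 deg_x [x0 Ax Amx _]; split=> //.
rewrite (_ : _ / x = ((absnorm m)%:R / m) * (m / x)); last by rewrite mulrA divfK.
by rewrite rpredM ?Aint_absnorm_div.
Qed.

Definition divisor_count_bound (D K : nat) :=
  forall (mu : nat -> aut) (b : nat) (m : algC) (s : seq algC),
  (0 < b)%N -> m != 0 -> m \in Aint -> uniq s ->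
  conjugate_system D mu (fun x => x \in m :: s) ->
  {in s, forall x, bounded_divisor b m x} ->
  (size s <= ((trunc_log 2 (b ^ D.+1)).+1 * size (divisors (absnorm m ^ D`!))) ^ D * K)%N.

(* Up to K choices, a divisor x of m is determined by the valuations of its conjugates,
   recorded in a divisor of a power of the norm of m, and by their sizes up to a factor 2. *)
Theorem count_bounded_divisors D : exists K : nat, divisor_count_bound D K.
Proof.
have [K NorthcottK] := Northcott_Aint D 2; exists K => mu b m s b_gt0 m0 Am uniq_s conj_s bounded_s.
have N_gt0 : (0 < absnorm m)%N by apply: absnorm_gt0.
have deg_s x : x \in s -> (size (conjugates x) <= D)%N.
  by move=> xs; apply: size_conjugates_le conj_s _; rewrite inE xs orbT.
have div_s x : x \in s -> integral_divisor D (absnorm m) x.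
  by move=> xs; apply: bounded_divisor_absnorm (bounded_s x xs); rewrite ?deg_s.
have [code [code_dvd code_inj]] := divisor_code_exists D N_gt0.
pose scaled i x : algC := (b ^ D)%:R * `|mu i x|.
have scaled_ge1 i x : x \in s -> 1 <= scaled i x.
  by move=> xs; have [x0 Ax _ le_xb] := bounded_s x xs; apply: norm_ge_absnorm; rewrite ?deg_s.
rewrite -(size_iota 0 (trunc_log 2 _).+1) -(size_allpairs pair).
apply: (@size_le_joint_fibers _ _ (fun i x => (dyadic_size (scaled i x), code (mu i x)))).
  move=> i x _ xs; have [_ _ _ le_xb] := bounded_s x xs; apply/allpairs_f.
    by rewrite mem_iota ltnS dyadic_size_le // expnSr natrM ler_pM.
  by rewrite -dvdn_divisors ?expn_gt0 ?N_gt0 ?code_dvd //; apply/integral_divisor_aut/div_s.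
case=> [//|y u] sub_u same_data.
have in_s x : x \in y :: u -> x \in s by apply: (mem_subseq sub_u).
have ys := in_s y (mem_head _ _); have [y0 _ _ _] := bounded_s y ys.
rewrite -(size_map (fun x => x / y)); apply: NorthcottK => [|_ /mapP[x xu ->]].
  by rewrite map_inj_uniq ?(subseq_uniq sub_u) //; apply: mulIf; rewrite invr_eq0.
have xs := in_s x xu.
have conj_xy (nu : aut) : exists2 i, (i < D)%N & forall z, z \in [:: x; y; x / y] -> nu z = mu i z.
  have [i lt_iD nuE] := conj_s nu; exists i => // z.
  by rewrite !inE => /or3P[]/eqP->; rewrite ?fmorph_div !nuE // inE ?xs ?ys orbT.
have {}same_data i : (i < D)%N -> dyadic_size (scaled i x) = dyadic_size (scaled i y) /\
    code (mu i x) = code (mu i y).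
  by move=> /same_data/(_ x y xu (mem_head _ _))[].
split.
- apply: code_inj (div_s x xs) (div_s y ys) _ => nu.
  by have [i /same_data[_ code_xy] nuE] := conj_xy nu; rewrite !nuE ?inE ?eqxx ?orbT.
- by apply: (@size_conjugates_le D mu (fun z => z \in [:: x; y; x / y])); rewrite ?inE ?eqxx ?orbT.
move=> nu; have [i /same_data[size_xy _] ->] := conj_xy nu; last by rewrite !inE eqxx ?orbT.
by rewrite fmorph_div (norm_div_le2 _ _ _ size_xy) ?scaled_ge1 // ltr0n expn_gt0 b_gt0.
Qed.

(** * Expressions of bounded depth *)

Section Expressions.
Variable T : comNzRingType.
Implicit Types (S : T -> Prop) (P Q G R : {poly T}).

Fixpoint expressible S (k : nat) (z : T) : Prop :=
  if k is k'.+1 then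
    exists a b c d, [/\ expressible S k' a, expressible S k' b,
      expressible S k' c, expressible S k' d & z = a * b + c * d]
  else [\/ S z, z = 0, z = 1 | z = -1].

Variable S : T -> Prop.
Local Notation expr := (expressible S).

Lemma expressible_const k : [/\ expr k 0, expr k 1 & expr k (-1)].
Proof.
elim: k => [|k [e0 e1 eN1]]; first by split; [apply: Or42|apply: Or43|apply: Or44].
split; [exists 0, 0, 0, 0 | exists 1, 1, 0, 0 | exists 1, (-1), 0, 0]; split=> //.
- by rewrite mul0r addr0.
- by rewrite mul0r addr0 mulr1.
- by rewrite mul0r addr0 mul1r.
Qed.

Lemma expressible0 k : expr k 0. Proof. by case: (expressible_const k). Qed.
Lemma expressible1 k : expr k 1. Proof. by case: (expressible_const k). Qed.
Lemma expressibleN1 k : expr k (-1). Proof. by case: (expressible_const k). Qed.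
#[local] Hint Resolve expressible0 expressible1 expressibleN1 : core.

Lemma expressible_leq k l z : (k <= l)%N -> expr k z -> expr l z.
Proof.
move=> /subnK <-; elim: (l - k)%N => // n IHn ez.
by exists z, 1, 0, 0; rewrite mulr1 mul0r addr0; split=> //; apply: IHn.
Qed.

Lemma expressible_mem k z : S z -> expr k z.
Proof. by move=> Sz; apply: (@expressible_leq 0) => //; apply: Or41. Qed.

Lemma expressibleM k a b : expr k a -> expr k b -> expr k.+1 (a * b).
Proof. by move=> ea eb; exists a, b, 0, 0; rewrite mul0r addr0. Qed.

Lemma expressibleD k a b : expr k a -> expr k b -> expr k.+1 (a + b).
Proof. by move=> ea eb; exists a, 1, b, 1; rewrite !mulr1. Qed.

Lemma expressibleB k a b : expr k a -> expr k b -> expr k.+1 (a - b).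
Proof. by move=> ea eb; exists a, 1, (-1), b; rewrite mulr1 mulN1r. Qed.

Lemma expressibleX k a n : expr k a -> expr (k + n) (a ^+ n).
Proof.
move=> ea; elim: n => [|n IHn]; first by rewrite expr0.
by rewrite exprS addnS; apply: expressibleM => //; apply: expressible_leq ea; rewrite leq_addr.
Qed.

Lemma expressible_sum k (I : eqType) (r : seq I) (f : I -> T) :
  {in r, forall i, expr k (f i)} -> expr (k + size r) (\sum_(i <- r) f i).
Proof.
elim: r => [|i r IHr] ef; first by rewrite big_nil.
rewrite big_cons addnS; apply: expressibleD.
  by apply: expressible_leq (ef i (mem_head _ _)); rewrite leq_addr.
by apply: IHr => j jr; apply: ef; rewrite inE jr orbT.
Qed.

Lemma expressible_sum_ord k n (f : 'I_n -> T) :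
  (forall i, expr k (f i)) -> expr (k + n) (\sum_i f i).
Proof.
move=> ef; rewrite -[\sum_i _]big_enum -[n in (k + n)%N]size_enum_ord.
by apply: expressible_sum => i _.
Qed.

Definition poly_expressible k P := forall i, expr k P`_i.

Lemma poly_expressible_leq k l P : (k <= l)%N -> poly_expressible k P -> poly_expressible l P.
Proof. by move=> le_kl eP i; apply: expressible_leq (eP i). Qed.

Lemma poly_expressible_lead k P : poly_expressible k P -> expr k (lead_coef P).
Proof. by rewrite lead_coefE. Qed.

Lemma poly_expressible0 k : poly_expressible k 0.
Proof. by move=> i; rewrite coef0. Qed.

Lemma poly_expressibleD k P Q :
  poly_expressible k P -> poly_expressible k Q -> poly_expressible k.+1 (P + Q).
Proof. by move=> eP eQ i; rewrite coefD; apply: expressibleD. Qed.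

Lemma poly_expressibleM k n P Q : (size (P * Q)%R <= n)%N ->
  poly_expressible k P -> poly_expressible k Q -> poly_expressible (k.+1 + n) (P * Q).
Proof.
move=> sz_PQ eP eQ i; have [lt_in|le_ni] := ltnP i n; last first.
  by rewrite nth_default ?(leq_trans sz_PQ).
rewrite coefM; apply: (@expressible_leq (k.+1 + i.+1)); first by rewrite leq_add2l.
by apply: expressible_sum_ord => j; apply: expressibleM.
Qed.

Definition pseudo_step P G : {poly T} :=
  lead_coef G *: P - (lead_coef P *: 'X^(size P - size G)) * G.

Lemma coef_pseudo_step P G i : (pseudo_step P G)`_i = lead_coef G * P`_i -
  lead_coef P * (if (i < size P - size G)%N then 0 else G`_(i - (size P - size G))).
Proof. by rewrite coefB coefZ -scalerAl coefZ coefXnM. Qed.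

Lemma poly_expressible_pseudo_step k P G :
  poly_expressible k P -> poly_expressible k G -> poly_expressible k.+2 (pseudo_step P G).
Proof.
move=> eP eG i; rewrite coef_pseudo_step; apply: expressibleB; apply: expressibleM => //;
  try exact: poly_expressible_lead.
by case: ifP.
Qed.

Lemma size_pseudo_step P G : (0 < size G <= size P)%N ->
  (size (pseudo_step P G) <= (size P).-1)%N.
Proof.
move=> sz_GP; apply/leq_sizeP => i le_Pi; rewrite coef_pseudo_step ifF; last by lia.
have [Di|lt_Pi] : i = (size P).-1 \/ (size P <= i)%N by lia.
  have -> : (i - (size P - size G) = (size G).-1)%N by lia.
  by rewrite Di -!lead_coefE mulrC subrr.
have le_Gi : (size G <= i - (size P - size G))%N by lia.
by rewrite !nth_default ?mulr0 ?subrr.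
Qed.

Lemma pseudo_division k G : poly_expressible k G -> forall n P, poly_expressible k P ->
  (size P <= n)%N -> G != 0 -> exists m Q R,
  [/\ lead_coef G ^+ m *: P = Q * G + R, (size R < size G)%N,
      poly_expressible (k + 4 * n) R, poly_expressible (k + 4 * n) Q
    & (m <= n)%N /\ (size Q <= (size P - size G).+1)%N].
Proof.
move=> eG n; elim: n k G eG => [|n IHn] k G eG P eP sz_P G0.
  exists 0%N, 0, P; rewrite expr0 scale1r mul0r add0r size_poly0 addn0.
  by split=> //; [apply: leq_ltn_trans sz_P _; rewrite size_poly_gt0|apply: poly_expressible0].
have [lt_PG|le_GP] := ltnP (size P) (size G).
  exists 0%N, 0, P; rewrite expr0 scale1r mul0r add0r size_poly0.
  by split=> //; [apply: poly_expressible_leq eP; rewrite leq_addr|apply: poly_expressible0].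
have sz_P' : (size (pseudo_step P G) <= (size P).-1)%N.
  by rewrite size_pseudo_step // size_poly_gt0 G0.
have [||||m [Q [R [DR lt_RG eR eQ [le_mn sz_Q]]]]] := IHn k.+2 G _ (pseudo_step P G).
- by apply: poly_expressible_leq eG; rewrite ltnW.
- exact: poly_expressible_pseudo_step.
- by lia.
- by [].
exists m.+1, (Q + (lead_coef G ^+ m * lead_coef P) *: 'X^(size P - size G)), R; split=> //.
- rewrite mulrDl addrAC -DR scalerBr !scalerA -!scalerAl scalerA exprSr.
  by rewrite subrK.
- by apply: poly_expressible_leq eR; lia.
- apply: (@poly_expressible_leq (k.+2 + 4 * n).+1); first by lia.
  apply: poly_expressibleD => // i; rewrite coefZ coefXn.
  apply: (@expressible_leq (k + n).+2); first by lia.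
  apply: expressibleM; last by case: (i == _).
  apply: expressibleM; last exact: expressible_leq (leq_addr _ _) (poly_expressible_lead eP).
  apply: (@expressible_leq (k + m)); first by rewrite leq_add2l.
  exact/expressibleX/poly_expressible_lead.
- split=> //; apply: leq_trans (size_polyD _ _) _; rewrite geq_max; apply/andP; split.
    by apply: leq_trans sz_Q _; rewrite ltnS leq_sub2r // (leq_trans sz_P') // leq_pred.
  by apply: leq_trans (size_scale_leq _ _) _; rewrite size_polyXn.
Qed.
End Expressions.

Fixpoint adjoin_depth (k : nat) : nat :=
  if k is k'.+1 then (adjoin_depth k' + (2 ^ k).+3)%N else 0.

Lemma expressible_adjoin (T : comNzRingType) (S : T -> Prop) (g : T) k z :
  expressible (fun x => S x \/ x = g) k z -> exists P : {poly T},
  [/\ poly_expressible S (adjoin_depth k) P, (size P <= (2 ^ k).+1)%N & z = P.[g]].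
Proof.
elim: k z => [|k IHk] z.
  have const c : expressible S 0 c -> exists P : {poly T},
      [/\ poly_expressible S 0 P, (size P <= 2)%N & c = P.[g]].
    exists c%:P; rewrite hornerC; split=> //; last exact: leq_trans (size_polyC_leq1 _) _.
    by move=> i; rewrite coefC; case: eqP => // _; apply: Or42.
  case=> [[Sz|->]|->|->|->].
  - exact/const/Or41.
  - exists 'X; rewrite hornerX size_polyX; split=> // i.
    by rewrite coefX; case: (i == 1%N); [apply: Or43|apply: Or42].
  - exact/const/Or42.
  - exact/const/Or43.
  - exact/const/Or44.
move=> [a [b [c [d [/IHk[Pa [ea sa ->]] /IHk[Pb [eb sb ->]]
  /IHk[Pc [ec sc ->]] /IHk[Pd [ed sd ->]] ->]]]]].
have szM (P Q : {poly T}) : (size P <= (2 ^ k).+1 -> size Q <= (2 ^ k).+1 ->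
    size (P * Q)%R <= (2 ^ k.+1).+1)%N.
  by move=> sP sQ; apply: leq_trans (size_polyMleq _ _) _; rewrite expnS; lia.
exists (Pa * Pb + Pc * Pd); split.
- rewrite /= -addSnnS addnS -addSn.
  by apply: poly_expressibleD; apply: poly_expressibleM => //; apply: szM.
- by apply: leq_trans (size_polyD _ _) _; rewrite geq_max !szM.
- by rewrite hornerD !hornerM.
Qed.

(** * Faithful lifts to the algebraic numbers *)

Lemma root_norm_le (R : numDomainType) (p : {poly R}) (M z : R) :
  (forall i, `|p`_i| <= M) -> root p z -> 1 <= `|z| -> `|lead_coef p| * `|z| <= (size p)%:R * M.
Proof.
move=> le_M pz z1; have [->|p0] := eqVneq p 0.
  by rewrite lead_coef0 normr0 mul0r size_poly0 mul0r.
have M0 : 0 <= M by apply: le_trans (le_M 0%N).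
have := root_size_gt1 p0 pz; have /eqP := pz; rewrite horner_coef lead_coefE.
case: (size p) => [|[|d]] //; rewrite big_ord_recr /= addrC => /eqP.
rewrite addr_eq0 => /eqP lead_z _.
have zd : 0 < `|z| ^+ d by rewrite exprn_gt0 // (lt_le_trans ltr01).
rewrite -(ler_pM2r zd) -[leLHS]mulrA -exprS -[`|z| ^+ d.+1]normrX -normrM lead_z normrN.
apply: le_trans (ler_norm_sum _ _ _) _.
apply: le_trans (_ : \sum_(i < d.+1) M * `|z| ^+ d <= _).
  by apply: ler_sum => i _; rewrite normrM normrX ler_pM ?exprn_ge0 // ler_weXn2l // -ltnS.
rewrite sumr_const card_ord -[leLHS]mulr_natl mulrA ler_wpM2r ?exprn_ge0 //.
by rewrite ler_wpM2r // ler_nat.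
Qed.

Lemma root_norm_le_Cauchy (R : numFieldType) (p : {poly R}) (M C z : R) : 1 <= M -> 1 <= C ->
  (forall i, `|p`_i| <= M) -> 1 <= C * `|lead_coef p| -> root p z -> `|z| <= (size p)%:R * M * C.
Proof.
move=> M1 C1 le_M le_C pz; have C0 := le_trans ler01 C1.
have p_gt0 : (0 < size p)%N.
  rewrite size_poly_gt0; apply: contraTneq le_C => ->.
  by rewrite lead_coef0 normr0 mulr0 ler10.
have bound1 : 1 <= (size p)%:R * M * C by rewrite !mulr_ege1 // (ler_nat _ 1).
have [le_z1|/ltW z1] := real_leP (normr_real z) (real1 _); first exact: le_trans bound1.
rewrite mulrC; apply: le_trans (_ : C * (`|lead_coef p| * `|z|) <= _).
  by rewrite mulrA ler_peMl.
by rewrite ler_wpM2l // root_norm_le.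
Qed.

Lemma conjugate_system_adjoin_root (D s : nat) (mu : nat -> aut) (P : algC -> Prop)
    (p : {poly algC}) (tau : algC) : conjugate_system D mu P ->
  (forall nu nu' : aut, (forall x, P x -> nu x = nu' x) -> map_poly nu p = map_poly nu' p) ->
  p != 0 -> (size p <= s)%N -> root p tau ->
  exists mu', conjugate_system (D * s) mu' (fun x => P x \/ x = tau).
Proof.
move=> conj_mu p_fixed p0 sz_p p_tau.
pose rts i : seq algC := sval (closed_field_poly_normal (map_poly (mu i) p)).
have rtsE i x : (x \in rts i) = root (map_poly (mu i) p) x.
  rewrite /rts; case: closed_field_poly_normal => r /= Dr.
  by rewrite Dr rootZ ?lead_coef_eq0 ?map_poly_eq0 // root_prod_XsubC.
have sz_rts i : (size (rts i) < s)%N.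
  apply: leq_trans sz_p; rewrite -(size_map_poly (mu i) p) /rts.
  case: closed_field_poly_normal => r /= Dr.
  by rewrite [in leqRHS]Dr size_scale ?lead_coef_eq0 ?map_poly_eq0 // size_prod_XsubC.
pose extends n (nu : aut) :=
  (forall x, P x -> nu x = mu (n %% D)%N x) /\ nu tau = (rts (n %% D)%N)`_(n %/ D).
have [n|mu' mu'P] := @boolp.choice nat aut
    (fun n nu' => (exists nu, extends n nu) -> extends n nu').
  by have [[nu nuP]|no_nu] := pselect (exists nu, extends n nu); [exists nu | exists (mu 0%N)].
exists mu' => nu; have [i lt_iD nuE] := conj_mu nu.
have nu_tau : nu tau \in rts i by rewrite rtsE -(p_fixed nu (mu i) nuE) fmorph_root.
have lt_idx : (index (nu tau) (rts i) < s)%N by apply: ltn_trans (sz_rts i); rewrite index_mem.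
set j := index _ _ in lt_idx; exists (j * D + i)%N.
  apply: leq_trans (_ : j.+1 * D <= _)%N; first by rewrite mulSn addnC ltn_add2r.
  by rewrite mulnC leq_mul2l lt_idx orbT.
have := mu'P (j * D + i)%N; rewrite /extends modnMDl modn_small //.
rewrite divnMDl ?(leq_ltn_trans _ lt_iD) //.
rewrite divn_small // addn0 nth_index // => -[|mu'E mu'_tau]; first by exists nu.
by move=> x [Px|->] //; rewrite mu'E ?nuE.
Qed.

Definition lifts (F : Type) (S : F * algC -> Prop) (u : algC) := exists2 z, S z & z.2 = u.

(* S is a set of pairs (element of F, lift): an expression of depth K vanishes in F if and
   only if its lift does. *)
Record faithful_lift (F : fieldType) (S : F * algC -> Prop) (K D b : nat) : Prop := FaithfulLift {
  lift_eq0 : forall z, expressible S K z -> (z.1 == 0) = (z.2 == 0);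
  lift_bound : forall z, S z -> forall nu : aut, `|nu z.2| <= b%:R;
  lift_denominator : exists Delta : nat,
    [/\ (0 < Delta)%N, (Delta <= b)%N & forall z, S z -> Delta%:R * z.2 \in Aint];
  lift_conjugates : exists mu, conjugate_system D mu (lifts S) }.

Definition height_exponent (k : nat) : nat := (2 ^ k + 2 * 3 ^ k)%N.
Definition norm_exponent (k D : nat) : nat := (height_exponent k * D + 2 ^ k)%N.

Lemma double_sqr_exp_le (b k : nat) : (2 <= b)%N ->
  (2 * (b ^ (2 * 3 ^ k) * b ^ (2 * 3 ^ k)) <= b ^ (2 * 3 ^ k.+1))%N.
Proof.
move=> b_ge2.
have -> : (2 * 3 ^ k.+1 = 2 * 3 ^ k + (2 * 3 ^ k + 2 * 3 ^ k))%N by rewrite expnS; lia.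
have : (0 < 2 * 3 ^ k)%N by rewrite muln_gt0 expn_gt0.
move: (2 * 3 ^ k)%N => e e_gt0; rewrite !expnD leq_mul2r; apply/orP; right.
exact: leq_trans b_ge2 (leq_self_exp b e_gt0).
Qed.

Section ExpressionBounds.
Variables (F : fieldType) (S : F * algC -> Prop) (b : nat).
Hypothesis b_ge2 : (2 <= b)%N.

Let b_gt0 : (0 < b)%N. Proof. exact: leq_trans b_ge2. Qed.

Lemma expressible_bound k z (nu : aut) : (forall y, S y -> `|nu y.2| <= b%:R) ->
  expressible S k z -> `|nu z.2| <= (b ^ (2 * 3 ^ k))%:R.
Proof.
move=> le_b; elim: k z => [|k IHk] z.
  have b1 : 1 <= (b ^ (2 * 3 ^ 0))%:R :> algC by rewrite (ler_nat _ 1) expn_gt0 b_gt0.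
  case=> [Sz|->|->|->]; rewrite ?rmorph0 ?normr0 ?rmorphN1 ?normrN ?rmorph1 ?normr1 //.
  by apply: le_trans (le_b z Sz) _; rewrite ler_nat leq_self_exp.
move=> [a [a' [c [c' [/IHk le_a /IHk le_a' /IHk le_c /IHk le_c' ->]]]]] /=.
rewrite rmorphD !rmorphM; apply: le_trans (ler_normD _ _) _; rewrite !normrM.
apply: le_trans (lerD (ler_pM _ _ le_a le_a') (ler_pM _ _ le_c le_c')) _ => //.
by rewrite -!natrM -natrD ler_nat addnn -mul2n double_sqr_exp_le.
Qed.

Lemma expressible_eq_aut (nu nu' : aut) k z : (forall u, lifts S u -> nu u = nu' u) ->
  expressible S k z -> nu z.2 = nu' z.2.
Proof.
move=> eq_nu; elim: k z => [|k IHk] z.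
  by case=> [Sz|->|->|->]; rewrite ?rmorph0 ?rmorphN1 ?rmorph1 // eq_nu //; exists z.
move=> [a [a' [c [c' [/IHk eq_a /IHk eq_a' /IHk eq_c /IHk eq_c' ->]]]]] /=.
by rewrite !rmorphD !rmorphM eq_a eq_a' eq_c eq_c'.
Qed.

Section Denominator.
Variable Delta : nat.
Hypotheses (Delta_gt0 : (0 < Delta)%N) (Delta_le : (Delta <= b)%N).
Hypothesis Delta_den : forall z, S z -> Delta%:R * z.2 \in Aint.

Lemma expressible_den k z : expressible S k z -> (Delta ^ 2 ^ k)%:R * z.2 \in Aint.
Proof.
elim: k z => [|k IHk] z.
  rewrite expn0 expn1; case=> [/Delta_den //|->|->|->];
  by rewrite /= ?mulr0 ?mulrN1 ?mulr1 ?rpredN ?rpred0 ?rpred_nat.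
move=> [a [a' [c [c' [/IHk Aa /IHk Aa' /IHk Ac /IHk Ac' ->]]]]] /=.
set d := (Delta ^ 2 ^ k)%N in Aa Aa' Ac Ac'.
have -> : (Delta ^ 2 ^ k.+1)%:R = d%:R * d%:R :> algC.
  by rewrite -natrM -expnD addnn -mul2n -expnS.
by rewrite mulrDr !(mulrACA d%:R d%:R) rpredD // rpredM.
Qed.

Lemma scaled_neq0 k (u : algC) : u != 0 -> (Delta ^ 2 ^ k)%:R * u != 0.
Proof. by move=> u0; rewrite mulf_neq0 // pnatr_eq0 -lt0n expn_gt0 Delta_gt0. Qed.

Lemma scaled_expressible_bound k z (nu : aut) : (forall y, S y -> `|nu y.2| <= b%:R) ->
  expressible S k z -> `|nu ((Delta ^ 2 ^ k)%:R * z.2)| <= (b ^ height_exponent k)%:R.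
Proof.
move=> le_b ez; rewrite rmorphM rmorph_nat normrM normr_nat expnD natrM.
by rewrite ler_pM ?expressible_bound // ler_nat leq_wexp2r.
Qed.

Lemma scaled_conjugates D mu k z : conjugate_system D mu (lifts S) -> expressible S k z ->
  (size (conjugates ((Delta ^ 2 ^ k)%:R * z.2)%R) <= D)%N.
Proof.
move=> conjS ez; apply: (@size_conjugates_le D mu (eq ((Delta ^ 2 ^ k)%:R * z.2))) => // nu.
have [i lt_iD nuE] := conjS nu; exists i => // _ <-.
by rewrite !rmorphM !rmorph_nat (expressible_eq_aut nuE ez).
Qed.

Lemma expressible_norm_ge D mu k z (nu : aut) :
  (forall (nu : aut) y, S y -> `|nu y.2| <= b%:R) -> conjugate_system D mu (lifts S) ->
  expressible S k z -> z.2 != 0 -> 1 <= (b ^ norm_exponent k D)%:R * `|nu z.2|.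
Proof.
move=> le_b conjS ez z0.
have := norm_ge_absnorm _ (scaled_conjugates conjS ez) (expressible_den ez) (scaled_neq0 k z0)
  (fun nu => scaled_expressible_bound (le_b nu) ez) nu.
rewrite expn_gt0 b_gt0 => /(_ isT)/le_trans; apply.
rewrite rmorphM rmorph_nat normrM normr_nat /norm_exponent expnD expnM natrM -mulrA.
by rewrite ler_wpM2l // ler_wpM2r // ler_nat leq_wexp2r.
Qed.
End Denominator.
End ExpressionBounds.

(** * Adjoining an element to a faithful lift *)

Lemma horner_pair_fst (R1 R2 : comNzRingType) (P : {poly R1 * R2}) x y :
  P.[(x, y)].1 = (map_poly fst P).[x].
Proof. by rewrite (horner_map (fst : {rmorphism _ -> _}) P (x, y)). Qed.

Lemma horner_pair_snd (R1 R2 : comNzRingType) (P : {poly R1 * R2}) x y :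
  P.[(x, y)].2 = (map_poly snd P).[y].
Proof. by rewrite (horner_map (snd : {rmorphism _ -> _}) P (x, y)). Qed.

Section Extension.
Variables (F : fieldType) (S : F * algC -> Prop) (K D b : nat).
Hypotheses (b_ge2 : (2 <= b)%N) (liftS : faithful_lift S K D b).
Implicit Types (P Q G R : {poly F * algC}) (x : F) (tau : algC).

Let b_gt0 : (0 < b)%N. Proof. exact: leq_trans b_ge2. Qed.
Let le_b (nu : aut) y : S y -> `|nu y.2| <= b%:R.
Proof. by move=> Sy; apply: lift_bound liftS _ Sy nu. Qed.

Lemma lift_lead_coef_neq0 P : poly_expressible S K P -> P != 0 ->
  (lead_coef P).1 != 0 /\ (lead_coef P).2 != 0.
Proof.
move=> eP; have eq0 := lift_eq0 liftS (poly_expressible_lead eP).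
rewrite -lead_coef_eq0 -eq0; case: (lead_coef P) eq0 => u v /= eq0.
by have [u0|//] := eqVneq u 0; have := eq0; rewrite u0 eqxx => /esym/eqP->; rewrite eqxx.
Qed.

Lemma size_map_snd P : poly_expressible S K P -> size (map_poly snd P) = size P.
Proof.
move=> eP; have [->|P0] := eqVneq P 0; first by rewrite map_poly0 !size_poly0.
by apply: size_map_poly_id0; have [] := lift_lead_coef_neq0 eP P0.
Qed.

Lemma size_map_fst P : poly_expressible S K P -> size (map_poly fst P) = size P.
Proof.
move=> eP; have [->|P0] := eqVneq P 0; first by rewrite map_poly0 !size_poly0.
by apply: size_map_poly_id0; have [] := lift_lead_coef_neq0 eP P0.
Qed.

Definition annihilator x k s P :=
  [/\ poly_expressible S k P, (size P <= s)%N, P != 0 & (map_poly fst P).[x] = 0].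

Section MinimalAnnihilator.
Variables (x : F) (tau : algC) (l s W : nat) (G : {poly F * algC}).
Hypotheses (annG : annihilator x l s G) (le_lWK : (l + W <= K)%N).
Hypothesis minG : forall P, annihilator x (l + W) s P -> (size G <= size P)%N.
Hypothesis rootG : root (map_poly snd G) tau.

Let g : F * algC := (x, tau).

Lemma horner_minimal : G.[g] = 0.
Proof.
have [_ _ _ Gx] := annG; apply: injective_projections.
  by rewrite horner_pair_fst Gx.
by rewrite horner_pair_snd; apply/eqP.
Qed.

Lemma fst_neq0_below_minimal k R : poly_expressible S k R -> (k <= l + W)%N -> R != 0 ->
  (size R < size G)%N -> (map_poly fst R).[x] != 0.
Proof.
move=> eR le_k R0 lt_RG; have [_ sz_G _ _] := annG; apply/eqP => Rx.
suff /minG : annihilator x (l + W) s R by rewrite leqNgt lt_RG.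
by split=> //; [apply: poly_expressible_leq eR | apply: leq_trans (ltnW lt_RG) sz_G].
Qed.

Lemma minimal_not_factored k m Q R : poly_expressible S k R -> poly_expressible S k Q ->
  (k <= l + W)%N -> R != 0 -> (1 < size R < size G)%N -> (size Q <= (size G - size R).+1)%N ->
  lead_coef R ^+ m *: G <> Q * R.
Proof.
move=> eR eQ le_k R0 /andP[R1 lt_RG] sz_Q DG; have [eG sz_G G0 _] := annG.
have [r0 _] := lift_lead_coef_neq0 (poly_expressible_leq (leq_trans le_k le_lWK) eR) R0.
have le_lK : (l <= K)%N by apply: leq_trans le_lWK; rewrite leq_addr.
have [g0 _] := lift_lead_coef_neq0 (poly_expressible_leq le_lK eG) G0.
have Qx : (map_poly fst Q).[x] = 0.
  have /esym/eqP := congr1 (fun P : {poly F * algC} => P.[g].1) DG.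
  rewrite hornerZ hornerM horner_minimal mulr0 /= mulf_eq0 !horner_pair_fst.
  by rewrite (negPf (fst_neq0_below_minimal eR _ R0 lt_RG)) // orbF => /eqP.
have Q0 : Q != 0.
  apply: contraNneq g0 => Q0; have := congr1 (fun P : {poly F * algC} => (P`_(size G).-1).1) DG.
  rewrite Q0 mul0r coef0 coefZ -lead_coefE /= => /eqP.
  by rewrite mulf_eq0 rmorphXn expf_eq0 /= (negPf r0) andbF.
have lt_QG : (size Q < size G)%N.
  by apply: leq_ltn_trans sz_Q _; move: (size R) (size G) R1 lt_RG => r e; lia.
suff /minG : annihilator x (l + W) s Q by rewrite leqNgt lt_QG.
by split=> //; [apply: poly_expressible_leq eQ | apply: leq_trans (ltnW lt_QG) sz_G].
Qed.

(* Were tau a root of a smaller R, the Euclidean algorithm applied to G and R would split G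
   and so produce a smaller annihilator of x. *)
Lemma snd_neq0_below_minimal t R k : poly_expressible S k R -> (l <= k)%N ->
  (k + 4 * s * t <= l + W)%N -> R != 0 -> (size R <= t)%N ->
  (size R < size G)%N -> (map_poly snd R).[tau] != 0.
Proof.
elim: t R k => [|t IHt] R k eR le_lk le_k R0 sz_R lt_RG.
  by move: R0; rewrite -size_poly_eq0 -leqn0 sz_R.
apply/eqP => Rtau; have [eG sz_G _ _] := annG.
rewrite mulnS addnA in le_k; have le_k' := leq_trans (leq_addr _ _) le_k.
have [m [Q [R' [DG lt_R'R eR' eQ [_ sz_Q]]]]] :=
  pseudo_division eR (poly_expressible_leq le_lk eG) sz_G R0.
have [R'0|nzR'] := eqVneq R' 0.
  rewrite R'0 addr0 in DG; apply: (minimal_not_factored _ eQ le_k' R0 _ sz_Q DG).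
    by apply: poly_expressible_leq eR; rewrite leq_addr.
  have eRK : poly_expressible S K R by apply: poly_expressible_leq eR; lia.
  rewrite lt_RG andbT -(size_map_snd eRK); apply: (@root_size_gt1 _ tau); last exact/eqP.
  by rewrite -size_poly_eq0 size_map_snd // size_poly_eq0.
have /eqP : (map_poly snd R').[tau] != 0.
  apply: (IHt R' (k + 4 * s)%N) => //; last exact: ltn_trans lt_R'R lt_RG.
    exact: leq_trans le_lk (leq_addr _ _).
  exact: leq_trans lt_R'R sz_R.
apply; have := congr1 (fun P : {poly F * algC} => P.[g].2) DG.
rewrite hornerZ hornerD hornerM horner_minimal mulr0 /= !horner_pair_snd Rtau mulr0 add0r.
by move=> <-.
Qed.

Lemma minimal_lift_eq0 P : poly_expressible S l P -> (size P <= s)%N ->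
  (4 * s * s.+1 <= W)%N -> (P.[g].1 == 0) = (P.[g].2 == 0).
Proof.
rewrite mulnS => eP sz_P le_W; have [eG sz_G G0 _] := annG.
have [m [Q [R [DP lt_RG eR _ _]]]] := pseudo_division eG eP sz_P G0.
have le_lK : (l <= K)%N by lia.
have [g1 g2] := lift_lead_coef_neq0 (poly_expressible_leq le_lK eG) G0.
have PR : lead_coef G ^+ m * P.[g] = R.[g].
  by rewrite -hornerZ DP hornerD hornerM horner_minimal mulr0 add0r.
transitivity (R.[g].1 == 0).
  by rewrite -PR /= mulf_eq0 rmorphXn expf_eq0 /= (negPf g1) andbF.
transitivity (R.[g].2 == 0); last first.
  by rewrite -PR /= mulf_eq0 rmorphXn expf_eq0 /= (negPf g2) andbF.
have [->|R0] := eqVneq R 0; first by rewrite horner0 !eqxx.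
rewrite horner_pair_fst horner_pair_snd (negPf (fst_neq0_below_minimal eR _ R0 lt_RG)); last by lia.
by rewrite (negPf (snd_neq0_below_minimal eR _ _ R0 (ltnW (leq_trans lt_RG sz_G)) lt_RG)) //; lia.
Qed.
End MinimalAnnihilator.

Lemma minimal_annihilator x s W t l P : annihilator x l s P -> (size P <= t)%N ->
  exists l' G, [/\ (l <= l' <= l + t * W)%N, annihilator x l' s G
    & forall P', annihilator x (l' + W) s P' -> (size G <= size P')%N].
Proof.
elim: t l P => [|t IHt] l P annP sz_P.
  by have [_ _ + _] := annP; rewrite -size_poly_eq0 -leqn0 sz_P.
have [[P' annP' lt_P'P]|noP'] := pselect (exists2 P', annihilator x (l + W) s P'
    & (size P' < size P)%N).
  have [|l' [G [/andP[le_l le_l'] annG minG]]] := IHt _ _ annP' _.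
    by rewrite -ltnS (leq_trans lt_P'P).
  exists l', G; split=> //.
  by rewrite (leq_trans _ le_l) ?leq_addr //= mulSn addnA.
exists l, P; split=> //; first by rewrite leqnn leq_addr.
by move=> P' annP'; rewrite leqNgt; apply/negP => lt_P'P; apply: noP'; exists P'.
Qed.

Definition extension_exponent s := (s + 2 * 3 ^ K + norm_exponent K D).+1.

Lemma root_lift_norm_le P (nu : aut) s z : poly_expressible S K P -> P != 0 ->
  (size P <= s)%N -> root (map_poly nu (map_poly snd P)) z ->
  `|z| <= (b ^ (extension_exponent s).-1)%:R.
Proof.
move=> eP P0 sz_P Pz; have [Delta [Delta_gt0 le_Delta Delta_den]] := lift_denominator liftS.
have [mu conjS] := lift_conjugates liftS.
have [_ lead0] := lift_lead_coef_neq0 eP P0.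
have lead_ge := expressible_norm_ge b_ge2 Delta_gt0 le_Delta Delta_den nu le_b conjS
  (poly_expressible_lead eP) lead0.
have exp_ge1 n : 1 <= (b ^ n)%:R :> algC by rewrite (ler_nat _ 1) expn_gt0 b_gt0.
have := root_norm_le_Cauchy (exp_ge1 (2 * 3 ^ K)%N) (exp_ge1 (norm_exponent K D)) _ _ Pz.
rewrite lead_coef_map lead_coef_map_eq // => /(_ _ lead_ge) le_z; apply: le_trans (le_z _) _.
  by move=> i; rewrite !coef_map /=; apply: (expressible_bound b_ge2 (le_b nu) (eP i)).
rewrite size_map_poly size_map_snd // -!natrM ler_nat /extension_exponent /= !expnD !leq_mul //.
exact: leq_trans sz_P (ltnW (ltn_expl s b_ge2)).
Qed.

Let adjoin (g : F * algC) z := S z \/ z = g.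

Lemma lift_transcendental x K' : (adjoin_depth K' <= K)%N ->
  (forall P, ~ annihilator x (adjoin_depth K') (2 ^ K').+1 P) ->
  exists tau, faithful_lift (adjoin (x, tau)) K' (D * (2 ^ K').+1)
    (b ^ extension_exponent (2 ^ K').+1).
Proof.
set s := (2 ^ K').+1 => le_K noP; set c := extension_exponent s.
have le_bc : (b <= b ^ c)%N by apply: leq_self_exp.
exists (b ^ c)%:R; split.
- move=> z /expressible_adjoin[P [eP sz_P ->]].
  have [->|P0] := eqVneq P 0; first by rewrite horner0 !eqxx.
  rewrite horner_pair_fst horner_pair_snd.
  have -> : ((map_poly fst P).[x] == 0) = false by apply/eqP => Px; apply: (noP P).
  apply/esym/negP => Pz.
  have := @root_lift_norm_le P idfun s (b ^ c)%:R (poly_expressible_leq le_K eP) P0 sz_P.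
  rewrite map_poly_id // => /(_ Pz); rewrite normr_nat ler_nat leqNgt.
  by rewrite ltn_exp2l // ltnSn.
- move=> z [Sz|->] nu; first by apply: le_trans (le_b nu Sz) _; rewrite ler_nat.
  by rewrite /= rmorph_nat normr_nat.
- have [Delta [Delta_gt0 le_Delta Delta_den]] := lift_denominator liftS; exists Delta; split=> //.
    exact: leq_trans le_bc.
  by move=> z [/Delta_den //|->]; rewrite rpredM ?rpred_nat.
- have [mu conjS] := lift_conjugates liftS; exists mu => nu; have [i lt_iD nuE] := conjS nu.
  exists i; first by apply: leq_trans lt_iD _; rewrite leq_pmulr.
  by move=> _ [z [Sz|->] <-]; [apply: nuE; exists z | rewrite /= !rmorph_nat].
Qed.

Lemma root_lift_denominator x G tau : poly_expressible S K G -> G != 0 ->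
  root (map_poly snd G) tau -> exists Delta : nat, [/\ (0 < Delta)%N,
    (Delta <= b ^ (norm_exponent K D).+1)%N
    & forall z, adjoin (x, tau) z -> Delta%:R * z.2 \in Aint].
Proof.
move=> eG G0 Gtau; have [Delta [Delta_gt0 le_Delta Delta_den]] := lift_denominator liftS.
have [mu conjS] := lift_conjugates liftS; have [_ lead0] := lift_lead_coef_neq0 eG G0.
have e_lead := poly_expressible_lead eG.
pose w := (Delta ^ 2 ^ K)%:R * (lead_coef G).2.
have w0 : w != 0 by apply: scaled_neq0.
have Aw : w \in Aint := expressible_den Delta_den e_lead.
have w_tau : w * tau \in Aint.
  pose p := (Delta ^ 2 ^ K)%:R *: map_poly snd G.
  have <- : lead_coef p = w by rewrite lead_coefZ lead_coef_map_eq.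
  apply: Aint_lead_coef_mul_root; last by rewrite rootE hornerZ (rootP Gtau) mulr0.
  by apply/polyOverP => i; rewrite coefZ coef_map (expressible_den Delta_den).
exists (Delta * absnorm w)%N; split; first by rewrite muln_gt0 Delta_gt0 absnorm_gt0.
  rewrite expnS leq_mul // /norm_exponent expnD expnM; apply: leq_trans (leq_pmulr _ _).
    apply: (absnorm_le _ _ Aw); rewrite ?expn_gt0 ?b_gt0 //.
      exact: scaled_conjugates conjS e_lead.
    by move=> nu; apply: (scaled_expressible_bound b_ge2 le_Delta (le_b nu) e_lead).
  by rewrite expn_gt0 b_gt0.
move=> z [/Delta_den Az|->]; rewrite natrM; first by rewrite mulrAC rpredM ?rpred_nat.
rewrite -mulrA rpredM ?rpred_nat //=.
rewrite (_ : _ * tau = (absnorm w)%:R / w * (w * tau)); last by rewrite mulrA divfK.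
exact: rpredM (Aint_absnorm_div Aw w0) w_tau.
Qed.

Lemma lift_algebraic x K' l W G :
  let s := (2 ^ K').+1 in
  annihilator x l s G -> (adjoin_depth K' <= l)%N -> (l + W <= K)%N ->
  (4 * s * s.+1 <= W)%N ->
  (forall P, annihilator x (l + W) s P -> (size G <= size P)%N) ->
  exists tau, faithful_lift (adjoin (x, tau)) K' (D * s) (b ^ extension_exponent s).
Proof.
move=> s annG le_l le_lWK le_W minG; have [eG sz_G G0 Gx] := annG.
have eGK : poly_expressible S K G.
  by apply: poly_expressible_leq eG; apply: leq_trans le_lWK; rewrite leq_addr.
have sz_G1 : (1 < size G)%N.
  rewrite -(size_map_fst eGK); apply: (@root_size_gt1 _ x); last exact/eqP.
  by rewrite -size_poly_eq0 size_map_fst // size_poly_eq0.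
have [tau Gtau] : exists tau, root (map_poly snd G) tau.
  by apply/closed_rootP; rewrite size_map_snd // gtn_eqF.
exists tau; split.
- move=> z /expressible_adjoin[P [eP sz_P ->]].
  by apply: (minimal_lift_eq0 annG le_lWK minG Gtau) => //; apply: poly_expressible_leq eP.
- move=> z [Sz|->] nu; first by apply: le_trans (le_b nu Sz) _; rewrite ler_nat leq_self_exp.
  apply: le_trans (root_lift_norm_le (nu := nu) eGK G0 sz_G _) _; first by rewrite fmorph_root.
  by rewrite ler_nat leq_pexp2l ?leq_pred.
- have [Delta [Delta_gt0 le_Delta Delta_den]] := root_lift_denominator x eGK G0 Gtau.
  exists Delta; split=> //; apply: leq_trans le_Delta _.
  by rewrite leq_pexp2l // ltnS leq_addl.
have [mu conjS] := lift_conjugates liftS.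
have sz_mG : (size (map_poly snd G) <= s)%N by rewrite size_map_snd.
have [||mu' conj'] := conjugate_system_adjoin_root conjS _ _ sz_mG Gtau.
- move=> nu nu' nuE; apply/polyP => i; rewrite !coef_map.
  exact: expressible_eq_aut nuE (eGK i).
- by rewrite -size_poly_eq0 size_map_snd // size_poly_eq0.
exists mu' => nu; have [i lt_i nuE] := conj' nu; exists i => // _ [z [Sz|->] <-]; apply: nuE.
  by left; exists z.
by right.
Qed.
End Extension.

Lemma extend_lift K' : exists K, forall D, exists D' c, (0 < c)%N /\
  forall (F : fieldType) (S : F * algC -> Prop) b x, (2 <= b)%N -> faithful_lift S K D b ->
  exists tau, faithful_lift (fun z => S z \/ z = (x, tau)) K' D' (b ^ c).
Proof.
set s := (2 ^ K').+1; set W := (4 * s * s.+1)%N; set k := adjoin_depth K'.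
exists (k + s.+1 * W)%N => D; exists (D * s)%N, (extension_exponent (k + s.+1 * W) D s).
split=> // F S b x b_ge2 liftS.
have [[P annP]|noP] := pselect (exists P, annihilator S x k s P); last first.
  apply: (lift_transcendental b_ge2 liftS) => [|P annP]; first by rewrite leq_addr.
  by apply: noP; exists P.
have sz_P : (size P <= s)%N by case: annP.
have [l [G [/andP[le_l le_l'] annG minG]]] := minimal_annihilator W annP sz_P.
apply: (lift_algebraic b_ge2 liftS annG le_l _ _ minG) => //.
by rewrite mulSn addnCA [(l + W)%N]addnC leq_add2l.
Qed.

(** * Sets with small doubling *)

Lemma maximal_independent_set (I : finType) (P : {set I}) (r : rel I) :
  {in P, reflexive r} -> symmetric r -> exists X : {set I}, [/\ X \subset P,
    {in X &, forall i j, r i j -> i = j} & forall i, i \in P -> exists2 j, j \in X & r i j].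
Proof.
move=> r_refl r_sym.
pose indep (X : {set I}) := (X \subset P) && [forall i in X, forall j in X, r i j ==> (i == j)].
have [|X /maxsetP[/andP[sXP /forall_inP indepX] maxX] _] := @maxset_exists _ indep set0.
  by rewrite /indep sub0set; apply/forall_inP => i; rewrite inE.
have {}indepX i j : i \in X -> j \in X -> r i j -> i = j.
  by move=> iX jX rij; have /forall_inP/(_ j jX)/implyP/(_ rij)/eqP := indepX i iX.
exists X; split=> // i iP; apply: contrapT => far_i.
have far j : j \in X -> ~~ r i j by move=> jX; apply/negP => rij; apply: far_i; exists j.
have iX : i \notin X by apply: contraL (r_refl i iP) => /far.
move: (iX); rewrite -(maxX (i |: X)) ?setU11 ?subsetUr // /indep subUset sub1set iP sXP /=.
apply/forall_inP => u /setU1P[->|uX]; apply/forall_inP => v /setU1P[->|vX] //.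
- by rewrite eqxx implybT.
- by rewrite (negPf (far v vX)).
- by rewrite r_sym (negPf (far u uX)).
- by apply/implyP => /(indepX u v uX vX) ->.
Qed.

Lemma multiple_in_subgroup (U : zmodType) (I : finType) (P : {set I}) (g : I -> U)
    (M : zmodClosed U) : (0 < #|P|)%N ->
  exists s : nat, (0 < s <= #|P|)%N /\ forall u,
    (forall i, i \in P -> exists2 j, j \in P & u + g i - g j \in M) -> u *+ s \in M.
Proof.
move=> P_gt0; pose eqv i j := g i - g j \in M.
have eqv_sym i j : eqv i j = eqv j i by rewrite /eqv -opprB rpredN.
have [i _||X [sXP sepX covX]] := @maximal_independent_set _ P eqv; rewrite ?/eqv ?subrr ?rpred0 //.
exists #|X|; split.
  rewrite subset_leq_card // andbT card_gt0; have /card_gt0P[i /covX[j jX _]] := P_gt0.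
  by apply/set0Pn; exists j.
move=> u stable_u.
have f_ex i : exists j, i \in X -> j \in X /\ u + g i - g j \in M.
  have [iX|] := boolP (i \in X); last by exists i.
  have [j jP Mj] := stable_u i (subsetP sXP i iX); have [k kX Mk] := covX j jP.
  exists k => _; split=> //.
  by rewrite -[u + g i](subrK (g j)) -addrA rpredD.
have [f fP] := fin_all_exists f_ex.
have f_inj : {in X &, injective f}.
  move=> i i' iX i'X E; apply: sepX => //; rewrite /eqv.
  have [_ Mi] := fP i iX; have [_ Mi'] := fP i' i'X.
  by have := rpredB Mi Mi'; rewrite E opprD addrACA subrr addr0 opprD addrACA subrr add0r.
have fX : f @: X = X.
  apply/eqP; rewrite eqEcard card_in_imset // leqnn andbT.
  by apply/subsetP => _ /imsetP[i /fP[fiX _] ->].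
have : \sum_(i in X) (u + g i - g (f i)) \in M by apply: rpred_sum => i /fP[].
by rewrite sumrB big_split /= sumr_const -(big_imset g f_inj) fX addrK.
Qed.

Section Sumsets.
Variable V : finZmodType.
Implicit Types (A B S X Y Z : {set V}).

Lemma mem_sumset A B a b : a \in A -> b \in B -> a + b \in sumset A B.
Proof. exact: imset2_f. Qed.

Lemma sumsetC A B : sumset A B = sumset B A.
Proof.
by apply/setP => z; apply/imset2P/imset2P => -[a b aA bB ->]; exists b a; rewrite // addrC.
Qed.

Lemma sumsetA A B S : sumset A (sumset B S) = sumset (sumset A B) S.
Proof.
apply/setP => z; apply/imset2P/imset2P => [[a _ aA /imset2P[b c bB cS ->] ->]|].
  by exists (a + b) c; rewrite ?mem_sumset // addrA.
by case=> _ c /imset2P[a b aA bB ->] cS ->; exists a (b + c); rewrite ?mem_sumset // addrA.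
Qed.

Lemma sumsetUr A B S : sumset A (B :|: S) = sumset A B :|: sumset A S.
Proof. exact: imset2Ur. Qed.

Lemma sumset0r A : sumset A set0 = set0.
Proof. by apply/setP => z; rewrite inE; apply/imset2P => -[a b _]; rewrite inE. Qed.

Lemma card_sumset1 A x : #|sumset A [set x]| = #|A|.
Proof.
have -> : sumset A [set x] = [set a + x | a in A].
  apply/setP => z; apply/imset2P/imsetP => [[a y aA /set1P-> ->]|[a aA ->]]; first by exists a.
  by exists a x; rewrite ?set11.
by rewrite card_imset //; apply: addIr.
Qed.

(* By induction on S, adding a point s to S adds to A + (B + S) at most the points of
   A + B + s outside A + B' + s, where B' collects the b in B with A + b + s already covered. *)
Lemma Petridis A B :
  (forall B', B' \subset B -> #|sumset A B| * #|B'| <= #|sumset A B'| * #|B|)%N ->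
  forall S, (#|sumset A (sumset B S)| * #|B| <= #|sumset A B| * #|sumset B S|)%N.
Proof.
move=> minB S; have [n] := ubnP #|S|; elim: n S => // n IHn S lt_S.
have [->|[s sS]] := set_0Vmem S; first by rewrite !sumset0r cards0.
have {IHn} := IHn (S :\ s); rewrite [#|S|](cardsD1 s) sS in lt_S => /(_ lt_S).
rewrite -{3 4}(setD1K sS) setUC; set S' := S :\ s => IH.
pose B' := [set b in B | sumset A [set b + s] \subset sumset A (sumset B S')].
have sB'B : B' \subset B by apply/subsetP => b; rewrite inE => /andP[].
have card_add C : #|sumset A (sumset C [set s])| = #|sumset A C| by rewrite sumsetA card_sumset1.
have old_sums : sumset A (sumset B' [set s]) \subset
    sumset A (sumset B S') :&: sumset A (sumset B [set s]).
  rewrite subsetI; apply/andP; split; last by rewrite !sumsetA; apply/imset2Sl/imset2Sr.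
  apply/subsetP => _ /imset2P[a _ aA /imset2P[b _ + /set1P-> ->] ->].
  by rewrite inE => /andP[_ /subsetP]; apply; rewrite mem_sumset ?set11.
have old_points : sumset B S' :&: sumset B [set s] \subset sumset B' [set s].
  apply/subsetP => z /setIP[zS /imset2P[b _ bB /set1P-> Dz]]; rewrite {z}Dz in zS *.
  rewrite mem_sumset ?set11 // inE bB; apply/subsetP => _ /imset2P[a _ aA /set1P-> ->].
  exact: mem_sumset.
have := subset_leq_card old_sums; have := subset_leq_card old_points.
have := cardsUI (sumset A (sumset B S')) (sumset A (sumset B [set s])).
have := cardsUI (sumset B S') (sumset B [set s]); have := minB B' sB'B.
rewrite !sumsetUr !card_add !card_sumset1; move: IH.
move: #|_ :&: sumset A _| #|_ :&: _| #|_ :|: sumset A _| #|_ :|: _| => i2 i1 u2 u1.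
move: #|sumset A (sumset B S')| #|sumset B S'| #|sumset A B| #|sumset A B'| #|B| #|B'|.
nia.
Qed.

Lemma Ruzsa_triangle Y Z B :
  (#|sumset Y (-%R @: Z)| * #|B| <= #|sumset Y B| * #|sumset Z B|)%N.
Proof.
have rep_ex d : exists yz : V * V, d \in sumset Y (-%R @: Z) ->
    [/\ yz.1 \in Y, yz.2 \in Z & d = yz.1 - yz.2].
  case: (boolP (d \in _)) => [/imset2P[y _ yY /imsetP[z zZ ->] ->]|_]; last by exists (0, 0).
  by exists (y, z).
have [rep repP] := fin_all_exists rep_ex.
rewrite -!cardsX; pose f (db : V * V) := ((rep db.1).1 + db.2, (rep db.1).2 + db.2).
rewrite -(card_in_imset (f := f)); last first.
  move=> [d b] [d' b'] /setXP[/= /repP[_ _ Dd] _] /setXP[/= /repP[_ _ Dd'] _] [E1 E2].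
  have Ed : d = d' by rewrite Dd Dd' -(addrKA b) (addrC b) E1 E2 opprD addrACA subrr addr0.
  by move: E1; rewrite Ed => /addrI ->.
apply/subset_leq_card/subsetP => _ /imsetP[[d b] /setXP[/= /repP[repY repZ _] bB] ->].
by rewrite inE !mem_sumset.
Qed.

Lemma Petridis_subset A (C : nat) : (0 < #|A|)%N -> (#|sumset A A| <= C * #|A|)%N ->
  exists B, [/\ B \subset A, (0 < #|B|)%N, (#|sumset A B| <= C * #|B|)%N
    & forall S, (#|sumset A (sumset B S)| <= C * #|sumset B S|)%N].
Proof.
move=> A0 le_C; pose ratio B : rat := #|sumset A B|%:R / #|B|%:R.
pose P B := (B \subset A) && (B != set0).
have PA : P A by rewrite /P subxx -card_gt0.
case: (Order.TotalTheory.arg_minP ratio PA) => B /andP[sBA B0] minB.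
have B_gt0 : (0 < #|B|)%N by rewrite card_gt0.
have ratio_le B' : B' \subset A -> (#|sumset A B| * #|B'| <= #|sumset A B'| * #|B|)%N.
  move=> sB'A; have [->|B'0] := eqVneq B' set0; first by rewrite cards0 muln0.
  have := minB B'; rewrite /P sB'A B'0 /ratio => /(_ isT).
  rewrite ler_pdivrMr ?ltr0n // mulrAC ler_pdivlMr ?ltr0n ?card_gt0 //.
  by rewrite -!natrM ler_nat.
have le_AB : (#|sumset A B| <= C * #|B|)%N.
  rewrite -(leq_pmul2r A0); apply: leq_trans (ratio_le A (subxx _)) _.
  by rewrite mulnAC leq_mul2r le_C orbT.
exists B; split=> // S; rewrite -(leq_pmul2r B_gt0).
apply: leq_trans (Petridis (fun B' sB' => ratio_le B' (subset_trans sB' sBA)) S) _.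
by rewrite mulnAC leq_mul2r le_AB orbT.
Qed.

Lemma Plunnecke_Ruzsa A (C : nat) : (0 < #|A|)%N -> (#|sumset A A| <= C * #|A|)%N ->
  (#|sumset (sumset A (sumset A A)) (-%R @: A)| <= C ^ 4 * #|A|)%N.
Proof.
move=> A0 /(Petridis_subset A0)[B [sBA B_gt0 le_AB le_ABS]].
have le_A3B : (#|sumset (sumset A (sumset A A)) B| <= C ^ 3 * #|B|)%N.
  rewrite sumsetC sumsetA (sumsetC B) -sumsetA; apply: leq_trans (le_ABS _) _.
  rewrite sumsetA (sumsetC B) -sumsetA expnS -mulnA leq_mul2l; apply/orP; right.
  apply: leq_trans (le_ABS _) _; rewrite expnS expn1 -mulnA leq_mul2l sumsetC.
  by rewrite le_AB orbT.
rewrite -(leq_pmul2r B_gt0); apply: leq_trans (Ruzsa_triangle _ _ _) _.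
apply: leq_trans (leq_mul le_A3B le_AB) _; rewrite mulnACA -expnSr -mulnA leq_mul2l.
by rewrite leq_mul2r (subset_leq_card sBA) !orbT.
Qed.

(* A maximal X in A + A - A with pairwise disjoint translates of A works. *)
Lemma Ruzsa_covering A (C : nat) : (0 < #|A|)%N -> (#|sumset A A| <= C * #|A|)%N ->
  exists X, (#|X| <= C ^ 4)%N /\ forall a b c, a \in A -> b \in A -> c \in A ->
    exists x d e, [/\ x \in X, d \in A, e \in A & a + b - c = x + d - e].
Proof.
move=> A0 le_C; pose W := sumset (sumset A A) (-%R @: A).
pose meet x y := ~~ [disjoint sumset A [set x] & sumset A [set y]].
have [x _|x y|X [sXW sepX covX]] := @maximal_independent_set _ W meet.
- have [a aA] : exists a, a \in A by apply/set0Pn; rewrite -card_gt0.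
  by apply/pred0Pn; exists (a + x); rewrite /= andbb mem_sumset ?set11.
- by rewrite /meet disjoint_sym.
exists X; split.
  rewrite -(leq_pmul2r A0); apply: leq_trans (Plunnecke_Ruzsa A0 le_C).
  rewrite -cardsX -(card_in_imset (f := fun xa : V * V => xa.1 + xa.2)).
    apply/subset_leq_card/subsetP => _ /imsetP[[x a] /setXP[/= /(subsetP sXW) + aA] ->].
    by case/imset2P=> y t yAA tA ->; rewrite addrAC mem_sumset // addrC mem_sumset.
  move=> [x a] [y b] /setXP[/= xX aA] /setXP[/= yX bA] E.
  suff Ex : x = y by move: E; rewrite Ex => /addrI ->.
  apply: sepX => //; apply/pred0Pn; exists (x + a) => /=.
  by rewrite {2}E !(addrC _ a) !(addrC _ b) !mem_sumset ?set11.
move=> a b c aA bA cA.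
have /covX[x xX /pred0Pn[_ /andP[/imset2P[e _ eA /set1P-> ->]]]] : a + b - c \in W.
  by rewrite !mem_sumset // imset_f.
case/imset2P=> d _ dA /set1P-> E; exists x, d, e; split=> //.
by rewrite [x + d]addrC -E [RHS]addrC addKr.
Qed.

Lemma sum_seq_count (X : {set V}) (r : seq V) : {subset r <= X} ->
  \sum_(x <- r) x = \sum_(x in X) x *+ count_mem x r.
Proof.
move=> sub_rX; rewrite big_seq (partition_big id (mem X)) //=.
apply: eq_bigr => x xX; rewrite (eq_bigr (fun=> x)) => [|y /andP[_ /eqP] //].
rewrite big_const_seq iter_addr_0; congr (_ *+ _); apply: eq_in_count => y yr.
by rewrite /= yr.
Qed.

(* The moves (d, e) -> (d', e') given by a + d - e = x + d' - e' must cycle; summing them along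
   the cycle expresses a multiple of a in terms of the x's. *)
Lemma small_multiple A X :
  (forall a b c, a \in A -> b \in A -> c \in A ->
    exists x d e, [/\ x \in X, d \in A, e \in A & a + b - c = x + d - e]) ->
  forall a, a \in A -> exists q (f : V -> nat), [/\ (0 < q <= #|A| ^ 2)%N,
    (forall x, f x <= #|A| ^ 2)%N & a *+ q = \sum_(x in X) x *+ f x].
Proof.
move=> cov a aA.
have move_ex (s : V * V) : exists t : V * (V * V), s \in setX A A ->
    [/\ t.1 \in X, t.2 \in setX A A & a + s.1 - s.2 = t.1 + t.2.1 - t.2.2].
  case: s => b c; case: (boolP (_ \in _)) => [/setXP[bA cA]|_]; last by exists (0, (0, 0)).
  by have [x [d [e [xX dA eA E]]]] := cov a b c aA bA cA; exists (x, (d, e)); rewrite inE dA eA.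
have [move moveP] := fin_all_exists move_ex.
pose next s := (move s).2; pose st k := iter k next (a, a); pose xs k := (move (st k)).1.
have stA k : st k \in setX A A.
  by elim: k => [|k /moveP[]] //; rewrite inE aA.
pose dif k := (st k).1 - (st k).2.
have a_step k : a = xs k + (dif k.+1 - dif k).
  have E : a + dif k = xs k + dif k.+1 by rewrite !addrA; have [] := moveP _ (stA k).
  by rewrite addrA -E addrK.
set j := order next (a, a).
have le_j : (j <= #|A| ^ 2)%N.
  rewrite -mulnn -cardsX; apply/subset_leq_card/subsetP => s.
  rewrite -[s \in _]/(fconnect next (a, a) s) fconnect_orbit => /trajectP[k _ ->].
  exact: stA.
have [i lt_ij st_ij] := trajectP (looping_order next (a, a)).
exists (j - i)%N, (fun x => count_mem x [seq xs k | k <- index_iota i j]); split.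
- by rewrite subn_gt0 lt_ij (leq_trans (leq_subr _ _)).
- move=> x; apply: leq_trans (count_size _ _) _; rewrite size_map size_iota.
  exact: leq_trans (leq_subr _ _) le_j.
rewrite -sum_seq_count => [|_ /mapP[k _ ->]]; last by have [] := moveP _ (stA k).
have dif_ij : dif j = dif i by rewrite /dif /st st_ij.
have -> : a *+ (j - i) = \sum_(i <= k < j) (xs k + (dif k.+1 - dif k)).
  by rewrite -sumr_const_nat; apply: eq_bigr => k _; apply: a_step.
by rewrite big_split /= telescope_sumr ?(ltnW lt_ij) // dif_ij subrr addr0 big_map.
Qed.
End Sumsets.

(** * Lifting sets with small doubling *)

Lemma intr_Fp_eq0 p (m : int) : prime p -> (`|m| < p)%N -> ((m%:~R : 'F_p) == 0) = (m == 0).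
Proof.
move=> p_pr lt_mp; apply/idP/idP => [|/eqP ->]; last by rewrite rmorph0.
rewrite {1}(intEsign m) rmorphM rmorph_sign mulf_eq0 signr_eq0 /=.
rewrite -(dvdn_pcharf (pchar_Fp p_pr)) -absz_eq0; apply: contraLR.
by rewrite -lt0n => m_gt0; apply: contraL lt_mp => /(dvdn_leq m_gt0); rewrite leqNgt.
Qed.

Definition integer_pair (F : fieldType) (H : nat) (z : F * algC) :=
  exists2 m : int, (`|m| <= H)%N & z = (m%:~R, m%:~R).

Lemma expressible_integer_pair (F : fieldType) (H k : nat) (z : F * algC) : (2 <= H)%N ->
  expressible (@integer_pair F H) k z -> integer_pair (H ^ (2 * 3 ^ k)) z.
Proof.
move=> H_ge2; have exp_gt0 e : (0 < H ^ e)%N by rewrite expn_gt0 (leq_trans _ H_ge2).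
elim: k z => [|k IHk] z.
  case=> [[m le_m ->]|->|->|->]; [exists m|exists 0|exists 1|exists (-1)];
    rewrite ?rmorphN1 //.
  by apply: leq_trans le_m _; rewrite leq_self_exp.
move=> [a [a' [c [c' [/IHk[m1 l1 ->] /IHk[m2 l2 ->] /IHk[m3 l3 ->] /IHk[m4 l4 ->] ->]]]]].
exists (m1 * m2 + m3 * m4); last by rewrite !rmorphD !rmorphM.
apply: leq_trans (double_sqr_exp_le k H_ge2).
have le_absD (u v : int) : (`|(u + v)%R| <= `|u| + `|v|)%N by lia.
apply: leq_trans (le_absD _ _) _; rewrite !abszM mul2n -addnn.
by rewrite leq_add // leq_mul.
Qed.

Lemma faithful_integer_pair K p H : prime p -> (2 <= H)%N -> (H ^ (2 * 3 ^ K) < p)%N ->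
  faithful_lift (@integer_pair 'F_p H) K 1 H.
Proof.
move=> p_pr H_ge2 lt_p; split.
- move=> z /(expressible_integer_pair H_ge2)[m le_m ->] /=.
  by rewrite intr_Fp_eq0 ?intr_eq0 // (leq_ltn_trans le_m).
- move=> z [m le_m ->] nu /=; rewrite rmorph_int -intr_norm -abszE.
  by rewrite -pmulrn ler_nat.
- exists 1%N; split=> //; first exact: leq_trans H_ge2.
  by move=> z [m _ ->]; rewrite mul1r Aint_int.
- exists (fun=> idfun : aut) => nu; exists 0%N => // _ [z [m _ ->] <-] /=.
  by rewrite rmorph_int.
Qed.

Lemma lift_seq r K : exists D c c0, (0 < c)%N /\
  forall p H, prime p -> (2 <= H)%N -> (H ^ c0 < p)%N ->
  forall xs : seq 'F_p, size xs = r -> exists S, [/\ faithful_lift S K D (H ^ c),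
    forall z, integer_pair H z -> S z
  & forall x, x \in xs -> exists tau, S (x, tau)].
Proof.
elim: r K => [|r IHr] K.
  exists 1%N, 1%N, (2 * 3 ^ K)%N; split=> // p H p_pr H_ge2 lt_p [|//] _.
  by exists (@integer_pair _ H); split=> //; rewrite expn1; apply: faithful_integer_pair.
have [K1 ext] := extend_lift K; have [D [c [c0 [c_gt0 lift_r]]]] := IHr K1.
have [D' [c' [c'_gt0 {}ext]]] := ext D.
exists D', (c * c')%N, c0; split; first by rewrite muln_gt0 c_gt0.
move=> p H p_pr H_ge2 lt_p [//|x xs] [sz_xs].
have [S [liftS S_int S_xs]] := lift_r p H p_pr H_ge2 lt_p xs sz_xs.
have [|tau liftS'] := ext _ S (H ^ c)%N x _ liftS.
  exact: leq_trans H_ge2 (leq_self_exp H c_gt0).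
exists (fun z => S z \/ z = (x, tau)); rewrite expnM; split=> // [z /S_int|y]; first by left.
by rewrite inE => /predU1P[->|/S_xs[t St]]; [exists tau; right|exists t; left].
Qed.

Lemma lift_set r K : exists D c c0, (0 < c)%N /\
  forall p H, prime p -> (2 <= H)%N -> (H ^ c0 < p)%N ->
  forall X : {set 'F_p}, (#|X| <= r)%N -> exists (S : 'F_p * algC -> Prop) (tau : 'F_p -> algC),
    [/\ faithful_lift S K D (H ^ c), forall z, integer_pair H z -> S z
      & forall x, x \in X -> S (x, tau x)].
Proof.
have [D [c [c0 [c_gt0 lift_r]]]] := lift_seq r K; exists D, c, c0.
split=> // p H p_pr H_ge2 lt_p X le_X.
have sz_X : size (enum X ++ nseq (r - #|X|) 0) = r by rewrite size_cat size_nseq -cardE subnKC.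
have [S [liftS S_int S_X]] := lift_r p H p_pr H_ge2 lt_p _ sz_X.
have [x|tau tauP] := @fin_all_exists _ _ (fun x t => x \in X -> S (x, t)).
  case: (boolP (x \in X)) => [xX|_]; last by exists 0.
  by have [|t St] := S_X x; [rewrite mem_cat mem_enum xX | exists t].
by exists S, tau.
Qed.

Definition scaled_Aint (d : nat) : {pred algC} := fun v => d%:R * v \in Aint.

Fact scaled_Aint_zmod_closed d : zmod_closed (scaled_Aint d).
Proof.
have memE v : (v \in scaled_Aint d) = (d%:R * v \in Aint) by [].
by split=> [|x y]; rewrite !memE ?mulr0 ?mulrBr; [rewrite Aint0 | apply: rpredB].
Qed.
HB.instance Definition _ d :=
  GRing.isZmodClosed.Build algC (scaled_Aint d) (scaled_Aint_zmod_closed d).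

Section LiftSmallDoubling.
Variables (F : finFieldType) (A X : {set F}) (S : F * algC -> Prop) (K D b H r : nat).
Variables (tau : F -> algC) (q : F -> nat) (f : F -> F -> nat).
Hypotheses (liftS : faithful_lift S K D b) (le_Xr : (#|X| <= r)%N).
Hypothesis S_nat : forall m : nat, (m <= H)%N -> S (m%:R, m%:R).
Hypothesis S_tau : forall x, x \in X -> S (x, tau x).
Hypothesis q_bound : forall a, a \in A -> (0 < q a <= H)%N.
Hypothesis f_bound : forall a x, a \in A -> (f a x <= H)%N.
Hypothesis multiple : forall a, a \in A -> a *+ q a = \sum_(x in X) x *+ f a x.
Hypothesis covering : forall a b c, a \in A -> b \in A -> c \in A ->
  exists x d e, [/\ x \in X, d \in A, e \in A & a + b - c = x + d - e].

Definition lifted a : algC := (\sum_(x in X) (f a x)%:R * tau x) / (q a)%:R.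

Definition small_doubling_lift (z : F * algC) := S z \/ exists2 a, a \in A & z = (a, lifted a).
Local Notation S' := small_doubling_lift.

Lemma multiplier_neq0 a : a \in A -> (q a)%:R != 0 :> algC.
Proof. by case/q_bound/andP=> q_gt0 _; rewrite pnatr_eq0 -lt0n. Qed.

Definition denominator_at k (z : F * algC) := exists d : F * algC,
  [/\ expressible S k d, d.1 != 0, d.2 != 0 & expressible S k (d * z)].

Lemma denominator_lifted a : a \in A -> denominator_at (r + 1) (a, lifted a).
Proof.
move=> aA; have /andP[q_gt0 le_q] := q_bound aA.
have Sq := S_nat le_q; exists ((q a)%:R, (q a)%:R); split; try exact: multiplier_neq0.
- exact: expressible_mem.
- by have /= -> := lift_eq0 liftS (expressible_mem K Sq); apply: multiplier_neq0.
have -> : ((q a)%:R, (q a)%:R) * (a, lifted a) =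
    \sum_(x <- enum X) ((f a x)%:R, (f a x)%:R) * (x, tau x).
  apply: injective_projections.
    rewrite [RHS](rmorph_sum (fst : {rmorphism _ -> _})) /= mulr_natl multiple // big_enum.
    by apply: eq_bigr => x _; rewrite /= mulr_natl.
  rewrite [RHS](rmorph_sum (snd : {rmorphism _ -> _})) /= mulrC divfK ?multiplier_neq0 //.
  by rewrite big_enum.
apply: (@expressible_leq _ _ (1 + size (enum X))); first by rewrite addnC -cardE leq_add2r.
apply: expressible_sum => x; rewrite mem_enum => xX.
by apply: expressibleM; apply: expressible_mem; [apply: S_nat; apply: f_bound | apply: S_tau].
Qed.

Lemma denominator_expressible k z : expressible S' k z -> denominator_at (r + 1 + 3 * k) z.
Proof.
have const z' : expressible S 0 z' -> denominator_at (r + 1 + 3 * 0) z'.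
  move=> ez; exists 1; rewrite mul1r !oner_neq0; split=> //; first exact: expressible1.
  exact: expressible_leq ez.
elim: k z => [|k IHk] z.
  case=> [[Sz|[a aA ->]]|z0|z1|zN1].
  - exact/const/Or41.
  - by rewrite addn0; apply: denominator_lifted.
  - exact/const/Or42.
  - exact/const/Or43.
  - exact/const/Or44.
move=> [a [b' [c' [d [/IHk[qa [ea a1 a2 eqa]] /IHk[qb [eb b1 b2 eqb]]
   /IHk[qc [ec c1 c2 eqc]] /IHk[qd [ed d1 d2 eqd]] ->]]]]].
have -> : (r + 1 + 3 * k.+1 = (r + 1 + 3 * k).+3)%N by rewrite mulnS addnCA.
exists ((qa * qb) * (qc * qd)); split; try by rewrite /= !mulf_neq0.
- by apply: expressible_leq (leqnSn _) _; do 2!apply: expressibleM; try apply: expressibleM.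
have -> : qa * qb * (qc * qd) * (a * b' + c' * d) =
   (qa * a) * (qb * b') * (qc * qd) + (qc * c') * (qd * d) * (qa * qb) by ring.
by apply: expressibleD; apply: expressibleM => //; apply: expressibleM.
Qed.

Lemma small_doubling_lift_eq0 k z : (r + 1 + 3 * k <= K)%N ->
  expressible S' k z -> (z.1 == 0) = (z.2 == 0).
Proof.
move=> le_kK /denominator_expressible[d [_ d1 d2 edz]].
have := lift_eq0 liftS (expressible_leq le_kK edz).
by rewrite /= !mulf_eq0 (negPf d1) (negPf d2).
Qed.

Lemma lifted_bound a (nu : aut) : a \in A -> `|nu (lifted a)| <= (r * (H * b))%:R.
Proof.
move=> aA; have /andP[q_gt0 _] := q_bound aA.
rewrite fmorph_div normf_div rmorph_nat normr_nat ler_pdivrMr ?ltr0n //.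
apply: le_trans (_ : (r * (H * b))%:R <= _); last by rewrite ler_peMr ?ler0n // (ler_nat _ 1).
rewrite rmorph_sum; apply: le_trans (ler_norm_sum _ _ _) _.
apply: le_trans (_ : \sum_(x in X) (H * b)%:R <= _).
  apply: ler_sum => x xX; rewrite rmorphM rmorph_nat normrM normr_nat natrM.
  by rewrite ler_pM ?ler_nat ?f_bound //; apply: (lift_bound liftS (S_tau xX)).
by rewrite sumr_const -[leLHS]mulr_natl -natrM ler_nat leq_mul2r le_Xr orbT.
Qed.

Lemma lifted_covering a d e : (r + 10 <= K)%N -> a \in A -> d \in A -> e \in A ->
  exists x d' e', [/\ x \in X, d' \in A, e' \in A &
    lifted a + lifted d - lifted e = tau x + lifted d' - lifted e'].
Proof.
move=> le_rK aA dA eA; have [x [d' [e' [xX d'A e'A E]]]] := covering aA dA eA.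
exists x, d', e'; split=> //; apply/eqP; rewrite -subr_eq0.
have inA k u : u \in A -> expressible S' k (u, lifted u).
  by move=> uA; apply: expressible_mem; right; exists u.
have inX k : expressible S' k (x, tau x) by apply: expressible_mem; left; apply: S_tau.
have depth3 : expressible S' 3 ((a, lifted a) + (d, lifted d) - (e, lifted e) -
    ((x, tau x) + (d', lifted d') - (e', lifted e'))).
  apply: expressibleB; apply: expressibleB; try exact: inA;
    by apply: expressibleD; [try exact: inX; apply: inA | apply: inA].
have le_depth3 : (r + 1 + 3 * 3 <= K)%N by rewrite -addnA.
by have /= <- := small_doubling_lift_eq0 le_depth3 depth3; rewrite E subrr.
Qed.

Lemma small_doubling_denominator : (0 < #|A|)%N -> (r + 10 <= K)%N ->
  exists Delta : nat, [/\ (0 < Delta)%N, (Delta <= b * #|A| ^ 2)%N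
    & forall z, S' z -> Delta%:R * z.2 \in Aint].
Proof.
move=> A_gt0 le_rK; have [Delta [Delta_gt0 le_Delta Delta_den]] := lift_denominator liftS.
have [|s [/andP[s_gt0 le_s] multiple_s]] := @multiple_in_subgroup _ _ (setX A A)
    (fun de => lifted de.1 - lifted de.2) (scaled_Aint Delta).
  by rewrite cardsX muln_gt0 A_gt0.
rewrite cardsX mulnn in le_s; exists (Delta * s)%N; split; rewrite ?muln_gt0 ?Delta_gt0 ?leq_mul //.
move=> z [/Delta_den Az|[a aA ->]]; rewrite natrM; first by rewrite mulrAC rpredM ?rpred_nat.
have scaled_s : lifted a *+ s \in scaled_Aint Delta.
  apply: multiple_s => -[d e] /setXP[dA eA].
  have [x [d' [e' [xX d'A e'A E]]]] := lifted_covering le_rK aA dA eA.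
  exists (d', e'); rewrite ?inE ?d'A //= [_ + (_ - _)]addrA E -(addrA (tau x)) addrK.
  exact: Delta_den (S_tau xX).
by rewrite -mulrA [s%:R * _]mulr_natl; exact: scaled_s.
Qed.

Lemma faithful_small_doubling_lift k B : (0 < #|A|)%N -> (r + 10 <= K)%N ->
  (r + 1 + 3 * k <= K)%N -> (b <= B)%N -> (r * (H * b) <= B)%N -> (b * #|A| ^ 2 <= B)%N ->
  faithful_lift S' k D B.
Proof.
move=> A_gt0 le_rK le_kK le_bB le_liftB le_denB; split.
- by move=> z; apply: small_doubling_lift_eq0.
- move=> z [Sz|[a aA ->]] nu; first by apply: le_trans (lift_bound liftS Sz nu) _; rewrite ler_nat.
  by apply: le_trans (lifted_bound nu aA) _; rewrite ler_nat.
- have [Delta [Delta_gt0 le_Delta Delta_den]] := small_doubling_denominator A_gt0 le_rK.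
  by exists Delta; split=> //; apply: leq_trans le_denB.
have [mu conjS] := lift_conjugates liftS; exists mu => nu; have [i lt_iD nuE] := conjS nu.
exists i => // _ [z [Sz|[a aA ->]] <-]; first by apply: nuE; exists z.
rewrite !fmorph_div !rmorph_nat !rmorph_sum; congr (_ / _); apply: eq_bigr => x xX.
by rewrite !rmorphM !rmorph_nat nuE //; exists (x, tau x); first exact: S_tau.
Qed.
End LiftSmallDoubling.

Theorem lift_small_doubling (C K : nat) : exists D c c0, (0 < c)%N /\
  forall p (A : {set 'F_p}), prime p -> (2 <= #|A|)%N ->
  (#|sumset A A| <= C * #|A|)%N -> (#|A| ^ c0 < p)%N ->
  exists S : 'F_p * algC -> Prop, [/\ faithful_lift S K D (#|A| ^ c),
    forall z, integer_pair #|A| z -> S z & forall a, a \in A -> exists alpha, S (a, alpha)].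
Proof.
set r := (C ^ 4)%N; set K0 := (r + 10 + 3 * K)%N.
have [D [c [c0 [c_gt0 lift_r]]]] := lift_set r K0.
exists D, (2 * (c + r + 1))%N, (2 * c0)%N; split; first by rewrite muln_gt0 /= addn1.
move=> p A p_pr A_ge2 le_C lt_p; set n := #|A| in A_ge2 le_C lt_p *; set H := (n ^ 2)%N.
have n_gt0 : (0 < n)%N by apply: ltnW.
have le_nH : (n <= H)%N by rewrite leq_self_exp.
have H_gt0 : (0 < H)%N := leq_trans n_gt0 le_nH.
have [X [le_Xr covX]] := Ruzsa_covering n_gt0 le_C.
have [||S [tau [liftS S_int tauP]]] := lift_r p H p_pr _ _ X le_Xr.
- exact: leq_trans le_nH.
- by rewrite -expnM.
have [a|qf qfP] := @fin_all_exists _ _ (fun (a : 'F_p) (qf : nat * ('F_p -> nat)) => a \in A ->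
    [/\ (0 < qf.1 <= H)%N, (forall x, qf.2 x <= H)%N & a *+ qf.1 = \sum_(x in X) x *+ qf.2 x]).
  case: (boolP (a \in A)) => [aA|_]; last by exists (0%N, fun=> 0%N).
  by have [q [f qfP]] := small_multiple covX aA; exists (q, f).
exists (small_doubling_lift A X S tau (fun a => (qf a).1) (fun a => (qf a).2)).
split=> [|z [m le_m ->]|a aA]; last by eexists; right; exists a.
  have le_rHr : (r <= H ^ r)%N.
    by apply/ltnW/ltn_expl/(leq_trans A_ge2).
  have S_nat (m : nat) : (m <= H)%N -> S (m%:R, m%:R) by move=> le_m; apply: S_int; exists m.
  rewrite expnM -/H.
  apply: (faithful_small_doubling_lift liftS le_Xr S_nat tauP _ _ _ covX) => //.
  + by move=> a /qfP[].
  + by move=> a x /qfP[].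
  + by move=> a /qfP[].
  + exact: leq_addr.
  + by rewrite /K0 leq_add2r leq_add2l.
  + by rewrite leq_pexp2l // -addnA leq_addr.
  + by rewrite -[(C ^ 4)%N]/r addn1 -addSn addnC expnD [(H ^ c.+1)%N]expnS leq_mul.
  + by rewrite -[(#|A| ^ 2)%N]/H -expnSr leq_pexp2l // addn1 ltnS leq_addr.
by left; apply: S_int; exists m => //; apply: leq_trans le_nH.
Qed.

(** * Counting factorizations *)

Lemma lift_eq (F : fieldType) (S : F * algC -> Prop) (K D b k : nat) (y z : F * algC) :
  faithful_lift S K D b -> (k < K)%N -> expressible S k y -> expressible S k z ->
  (y.1 == z.1) = (y.2 == z.2).
Proof.
move=> liftS lt_kK ey ez; rewrite -subr_eq0 -[RHS]subr_eq0.
exact: (lift_eq0 liftS (expressible_leq lt_kK (expressibleB ey ez))).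
Qed.

Definition factor_of (F : fieldType) (S : F * algC -> Prop) (k : nat) (m x : F) :=
  exists y xi eta, [/\ expressible S k (x, xi), expressible S k (y, eta) & x * y = m].

Section CountFactors.
Variables (F : fieldType) (S : F * algC -> Prop) (K D b k : nat) (m : F) (xs : seq F).
Variables (y : F -> F) (xi eta : F -> algC).
Hypotheses (b_ge2 : (2 <= b)%N) (liftS : faithful_lift S K D b) (le_kK : (k + 2 <= K)%N).
Hypotheses (m0 : m != 0).
Hypothesis e_xi : {in xs, forall x, expressible S k (x, xi x)}.
Hypothesis e_eta : {in xs, forall x, expressible S k (y x, eta x)}.
Hypothesis mul_y : {in xs, forall x, x * y x = m}.

Let lt_kK : (k < K)%N. Proof. by apply: leq_trans le_kK; rewrite addn2. Qed.

Lemma factor_lift_neq0 : {in xs, forall x, xi x != 0 /\ eta x != 0}.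
Proof.
move=> x xX; have := m0; rewrite -(mul_y xX) mulf_eq0 negb_or.
have /= -> := lift_eq liftS lt_kK (e_xi xX) (expressible0 S k).
by have /= -> := lift_eq liftS lt_kK (e_eta xX) (expressible0 S k) => /andP.
Qed.

Lemma factor_lift_mul : {in xs &, forall x x', xi x * eta x = xi x' * eta x'}.
Proof.
move=> x x' xX x'X; apply/eqP.
have e_mul z (zX : z \in xs) := expressibleM (e_xi zX) (e_eta zX).
have lt_k1K : (k.+1 < K)%N by rewrite -addn2.
by have /= <- := lift_eq liftS lt_k1K (e_mul x xX) (e_mul x' x'X); rewrite !mul_y.
Qed.

Lemma factor_lift_inj : {in xs &, injective xi}.
Proof.
move=> x x' xX x'X eq_xi; apply/eqP.
by have /= -> := lift_eq liftS lt_kK (e_xi xX) (e_xi x'X); rewrite eq_xi.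
Qed.

Lemma scaled_factors_count (Kd : nat) (x0 : F) :
  divisor_count_bound D Kd -> x0 \in xs -> uniq xs ->
  exists N, [/\ (0 < N)%N, (N <= b ^ (2 * height_exponent k * D))%N &
    (size xs <= ((trunc_log 2 (b ^ (height_exponent k * D.+1))).+1 *
                 size (divisors (N ^ D`!))) ^ D * Kd)%N].
Proof.
move=> count x0X uniq_xs; have [Delta [Delta_gt0 le_Delta Delta_den]] := lift_denominator liftS.
have [mu conjS] := lift_conjugates liftS.
set d := (Delta ^ 2 ^ k)%N.
have d0 : d%:R != 0 :> algC by rewrite pnatr_eq0 -lt0n expn_gt0 Delta_gt0.
have B_gt0 : (0 < b ^ height_exponent k)%N by rewrite expn_gt0 ltnW.
have den z : expressible S k z -> d%:R * z.2 \in Aint by apply: expressible_den.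
have bound (nu : aut) z : expressible S k z -> `|nu (d%:R * z.2)| <= (b ^ height_exponent k)%:R.
  by apply: scaled_expressible_bound => // u Su; apply: lift_bound liftS _ Su nu.
pose M := (d%:R * xi x0) * (d%:R * eta x0).
have M_div : {in xs, forall x, M / (d%:R * xi x) = d%:R * eta x}.
  move=> x xX; have [xi0 _] := factor_lift_neq0 xX.
  by rewrite /M mulrACA (factor_lift_mul x0X xX); field; rewrite d0 xi0.
have M0 : M != 0 by have [xi0 eta0] := factor_lift_neq0 x0X; rewrite !mulf_neq0.
have AM : M \in Aint by rewrite rpredM ?(den _ (e_xi x0X)) ?(den _ (e_eta x0X)).
have conj_M : conjugate_system D mu (fun u => u \in M :: [seq d%:R * xi x | x <- xs]).
  move=> nu; have [i lt_iD nuE] := conjS nu; exists i => // u.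
  have nu_e z : expressible S k z -> nu (d%:R * z.2) = mu i (d%:R * z.2).
    by move=> ez; rewrite !rmorphM !rmorph_nat (expressible_eq_aut nuE ez).
  rewrite inE => /predU1P[->|/mapP[x xX ->]]; last exact: (nu_e _ (e_xi xX)).
  by rewrite [nu M]rmorphM [mu i M]rmorphM (nu_e _ (e_xi x0X)) (nu_e _ (e_eta x0X)).
exists (absnorm M); split; first exact: absnorm_gt0.
  rewrite [(2 * _)%N]mulnC !expnM -mulnn; apply: (absnorm_le _ _ AM).
  - by rewrite muln_gt0 B_gt0.
  - by apply: size_conjugates_le conj_M _; rewrite mem_head.
  - move=> nu; rewrite rmorphM normrM natrM.
    by rewrite ler_pM ?(bound _ _ (e_xi x0X)) ?(bound _ _ (e_eta x0X)).
rewrite expnM -(size_map (fun x => d%:R * xi x)).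
apply: (count mu _ M) => //.
  by rewrite map_inj_in_uniq // => x x' xX x'X /(mulfI d0)/factor_lift_inj; apply.
move=> _ /mapP[x xX ->]; have [xi0 _] := factor_lift_neq0 xX; split; rewrite ?M_div //.
- exact: mulf_neq0.
- exact: (den _ (e_xi xX)).
- exact: (den _ (e_eta xX)).
by move=> nu; apply: (bound _ _ (e_xi xX)).
Qed.
End CountFactors.

Lemma count_factors D k : exists Kd, forall (F : fieldType) (S : F * algC -> Prop) K b,
  (2 <= b)%N -> faithful_lift S K D b -> (k + 2 <= K)%N -> forall (m : F) (xs : seq F),
  m != 0 -> uniq xs -> {in xs, forall x, factor_of S k m x} ->
  exists N, [/\ (0 < N)%N, (N <= b ^ (2 * height_exponent k * D))%N &
    (size xs <= ((trunc_log 2 (b ^ (height_exponent k * D.+1))).+1 *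
                 size (divisors (N ^ D`!))) ^ D * Kd)%N].
Proof.
have [Kd count] := count_bounded_divisors D; exists Kd.
move=> F S K b b_ge2 liftS le_kK m xs m0 uniq_xs xsP.
have [->|[x0 x0X]] : xs = [::] \/ exists x0, x0 \in xs.
  by case: (xs) => [|x s]; [left|right; exists x; rewrite mem_head].
  by exists 1%N; rewrite expn_gt0 (leq_trans _ b_ge2).
have [x|t tP] := @boolp.choice F (F * (algC * algC))%type (fun x t => x \in xs ->
    [/\ expressible S k (x, t.2.1), expressible S k (t.1, t.2.2) & x * t.1 = m]).
  case: (boolP (x \in xs)) => [/xsP[y [xi [eta factor_x]]]|_]; last by exists (0, (0, 0)).
  by exists (y, (xi, eta)).
apply: (@scaled_factors_count F S K D b k m xs (fun x => (t x).1) (fun x => (t x).2.1)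
  (fun x => (t x).2.2) b_ge2 liftS le_kK m0 _ _ _ Kd x0 count x0X uniq_xs) => x /tP[] //.
Qed.

Section LogarithmicBounds.
Local Open Scope nat_scope.

Lemma sqr_le_exp2 t : t * t <= 2 ^ t.+1.
Proof.
elim: t => // t IHt; rewrite expnS mul2n -addnn.
by have := ltn_expl t (isT : 1 < 2); rewrite expnS in IHt *; lia.
Qed.

Lemma quadratic_exp2_le c t : t * (c + 2 * t) * 2 ^ t <= 2 * (c + 2) * 4 ^ t.
Proof.
have -> : 4 ^ t = 2 ^ t * 2 ^ t by rewrite -expnMn.
rewrite mulnA leq_mul2r; apply/orP; right.
have := sqr_le_exp2 t; rewrite expnS => le_tt.
have le_t : t <= t * t by case: (t) => // t'; rewrite leq_pmulr.
apply: leq_trans (_ : (c + 2) * (t * t) <= _); last by nia.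
by rewrite mulnDr mulnDl mulnCA leq_add2r mulnC leq_mul2l le_t orbT.
Qed.

Lemma log_power_le c l t : 4 ^ t <= l < 4 ^ t.+1 ->
  (c * l).+1 ^ (t * 2 ^ t) <= 2 ^ (2 * (c + 5) * l).
Proof.
case/andP=> ge_l lt_l; have l_gt0 : 0 < l by apply: leq_trans ge_l; rewrite expn_gt0.
have le_cl : (c * l).+1 <= 2 ^ (c + 3 + 2 * t).
  apply: leq_trans (_ : c.+1 * l <= _); first by rewrite mulSn -addn1 addnC leq_add2r.
  apply: leq_trans (leq_mul (ltnW (ltn_expl c.+1 (isT : 1 < 2))) (ltnW lt_l)) _.
  by rewrite -[4]/(2 ^ 2) -expnM -expnD leq_pexp2l //; lia.
apply: leq_trans (_ : (2 ^ (c + 3 + 2 * t)) ^ (t * 2 ^ t) <= _).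
  exact: leq_wexp2r.
rewrite -expnM leq_pexp2l // mulnA [(_ + _) * t]mulnC.
apply: leq_trans (quadratic_exp2_le (c + 3) t) _.
by rewrite -addnA leq_mul2l ge_l orbT.
Qed.

(* The bound of count_factors raised to the power t, where l ~ log n and 4 ^ t ~ l. *)
Lemma count_factors_power (c1 c2 D Kd l t L X dv : nat) : 4 ^ t <= l < 4 ^ t.+1 ->
  L <= c1 * l -> dv ^ t <= (c2 * l).+1 ^ (t * 2 ^ t) * 2 ^ (c2 * l) ->
  X <= (L.+1 * dv) ^ D * Kd ->
  X ^ t <= 2 ^ ((D * (2 * (c1 + 5) + (2 * (c2 + 5) + c2)) + Kd) * l).
Proof.
move=> tl le_L le_dv le_X; have /andP[ge_l _] := tl.
have le_tl : t <= l by apply: leq_trans ge_l; apply: ltnW; rewrite ltn_expl.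
have L_pow : L.+1 ^ t <= 2 ^ (2 * (c1 + 5) * l).
  apply: leq_trans (log_power_le c1 tl); apply: leq_trans (@leq_wexp2r L.+1 (c1 * l).+1 t le_L) _.
  by rewrite leq_pexp2l // leq_pmulr // expn_gt0.
have dv_pow : dv ^ t <= 2 ^ ((2 * (c2 + 5) + c2) * l).
  by apply: leq_trans le_dv _; rewrite mulnDl expnD leq_mul // log_power_le.
have Kd_pow : Kd ^ t <= 2 ^ (Kd * l).
  apply: leq_trans (leq_wexp2r t (ltnW (ltn_expl Kd (isT : 1 < 2)))) _.
  by rewrite -expnM leq_pexp2l // leq_mul2l le_tl orbT.
apply: leq_trans (leq_wexp2r t le_X) _.
rewrite expnMn -expnM [D * t]mulnC expnM expnMn mulnDl expnD leq_mul //.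
rewrite [D * _]mulnC mulnAC expnM; apply: leq_wexp2r.
by rewrite mulnDl expnD leq_mul.
Qed.
End LogarithmicBounds.

Section LogRatio.
Variable R : realType.

Definition log_ratio (n : nat) : R := ln n%:R / ln (ln n%:R).

Lemma ln2_bounds : 0 < ln (2 : R) <= 1.
Proof.
rewrite ln_gt0 ?ltr1n //= (_ : 2 = 1 + 1 :> R); last by lra.
by apply: le_ln1Dx; lra.
Qed.

Lemma ln3_gt1 : 1 < ln (3 : R).
Proof.
suff e_lt3 : expR 1 < 3 :> R.
  by rewrite -[X in X < _](expRK (1 : R)) ltr_ln ?posrE ?expR_gt0 ?ltr0n.
have exp_ge : 5 / 6 <= expR (- (1 / 6)) :> R.
  by apply: le_trans (expR_ge1Dx _); lra.
have -> : expR 1 = (expR (- (1 / 6)))^-1 ^+ 6 :> R.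
  by rewrite -expRN opprK -expRM_natl; congr expR; field.
apply: le_lt_trans (_ : (5 / 6)^-1 ^+ 6 < 3).
  by rewrite lerXn2r ?nnegrE ?invr_ge0 ?expR_ge0 ?lef_pV2 ?posrE ?expR_gt0 //; lra.
by rewrite invf_div !exprS expr0; lra.
Qed.

Lemma lnln_gt0 (n : nat) : (3 <= n)%N -> 0 < ln (ln (n%:R : R)).
Proof.
move=> n_ge3; apply: ln_gt0; apply: lt_le_trans ln3_gt1 _.
by rewrite ler_ln ?posrE ?ltr0n ?ler_nat // (leq_trans _ n_ge3).
Qed.

Lemma log_ratio_ge1 (n : nat) : (3 <= n)%N -> 1 <= log_ratio n.
Proof.
move=> n_ge3; rewrite ler_pdivlMr ?lnln_gt0 // mul1r ltW // ln_sublinear //.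
by apply: ln_gt0; rewrite ltr1n (leq_trans _ n_ge3).
Qed.

Lemma trunc_log_ln (b n : nat) : (1 < b)%N -> (0 < n)%N ->
  (trunc_log b n)%:R * ln b%:R <= ln (n%:R : R) < (trunc_log b n).+1%:R * ln b%:R.
Proof.
move=> b_gt1 n_gt0; have b_gt0 : 0 < b%:R :> R by rewrite ltr0n ltnW.
rewrite ![_%:R * ln _]mulr_natl -!lnXn // -!natrX.
rewrite ler_ln ?ltr_ln ?posrE ?ltr0n ?expn_gt0 ?(ltnW b_gt1) // ler_nat ltr_nat.
exact: trunc_log_bounds.
Qed.

Lemma ln_nat_power_le (X t c : nat) : (0 < X)%N -> (X ^ t <= 2 ^ c)%N ->
  t%:R * ln X%:R <= c%:R * ln 2 :> R.
Proof.
move=> X_gt0 le_X; rewrite ![_%:R * ln _]mulr_natl -!lnXn ?ltr0n // -!natrX.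
by rewrite ler_ln ?posrE ?ltr0n ?expn_gt0 ?X_gt0 // ler_nat.
Qed.

(* With l ~ log n and t ~ log l, the t-th root of 2 ^ (c l) is exp(O(log n / log log n)). *)
Lemma root_le_expR_log_ratio (n X c : nat) : let l := (trunc_log 2 n).+1 in (8 <= n)%N ->
  (X ^ trunc_log 4 l <= 2 ^ (c * l))%N -> X%:R <= expR (8 * c%:R * log_ratio n) :> R.
Proof.
move=> l n_ge8 le_X; have [->|X_gt0] := posnP X; first exact: expR_ge0.
set t := trunc_log 4 l in le_X; set y := ln (n%:R : R).
have n_ge3 : (3 <= n)%N by apply: leq_trans n_ge8.
have /andP[ln2_gt0 ln2_le1] := ln2_bounds.
have l_ge4 : (4 <= l)%N by rewrite ltnS; apply: trunc_log_max.
have t_ge1 : 1 <= (t%:R : R) by rewrite (ler_nat _ 1); apply: trunc_log_max.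
have /andP[ge_y lt_y] := @trunc_log_ln 2 n isT (leq_trans (isT : 0 < 8)%N n_ge8).
have /andP[_ lt_ln_l] := @trunc_log_ln 4 l isT isT.
have l_le : l%:R * ln 2 <= 2 * y.
  have : (l%:R : R) <= 2 * (l.-1)%:R by rewrite -natrM ler_nat; move: l_ge4; lia.
  by move: ge_y; rewrite -[trunc_log 2 n]/(l.-1) -/y; nra.
have y_gt0 : 0 < y by apply: ln_gt0; rewrite ltr1n (leq_trans _ n_ge3).
have le_yl : y <= l%:R.
  by apply: le_trans (ltW lt_y) _; rewrite ler_piMr.
have ln_y_le : ln y <= 4 * t%:R.
  apply: le_trans (_ : ln (l%:R : R) <= _); first by rewrite ler_ln ?posrE ?ltr0n.
  apply: le_trans (ltW lt_ln_l) _; rewrite -/t -natr1 (_ : 4 = 2 ^+ 2); last by rewrite -natrX.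
  by rewrite lnXn // mulr2n; nra.
have ln_X := ln_nat_power_le X_gt0 le_X.
have ln_X_ge0 : 0 <= ln (X%:R : R) by apply: ln_ge0; rewrite (ler_nat _ 1).
rewrite -[X%:R]lnK ?posrE ?ltr0n // ler_expR mulrA ler_pdivlMr ?lnln_gt0 //.
apply: le_trans (_ : ln X%:R * (4 * t%:R) <= _); first by rewrite ler_wpM2l.
have : c%:R * (l%:R * ln 2) <= c%:R * (2 * y) by rewrite ler_wpM2l.
by move: ln_X; rewrite natrM -mulrA -/y; lra.
Qed.

Lemma expR_log_ratio_ge1 (a : R) (n : nat) : 0 <= a -> (3 <= n)%N -> 1 <= expR (a * log_ratio n).
Proof.
move=> a0 n_ge3; rewrite -[leLHS]expR0 ler_expR mulr_ge0 //.
exact: le_trans (log_ratio_ge1 n_ge3).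
Qed.

Lemma expR_log_ratio_lower_bound (a Q : R) (n n0 s : nat) : 0 <= a -> 0 <= Q ->
  (3 <= n)%N -> (0 < s)%N ->
  ((n0 <= n)%N -> n%:R ^+ 2 <= s%:R * (Q * expR (a * log_ratio n))) ->
  expR (- (a + (Q + (n0 ^ 2)%:R)) * log_ratio n) * n%:R ^+ 2 < s%:R.
Proof.
move=> a0 Q0 n_ge3 s_gt0 large; set u := log_ratio n.
have u1 : 1 <= u := log_ratio_ge1 n_ge3; set d := Q + _.
have n00 : 0 <= ((n0 ^ 2)%:R : R) by [].
have d0 : 0 <= d by rewrite addr_ge0.
have d_lt : d < expR (d * u).
  have le_du : d <= d * u by rewrite ler_peMr.
  by have := expR_ge1Dx (d * u); lra.
have s1 : 1 <= (s%:R : R) by rewrite (ler_nat _ 1).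
have E1 := expR_log_ratio_ge1 a0 n_ge3; rewrite -/u in large E1.
rewrite mulNr expRN mulrC ltr_pdivrMr ?expR_gt0 // mulrDl expRD.
have [/large le_n|lt_n] := leqP n0 n.
  apply: le_lt_trans le_n _; rewrite ltr_pM2l ?ltr0n // mulrC ltr_pM2l ?expR_gt0 //.
  by apply: le_lt_trans d_lt; rewrite lerDl.
have lt_n2 : n%:R ^+ 2 < (n0 ^ 2)%:R :> R by rewrite -natrX ltr_nat ltn_exp2r.
apply: lt_le_trans lt_n2 (le_trans (_ : _ <= expR (d * u)) _).
  by apply: le_trans (ltW d_lt); rewrite lerDr.
by rewrite [leRHS]mulrA ler_peMl ?expR_ge0 // mulr_ege1.
Qed.

Lemma logb_gt_nat (B z : R) (c : nat) : 2 <= B -> c%:R < logb B z -> (2 ^ c)%:R < z.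
Proof.
move=> B_ge2; have /andP[ln2_gt0 _] := ln2_bounds.
have le_lnB : ln 2 <= ln B by rewrite ler_ln ?posrE ?ltr0n // (lt_le_trans _ B_ge2) ?ltr0n.
rewrite /logb ltr_pdivlMr ?(lt_le_trans _ le_lnB) // => lt_c.
have {}lt_c : c%:R * ln 2 < ln z by apply: le_lt_trans lt_c; rewrite ler_wpM2l.
have z_gt0 : 0 < z.
  rewrite ltNge; apply/negP => /ln0 lnz; move: lt_c; rewrite lnz ltNge.
  by rewrite mulr_ge0 // ltW.
by move: lt_c; rewrite mulr_natl -lnXn // ltr_ln ?posrE ?exprn_gt0 // natrX.
Qed.

Lemma tower_lt (B1 B2 : R) (p n : nat) : 2 <= B1 -> 2 <= B2 ->
  n%:R < logb 2 (logb B1 (logb B2 p%:R)) - 1 -> (2 ^ (2 ^ n) < p)%N.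
Proof.
move=> B1_ge2 B2_ge2; rewrite ltrBrDr natr1 => /(logb_gt_nat (lexx _)).
move=> /(logb_gt_nat B1_ge2)/(logb_gt_nat B2_ge2); rewrite ltr_nat; apply: leq_ltn_trans.
by rewrite !leq_pexp2l // (leq_trans (ltnW (ltn_expl n (isT : 1 < 2)%N))) // leq_pexp2l.
Qed.
End LogRatio.

Lemma exp_lt_of_tower (n c p : nat) : (2 * c <= n)%N -> (2 ^ (2 ^ n) < p)%N -> (n ^ c < p)%N.
Proof.
move=> le_cn; apply: leq_ltn_trans; apply: leq_trans (_ : (2 ^ n) ^ c <= _)%N.
  by rewrite leq_wexp2r // ltnW // ltn_expl.
rewrite -expnM leq_pexp2l // -(leq_pmul2l (isT : (0 < 2)%N)) -expnS.
by apply: leq_trans (sqr_le_exp2 n); rewrite mulnCA leq_mul2l le_cn orbT.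
Qed.

Lemma few_factors_nat (C k : nat) : exists c0 c, forall p (A : {set 'F_p}),
  prime p -> (2 <= #|A|)%N -> (#|sumset A A| <= C * #|A|)%N -> (#|A| ^ c0 < p)%N ->
  exists S : 'F_p * algC -> Prop, [/\ forall z, integer_pair #|A| z -> S z,
    forall a, a \in A -> exists alpha, S (a, alpha)
  & forall (m : 'F_p) (xs : seq 'F_p), m != 0 -> uniq xs ->
    {in xs, forall x, factor_of S k m x} ->
    (size xs ^ trunc_log 4 (trunc_log 2 #|A|).+1 <= 2 ^ (c * (trunc_log 2 #|A|).+1))%N].
Proof.
have [D [c [c0 [c_gt0 lift]]]] := lift_small_doubling C (k + 2).
have [Kd count] := count_factors D k.
pose c1 := (c * (height_exponent k * D.+1))%N; pose c2 := (c * (2 * height_exponent k * D) * D`!)%N.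
exists c0, (D * (2 * (c1 + 5) + (2 * (c2 + 5) + c2)) + Kd)%N.
move=> p A p_pr A_ge2 le_C lt_p; have [S [liftS S_int S_A]] := lift p A p_pr A_ge2 le_C lt_p.
exists S; split=> // m xs m0 uniq_xs xsP.
set n := #|A| in A_ge2 liftS *; set l := (trunc_log 2 n).+1.
have n_gt0 : (0 < n)%N by apply: ltnW.
have nc_ge2 := leq_trans A_ge2 (leq_self_exp n c_gt0).
have [N [N_gt0 le_N le_xs]] :=
  count _ S (k + 2)%N (n ^ c)%N nc_ge2 liftS (leqnn _) m xs m0 uniq_xs xsP.
have pow_le e : ((n ^ c) ^ e <= 2 ^ (c * e * l))%N.
  by rewrite [(_ * l)%N]mulnC expnM -expnM leq_wexp2r // ltnW // trunc_log_ltn.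
have log_le x e : (x <= 2 ^ e)%N -> (trunc_log 2 x <= e)%N.
  by move=> le_x; rewrite -[leqRHS](@trunc_expnK 2) // leq_trunc_log.
have le_ND : (N ^ D`! <= 2 ^ (c2 * l))%N.
  by rewrite /c2 mulnAC expnM leq_wexp2r // (leq_trans le_N).
have tl : (4 ^ trunc_log 4 l <= l < 4 ^ (trunc_log 4 l).+1)%N by apply: trunc_log_bounds.
apply: (count_factors_power tl _ _ le_xs); first exact/log_le/pow_le.
apply: leq_trans (divisor_bound _ _) _; first by rewrite expn_gt0 N_gt0.
by rewrite leq_mul // leq_wexp2r // ltnS log_le.
Qed.

Definition factors_at_most (R : numDomainType) (F : fieldType) (S : F * algC -> Prop) (k : nat)
    (E : R) :=
  forall (m : F) (xs : seq F), m != 0 -> uniq xs -> {in xs, forall x, factor_of S k m x} ->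
  (size xs)%:R <= E.

Theorem few_factors (R : realType) (C k : nat) : exists (n0 : nat) (a : R), 0 <= a /\
  forall p (A : {set 'F_p}), prime p -> (n0 <= #|A|)%N ->
  (#|sumset A A| <= C * #|A|)%N -> (2 ^ (2 ^ #|A|) < p)%N ->
  exists S : 'F_p * algC -> Prop, [/\ forall z, integer_pair #|A| z -> S z,
    forall a, a \in A -> exists alpha, S (a, alpha)
  & factors_at_most S k (expR (a * log_ratio R #|A|))].
Proof.
have [c0 [c few]] := few_factors_nat C k.
exists (8 + 2 * c0)%N, (8 * c%:R); split; first by rewrite mulr_ge0.
move=> p A p_pr A_large le_C lt_p.
have A_ge8 : (8 <= #|A|)%N by apply: leq_trans A_large; rewrite leq_addr.
have [|||S [S_int S_A S_few]] := few p A p_pr.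
- exact: leq_trans A_ge8.
- exact: le_C.
- by apply: exp_lt_of_tower lt_p; apply: leq_trans A_large; rewrite leq_addl.
exists S; split=> // m xs m0 uniq_xs xsP.
by apply: root_le_expR_log_ratio => //; apply: S_few uniq_xs xsP.
Qed.

(** * Lower bounds for the sumsets *)

Section Fibers.
Variables (I V : finType) (P : {set I}) (g : I -> V) (S : {set V}).
Hypothesis gPS : {in P, forall i, g i \in S}.

Lemma card_sum_fibers : #|P| = (\sum_(c in S) #|[set i in P | g i == c]|)%N.
Proof.
rewrite -sum1_card (partition_big g (mem S)) //=.
by apply: eq_bigr => c _; rewrite -sum1_card; apply: eq_bigl => i; rewrite inE.
Qed.

Lemma card_le_fibers k :
  {in S, forall c, (#|[set i in P | g i == c]| <= k)%N} -> (#|P| <= #|S| * k)%N.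
Proof. by move=> le_k; rewrite card_sum_fibers -sum_nat_const; apply: leq_sum. Qed.

Lemma sum_sqr_fibers : (\sum_(c in S) #|[set i in P | g i == c]| ^ 2 =
  \sum_(x in P) #|[set y in P | g y == g x]|)%N.
Proof.
rewrite [RHS](partition_big g (mem S)) //=; apply: eq_bigr => c _.
rewrite [RHS](eq_bigr (fun=> #|[set i in P | g i == c]|)) => [|i /andP[_ /eqP->] //].
rewrite sum_nat_const; congr (_ * _)%N.
by rewrite -!sum1_card; apply: eq_bigl => i; rewrite inE.
Qed.
End Fibers.

Lemma Cauchy_Schwarz_nat (I : finType) (S : {set I}) (f : I -> nat) :
  ((\sum_(i in S) f i) ^ 2 <= #|S| * \sum_(i in S) f i ^ 2)%N.
Proof.
rewrite -(leq_pmul2l (isT : (0 < 2)%N)) -mulnn big_distrlr /= big_distrr /=.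
have -> : (2 * (#|S| * \sum_(i in S) f i ^ 2) =
    \sum_(i in S) \sum_(j in S) (f i ^ 2 + f j ^ 2))%N.
  rewrite [RHS](eq_bigr (fun i => #|S| * f i ^ 2 + \sum_(j in S) f j ^ 2)%N).
    by rewrite big_split /= sum_nat_const -big_distrr /= addnn mul2n.
  by move=> i _; rewrite big_split /= sum_nat_const.
by apply: leq_sum => i _; rewrite big_distrr; apply: leq_sum => j _; apply: nat_Cauchy.
Qed.

(* (a, b), (c, d) |-> (a, d), (c, b) turns solutions of F a + F b = F c + F d into solutions of
   F a - F d = F c - F b. *)
Lemma sum_energy_eq_diff_energy (I : finType) (V : zmodType) (A : {set I}) (F : I -> V) :
  (\sum_(x in setX A A) #|[set y in setX A A | (F y.1 + F y.2 == F x.1 + F x.2)%R]|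
   = \sum_(x in setX A A) #|[set y in setX A A | (F y.1 - F y.2 == F x.1 - F x.2)%R]|)%N.
Proof.
have sum_pairs (Q : I * I -> I * I -> bool) :
    (\sum_(x in setX A A) #|[set y in setX A A | Q x y]| =
     \sum_(z | [&& z.1 \in setX A A, z.2 \in setX A A & Q z.1 z.2]) 1)%N.
  rewrite -(pair_big_dep (fun x => x \in setX A A)
    (fun x y => (y \in setX A A) && Q x y) (fun _ _ => 1%N)) /=.
  by apply: eq_bigr => x _; rewrite -sum1_card; apply: eq_bigl => y; rewrite inE.
pose swap (z : (I * I) * (I * I)) := ((z.1.1, z.2.2), (z.2.1, z.1.2)).
have swapK : involutive swap by case=> [[a b] [c d]].
rewrite !sum_pairs (reindex_inj (inv_inj swapK)) /=; apply: eq_bigl => -[[a b] [c d]] /=.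
have -> : (F c + F b == F a + F d) = (F c - F d == F a - F b).
  by rewrite subr_eq addrAC [in RHS]eq_sym subr_eq eq_sym.
by rewrite !inE /=; case: (a \in A); case: (b \in A); case: (c \in A); case: (d \in A).
Qed.

Lemma sumset_energy (I : finType) (V : finZmodType) (A : {set I}) (F : I -> V) :
  ((#|A| ^ 2) ^ 2 <= #|sumset (F @: A) (F @: A)| *
    \sum_(x in setX A A) #|[set y in setX A A | (F y.1 - F y.2 == F x.1 - F x.2)%R]|)%N.
Proof.
have sums : {in setX A A, forall x, F x.1 + F x.2 \in sumset (F @: A) (F @: A)}.
  by move=> [a b] /setXP[aA bA]; rewrite mem_sumset ?imset_f.
rewrite -sum_energy_eq_diff_energy -(sum_sqr_fibers sums) -[(#|A| ^ 2)%N]mulnn -cardsX.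
by rewrite (card_sum_fibers sums) Cauchy_Schwarz_nat.
Qed.

Lemma ler_sum_exceptional (R : numDomainType) (I : finType) (P : {set I}) (Q : pred I)
    (f : I -> R) (M N : R) : 0 <= N -> {in P, forall i, f i <= if Q i then M else N} ->
  \sum_(i in P) f i <= M *+ #|[set i in P | Q i]| + N *+ #|P|.
Proof.
move=> N0 le_f; apply: le_trans (ler_sum _ le_f) _.
rewrite -!sumr_const (bigID Q) /=; apply: lerD.
  by rewrite (eq_bigr (fun=> M)) => [|i /andP[_ ->] //]; rewrite [leRHS](eq_bigl _ _ (in_set _)).
rewrite [leRHS](bigID Q) /= (eq_bigr (fun=> N)) => [|i /andP[_ /negPf->] //].
by rewrite lerDr sumr_ge0.
Qed.

Lemma factors_at_most_ge0 (R : numDomainType) (F : fieldType) (S : F * algC -> Prop) k (E : R) :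
  factors_at_most S k E -> 0 <= E.
Proof. by move=> /(_ 1 [::]); apply; rewrite ?oner_eq0. Qed.

Section Inverses.
Variables (F : finFieldType) (A : {set F}).

Definition inverse_pairs (c : F) := [set ab in setX A A | ab.1^-1 + ab.2^-1 == c].

Lemma inverse_pairsP c a b :
  reflect [/\ a \in A, b \in A & a^-1 + b^-1 = c] ((a, b) \in inverse_pairs c).
Proof. by rewrite !inE -andbA; apply: (iffP and3P) => -[aA bA /eqP]. Qed.

Lemma inverse_pairs_inj c : {in inverse_pairs c &, injective fst}.
Proof.
move=> [a b] [a' b'] /inverse_pairsP[_ _ Ec] /inverse_pairsP[_ _ Ec'] /= Ea.
by congr (_, _) => //; move: Ec; rewrite -Ec' Ea => /addrI/invr_inj.
Qed.

Lemma card_inverse_pairs_le c : (#|inverse_pairs c| <= #|A|)%N.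
Proof.
rewrite -(card_in_imset (@inverse_pairs_inj c)); apply/subset_leq_card/subsetP => z.
by case/imsetP=> -[a b] /inverse_pairsP[aA _ _] ->.
Qed.

Lemma same_inverse_sum_factor (a b s t : F) : a != 0 -> b != 0 -> t != 0 ->
  a^-1 + b^-1 = s / t -> (s * a - t) * (s * b - t) = t ^+ 2.
Proof.
move=> a0 b0 t0 /(congr1 (fun c => c * (t * (a * b)))) E.
have {}E : t * (a + b) = s * (a * b).
  transitivity ((a^-1 + b^-1) * (t * (a * b))); first by field; rewrite a0 b0.
  by rewrite E; field.
have -> : (s * a - t) * (s * b - t) = s * (s * (a * b) - t * (a + b)) + t ^+ 2 by ring.
by rewrite E subrr mulr0 add0r.
Qed.

Variables (R : numDomainType) (S : F * algC -> Prop) (E : R).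
Hypotheses (A0 : 0 \notin A) (S_A : forall a, a \in A -> exists alpha, S (a, alpha)).
Hypothesis few : factors_at_most S 3 E.

Lemma card_inverse_pairs_few c : c != 0 -> #|inverse_pairs c|%:R <= E.
Proof.
move=> c0; have [->|[[a0 b0]]] := set_0Vmem (inverse_pairs c).
  by rewrite cards0 (factors_at_most_ge0 few).
case/inverse_pairsP=> a0A b0A Ec; pose s := a0 + b0; pose t := a0 * b0.
have nz a : a \in A -> a != 0 by move=> aA; apply: contraNneq A0 => <-.
have t0 : t != 0 by rewrite mulf_neq0 ?nz.
have Dc : c = s / t by rewrite -Ec /s /t; field; rewrite !nz.
have s0 : s != 0 by apply: contraNneq c0 => s0; rewrite Dc s0 mul0r.
pose shift (ab : F * F) := s * ab.1 - t.
have shift_inj : {in enum (inverse_pairs c) &, injective shift}.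
  by move=> x y; rewrite !mem_enum => xc yc /addIr/(mulfI s0)/(inverse_pairs_inj xc yc).
rewrite cardE -(size_map shift); apply: (few (m := t ^+ 2)).
- by rewrite expf_neq0.
- by rewrite map_inj_in_uniq ?enum_uniq.
move=> _ /mapP[[a b] + ->]; rewrite mem_enum => /inverse_pairsP[aA bA Eab].
have [[al0 Sa0] [be0 Sb0]] := (S_A a0A, S_A b0A).
have [[al Sa] [be Sb]] := (S_A aA, S_A bA).
have shift_expressible z : S z ->
    expressible S 3 (((a0, al0) + (b0, be0)) * z - (a0, al0) * (b0, be0)).
  move=> Sz; apply: expressibleB; first apply: expressibleM.
  - by apply: expressibleD; apply: expressible_mem.
  - exact: expressible_mem.
  - by apply: expressibleM; apply: expressible_mem.
exists (s * b - t), ((al0 + be0) * al - al0 * be0), ((al0 + be0) * be - al0 * be0); split.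
- exact: shift_expressible Sa.
- exact: shift_expressible Sb.
by apply: same_inverse_sum_factor; [apply: nz | apply: nz | | rewrite Eab].
Qed.

Lemma sqr_card_le_inverse_sumset :
  (#|A| ^ 2)%:R <= #|A|%:R + E *+ #|sumset (invset A) (invset A)|.
Proof.
have sums : {in setX A A, forall ab, ab.1^-1 + ab.2^-1 \in sumset (invset A) (invset A)}.
  by move=> [a b] /setXP[aA bA]; rewrite mem_sumset ?imset_f.
rewrite -mulnn -cardsX (card_sum_fibers sums) natr_sum.
apply: le_trans (ler_sum_exceptional (Q := pred1 0) (M := #|A|%:R) (N := E) _ _) _.
- exact: factors_at_most_ge0 few.
- move=> c _ /=; case: eqVneq => [_|c0]; last exact: card_inverse_pairs_few.
  by rewrite ler_nat card_inverse_pairs_le.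
rewrite lerD2r -[leRHS]mulr1n ler_wpMn2l // -(cards1 (0 : F)) subset_leq_card //.
by apply/subsetP => c; rewrite !inE => /andP[].
Qed.
End Inverses.

Lemma card_sumset_gt0 (V : finZmodType) (A : {set V}) : A != set0 -> (0 < #|sumset A A|)%N.
Proof. by case/set0Pn=> a aA; apply/card_gt0P; exists (a + a); apply: mem_sumset. Qed.

Theorem inverse_sumset_large (R : realType) (C : nat) : exists C' : R,
  forall p (A : {set 'F_p}), prime p -> (3 <= #|A|)%N ->
  (#|sumset A A| <= C * #|A|)%N -> (2 ^ (2 ^ #|A|) < p)%N -> 0 \notin A ->
  expR (- C' * log_ratio R #|A|) * #|A|%:R ^+ 2 < #|sumset (invset A) (invset A)|%:R.
Proof.
have [n0 [a [a0 few]]] := few_factors R C 3.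
exists (a + (2 + (n0 ^ 2)%:R)) => p A p_pr A_ge3 le_C lt_p A0.
have A_neq0 : A != set0 by rewrite -card_gt0 (leq_trans _ A_ge3).
apply: expR_log_ratio_lower_bound => // [|A_large].
  by rewrite card_sumset_gt0 // imset_eq0.
have [S [_ S_A few_S]] := few p A p_pr A_large le_C lt_p.
have := sqr_card_le_inverse_sumset A0 S_A few_S; rewrite natrX -[_ *+ #|sumset _ _|]mulr_natl.
have : 3 <= #|A|%:R :> R by rewrite (ler_nat _ 3).
by move: #|A|%:R (expR _) #|sumset _ _|%:R => n E s; nra.
Qed.

Section PolynomialDifferences.
Variables (F : finFieldType) (A : {set F}) (g : {poly F}).

Lemma coef_comp_XaddC (h : F) j : (g \Po ('X + h%:P))`_j = g^`N(j).[h].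
Proof.
elim/poly_ind: g j => [|p c IHp] j; first by rewrite comp_poly0 coef0 linear0 horner0.
rewrite comp_poly_MXaddC coefD mulrDr coefD coefMX coefMC coefC !IHp.
case: j => [|j] /=; first by rewrite !nderivn0 !hornerE.
by rewrite nderivnMXaddC !hornerE.
Qed.

Lemma coef_shift_sub (h : F) : (1 < size g)%N ->
  (g \Po ('X + h%:P) - g)`_(size g).-2 = lead_coef g * (size g).-1%:R * h.
Proof.
move=> g_gt1; have [d Dg] : exists d, size g = d.+2 by exists (size g).-2; lia.
rewrite coefB coef_comp_XaddC lead_coefE Dg /=.
have sz : (size g^`N(d) <= 2)%N.
  by apply/leq_sizeP => i i_ge2; rewrite coef_nderivn nth_default ?mul0rn // Dg; lia.
rewrite (horner_coef_wide _ sz) !big_ord_recl big_ord0 !coef_nderivn /= addn0 addn1.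
by rewrite binn mulr1n binSn expr0 mulr1 expr1 addr0 addrAC subrr add0r mulr_natr.
Qed.

Lemma card_roots_lt (P : {poly F}) (B : {set F}) :
  P != 0 -> {in B, forall b, root P b} -> (#|B| < size P)%N.
Proof.
move=> P0 rootB; rewrite cardE; apply: max_poly_roots; rewrite ?enum_uniq //.
by apply/allP => b; rewrite mem_enum => /rootB.
Qed.

Definition difference_pairs (m : F) := [set ab in setX A A | g.[ab.1] - g.[ab.2] == m].

Lemma difference_pairsP m a b :
  reflect [/\ a \in A, b \in A & g.[a] - g.[b] = m] ((a, b) \in difference_pairs m).
Proof. by rewrite !inE -andbA; apply: (iffP and3P) => -[aA bA /eqP]. Qed.

Hypotheses (g_gt2 : (2 < size g)%N) (deg_g : (size g).-1%:R != 0 :> F).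

Lemma card_difference_pairs0 : (#|difference_pairs 0%R| <= #|A| * (size g).-1)%N.
Proof.
apply: (card_le_fibers (g := snd)) => [[a b] /difference_pairsP[]//|c cA].
rewrite -(card_in_imset (f := fst)) => [|[a b] [a' b']]; last first.
  by rewrite !inE /= => /andP[_ /eqP->] /andP[_ /eqP->] ->.
have g_gt0 : (0 < size g)%N by rewrite (ltn_trans _ g_gt2).
have sz_gc : size (g - (g.[c])%:P) = size g.
  by rewrite size_polyDl // size_polyN (leq_ltn_trans (size_polyC_leq1 _)) // ltnW.
rewrite -ltnS prednK // -[ltnRHS]sz_gc; apply: card_roots_lt.
  by rewrite -size_poly_gt0 sz_gc.
move=> _ /imsetP[[a b] + ->]; rewrite inE => /andP[/difference_pairsP[_ _ Eab] /eqP /= Eb].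
by rewrite rootE !hornerE -Eb Eab.
Qed.

Lemma card_difference_pairs_shift m (h : F) : h != 0 ->
  (#|[set ab in difference_pairs m | (ab.1 - ab.2 == h)%R]| <= (size g).-1)%N.
Proof.
move=> h0; rewrite -(card_in_imset (f := snd)) => [|[a b] [a' b']]; last first.
  rewrite !inE /= => /andP[_ /eqP Eh] /andP[_ /eqP Eh'] Eb.
  by congr (_, _) => //; move: Eh; rewrite -Eh' Eb => /addIr.
have g_gt0 : (0 < size g)%N by rewrite (ltn_trans _ g_gt2).
pose P := (g \Po ('X + h%:P)) - g - m%:P.
have P0 : P != 0.
  apply/eqP => /(congr1 (fun p : {poly F} => p`_(size g).-2)).
  rewrite coefB coef_shift_sub ?(ltn_trans _ g_gt2) // coef0 coefC -subn2.
  rewrite subn_eq0 leqNgt g_gt2 subr0; apply/eqP.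
  by rewrite !mulf_neq0 ?lead_coef_eq0 -?size_poly_gt0.
have sz_P : (size P <= size g)%N.
  rewrite !(leq_trans (size_polyD _ _)) // size_polyN geq_max.
  rewrite (leq_trans (size_polyC_leq1 _)) // andbT (leq_trans (size_polyD _ _)) //.
  rewrite size_polyN geq_max leqnn andbT (leq_trans (size_comp_poly_leq _ _)) //.
  by rewrite size_XaddC muln1 prednK.
rewrite -ltnS prednK //; apply: leq_trans sz_P; apply: card_roots_lt P0 _.
move=> _ /imsetP[[a b] + ->]; rewrite inE => /andP[/difference_pairsP[_ _ Eab] /= /eqP Eh].
have Ea : b + h = a by rewrite -Eh addrC subrK.
by rewrite rootE !hornerE horner_comp !hornerE Ea Eab subrr.
Qed.
End PolynomialDifferences.

Definition difference_quotient (T : comNzRingType) (f : {poly int}) (a b : T) : T :=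
  \sum_(i < size f) (f`_i)%:~R * \sum_(j < i) a ^+ (i.-1 - j) * b ^+ j.

Lemma difference_quotientP (T : comNzRingType) (f : {poly int}) (a b : T) :
  (map_poly intr f).[a] - (map_poly intr f).[b] = (a - b) * difference_quotient f a b.
Proof.
have sz_f : (size (map_poly intr f : {poly T}) <= size f)%N by apply: size_poly.
rewrite !(horner_coef_wide _ sz_f) -sumrB mulr_sumr.
by apply: eq_bigr => i _; rewrite coef_map_id0 // -mulrBr subrXX mulrCA.
Qed.

Lemma rmorph_difference_quotient (T T' : comNzRingType) (phi : {rmorphism T -> T'}) f a b :
  phi (difference_quotient f a b) = difference_quotient f (phi a) (phi b).
Proof.
rewrite rmorph_sum; apply: eq_bigr => i _; rewrite rmorphM rmorph_int rmorph_sum.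
by congr (_ * _); apply: eq_bigr => j _; rewrite rmorphM !rmorphXn.
Qed.

Lemma expressible_difference_quotient (T : comNzRingType) (S : T -> Prop) (f : {poly int}) k a b :
  (size f <= k.+1)%N -> (forall i, S (f`_i)%:~R) -> S a -> S b ->
  expressible S (3 * k + 3) (difference_quotient f a b).
Proof.
move=> sz_f Sf Sa Sb; apply: (@expressible_leq _ _ (2 * k + 2 + size f)); first by lia.
apply: expressible_sum_ord => i; have le_ik : (i <= k)%N by have := ltn_ord i; lia.
rewrite addn2; apply: expressibleM; first exact: expressible_mem.
apply: (@expressible_leq _ _ (k.+1 + i)); first by lia.
apply: expressible_sum_ord => j; have := ltn_ord j => lt_ji.
apply: expressibleM.
  by apply: (@expressible_leq _ _ (0 + (i.-1 - j))); [lia|apply/expressibleX/expressible_mem].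
by apply: (@expressible_leq _ _ (0 + j)); [lia|apply/expressibleX/expressible_mem].
Qed.

Section PolynomialEnergy.
Variables (R : numDomainType) (F : finFieldType) (A : {set F}) (f : {poly int}) (k : nat).
Variables (S : F * algC -> Prop) (E : R).
Let g : {poly F} := map_poly intr f.
Hypotheses (f_gt2 : (2 < size f)%N) (f_le : (size f <= k.+1)%N) (sz_g : size g = size f).
Hypothesis deg_f : (size f).-1%:R != 0 :> F.
Hypothesis S_f : forall i, S ((f`_i)%:~R, (f`_i)%:~R).
Hypothesis S_A : forall a, a \in A -> exists alpha, S (a, alpha).
Hypothesis few : factors_at_most S (3 * k + 3) E.

Let le_degk : ((size f).-1 <= k)%N.
Proof. by rewrite -ltnS prednK // (ltn_trans _ f_gt2). Qed.

Lemma factor_difference_pair m a b :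
  (a, b) \in difference_pairs A g m -> factor_of S (3 * k + 3) m (a - b).
Proof.
case/difference_pairsP=> aA bA Em; have [[al Sa] [be Sb]] := (S_A aA, S_A bA).
pose q := difference_quotient f (a, al) (b, be).
exists q.1, (al - be), q.2; split.
- apply: (@expressible_leq _ _ 1); first by rewrite addnC.
  by apply: (@expressibleB _ _ 0 (a, al) (b, be)); apply: expressible_mem.
- rewrite -surjective_pairing; apply: expressible_difference_quotient => // i.
  have -> : (f`_i)%:~R = ((f`_i)%:~R, (f`_i)%:~R) :> F * algC; last exact: S_f.
  apply: injective_projections; first exact: (rmorph_int (@fst F algC)).
  exact: (rmorph_int (@snd F algC)).
by rewrite -Em /q (rmorph_difference_quotient (@fst F algC)) /= difference_quotientP.
Qed.

Lemma card_difference_pairs_few m : m != 0 -> #|difference_pairs A g m|%:R <= E *+ k.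
Proof.
move=> m0; pose H := [set ab.1 - ab.2 | ab in difference_pairs A g m].
apply: le_trans (_ : (#|H| * k)%:R <= _); last first.
  rewrite natrM mulr_natr lerMn2r; apply/orP; right.
  rewrite cardE; apply: (few m0 (enum_uniq _)) => x.
  by rewrite mem_enum => /imsetP[[a b] /factor_difference_pair ? ->].
rewrite ler_nat; apply: (card_le_fibers (g := fun ab => ab.1 - ab.2)) => [ab|h].
  exact: imset_f.
case/imsetP=> -[a b] /difference_pairsP[_ _ Em] Dh.
apply: leq_trans (card_difference_pairs_shift _ _ _ _ _) _; rewrite ?sz_g //.
rewrite Dh subr_eq0; apply: contraNneq m0 => /= Eab.
by rewrite -Em Eab subrr.
Qed.

Lemma polynomial_energy_bound :
  (\sum_(x in setX A A) #|difference_pairs A g (g.[x.1] - g.[x.2])%R|)%:R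
    <= (k ^ 2 * #|A| ^ 2)%:R + E *+ (k * #|A| ^ 2).
Proof.
have le0 : (#|difference_pairs A g 0%R| <= #|A| * k)%N.
  apply: leq_trans (card_difference_pairs0 _ _) _; rewrite sz_g //.
  by rewrite leq_mul2l le_degk orbT.
rewrite natr_sum.
apply: le_trans (ler_sum_exceptional (Q := fun x => g.[x.1] - g.[x.2] == 0)
  (M := (#|A| * k)%:R) (N := E *+ k) _ _) _.
- by rewrite mulrn_wge0 // (factors_at_most_ge0 few).
- move=> x _; case: eqVneq => [->|]; last exact: card_difference_pairs_few.
  by rewrite ler_nat.
by rewrite cardsX mulnn -!mulrnA lerD2r ler_nat -expnMn [(k * #|A|)%N]mulnC -mulnn leq_mul.
Qed.

Lemma sqr_card_le_polynomial_sumset :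
  (#|A| ^ 2)%:R <= #|sumset (polyset f A) (polyset f A)|%:R * ((k ^ 2)%:R + E *+ k).
Proof.
have [->|A_neq0] := eqVneq A set0.
  by rewrite cards0 mulr_ge0 // addr_ge0 // mulrn_wge0 // (factors_at_most_ge0 few).
have A_gt0 : 0 < (#|A| ^ 2)%:R :> R by rewrite ltr0n expn_gt0 card_gt0 A_neq0.
rewrite -(ler_pM2r A_gt0) -natrM mulnn.
have := sumset_energy A (fun x => g.[x]); rewrite -(ler_nat R) natrM => /le_trans; apply.
rewrite -mulrA ler_wpM2l // (le_trans polynomial_energy_bound) //.
by rewrite mulrDl -natrM [E *+ k * _]mulr_natr -mulrnA.
Qed.
End PolynomialEnergy.

Lemma kbounded_coef k f i : kbounded k f -> (absz (f`_i)%R <= k)%N.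
Proof.
move=> /andP[sum_le _]; have [lt_i|le_i] := ltnP i (size f); last by rewrite nth_default.
by apply: leq_trans sum_le; rewrite (bigD1 (Ordinal lt_i)) //= leq_addr.
Qed.

Theorem poly_sumset_large (R : realType) (C k : nat) : (0 < k)%N -> exists C' : R,
  forall p (A : {set 'F_p}) (f : {poly int}), prime p -> (3 <= #|A|)%N ->
  (#|sumset A A| <= C * #|A|)%N -> kbounded k f -> (2 < size f)%N -> (2 ^ (2 ^ #|A|) < p)%N ->
  expR (- C' * log_ratio R #|A|) * #|A|%:R ^+ 2 < #|sumset (polyset f A) (polyset f A)|%:R.
Proof.
move=> k_gt0; have [n0 [a [a0 few]]] := few_factors R C (3 * k + 3).
exists (a + ((2 * k ^ 2)%:R + ((n0 + k) ^ 2)%:R)).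
move=> p A f p_pr A_ge3 le_C f_k f_gt2 lt_p.
have A_neq0 : A != set0 by rewrite -card_gt0 (leq_trans _ A_ge3).
apply: expR_log_ratio_lower_bound => // [|A_large].
  by rewrite card_sumset_gt0 // imset_eq0.
have [le_n0 le_k] : (n0 <= #|A|)%N /\ (k <= #|A|)%N by split; lia.
have [S [S_int S_A few_S]] := few p A p_pr le_n0 le_C lt_p.
have lt_kp : (k < p)%N.
  apply: leq_ltn_trans le_k (ltn_trans _ lt_p).
  by apply: ltn_trans (ltn_expl #|A| (isT : 1 < 2)%N) (ltn_expl _ (isT : 1 < 2)%N).
have sz_f : (size f <= k.+1)%N by case/andP: f_k.
have sz_g : size (map_poly intr f : {poly 'F_p}) = size f.
  apply: size_map_poly_id0; rewrite intr_Fp_eq0 ?(leq_ltn_trans (kbounded_coef _ f_k)) //.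
  by rewrite lead_coef_eq0 -size_poly_gt0 (ltn_trans _ f_gt2).
have deg_f : (size f).-1%:R != 0 :> 'F_p.
  by rewrite pmulrn intr_Fp_eq0 // ?eqz_nat ?absz_nat; lia.
have S_f i : S ((f`_i)%:~R, (f`_i)%:~R).
  by apply: S_int; exists f`_i => //; apply: leq_trans (kbounded_coef i f_k) le_k.
rewrite -natrX.
apply: le_trans (sqr_card_le_polynomial_sumset f_gt2 sz_f sz_g deg_f S_f S_A few_S) _.
have E_ge1 := expR_log_ratio_ge1 a0 A_ge3.
have k_ge1 : 1 <= k%:R :> R by rewrite (ler_nat _ 1).
rewrite ler_wpM2l // -[_ *+ k]mulr_natl natrM natrX.
move: (expR _) k%:R E_ge1 k_ge1 => E x E_ge1 x_ge1.
have : 0 <= x ^+ 2 * (E - 1) + E * x * (x - 1).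
  by rewrite addr_ge0 ?mulr_ge0 ?exprn_ge0 ?subr_ge0 //; lra.
by lra.
Qed.

(* [3 <= n] is what makes [log log n] defined and positive. *)
Theorem theorem4p4 (R : realType) (C : R) (hC : 0 < C) :
  (exists C' : R,
     forall (p n : nat) (A : {set 'F_p}),
       prime p -> #|A| = n -> (3 <= n)%N ->
       #|sumset A A|%:R <= C * n%:R ->
       2 * n%:R < logb (2 : R) (logb 8 (logb 32 p%:R)) - 1 ->
       0 \notin A ->
       #|sumset (invset A) (invset A)|%:R >
         expR (- C' * (ln n%:R / ln (ln n%:R))) * n%:R ^+ 2)
  /\
  (forall k : nat, (0 < k)%N ->
   exists C' : R,
     forall (p n : nat) (A : {set 'F_p}) (f : {poly int}),
       prime p -> #|A| = n -> (3 <= n)%N ->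
       #|sumset A A|%:R <= C * n%:R ->
       kbounded k f -> (2 < size f)%N ->
       n%:R < logb (2 : R) (logb (8 * k%:R) (logb (32 * k%:R ^+ 2) p%:R)) - 1 ->
       #|sumset (polyset f A) (polyset f A)|%:R >
         expR (- C' * (ln n%:R / ln (ln n%:R))) * n%:R ^+ 2).
Proof.
have le_C s n : s%:R <= C * n%:R -> (s <= (Num.truncn C).+1 * n)%N.
  move=> le_s; rewrite -(ler_nat R) natrM (le_trans le_s) //.
  by rewrite ler_wpM2r // ltW // truncnS_gt.
split=> [|k k_gt0].
  have [C' large] := inverse_sumset_large R (Num.truncn C).+1.
  exists C' => p _ A p_pr <- A_ge3 /le_C small lt_p A0; apply: large => //.
  apply: (@tower_lt R 8 32); rewrite ?ler_nat //.
  by apply: le_lt_trans lt_p; rewrite ler_peMl // (ler_nat _ 1).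
have [C' large] := poly_sumset_large R (Num.truncn C).+1 k_gt0.
exists C' => p _ A f p_pr <- A_ge3 /le_C small f_k f_gt2 lt_p; apply: large => //.
apply: (@tower_lt R (8 * k%:R) (32 * k%:R ^+ 2)) => //; rewrite -?natrX -natrM ler_nat; nia.
Qed.
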